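(* Let $H=(V,E,w)$ be a hypergraph as in the context, and let $f_1,\dots,f_k$ be $k$ vectors that are orthonormal with respect to $\langle\cdot,\cdot\rangle_w$ and satisfy $\max_{s\in[k]}\mathcal{D}_w(f_s)\le\xi$. Then a random set $S\subset V$ can be constructed in polynomial time such that, with probability $\Omega(1)$, $|S|\le\frac{24|V|}{k}$ and $$\phi(S)\le C\min\{\sqrt{r\log k},\ k\log k\log\log k\sqrt{\log r}\}\cdot\sqrt{\xi},$$ where $C$ is an absolute constant and $r$ is the size of the largest hyperedge in $E$.
   Context: $H=(V,E,w)$: $V$ finite, hyperedges nonempty subsets of $V$, $w_e\ge0$; vertex weights $w_v=\sum_{e\ni v}w_e>0$; $w(S)=\sum_{v\in S}w_v$; $\partial S$ the set of hyperedges meeting both $S$ and $V\setminus S$; $\phi(S)=\sum_{e\in\partial S}w_e/w(S)$. $\langle f,g\rangle_w=\sum_vw_vf_vg_v$. $\mathcal{D}_w(f)=\frac{\sum_{e\in E}w_e\max_{u,v\in e}(f_u-f_v)^2}{\sum_uw_uf_u^2}$. *)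

(* Defs.v *)
From mathcomp Require Import all_boot all_order all_algebra.
From mathcomp Require Import reals exp.

Set Implicit Arguments.
Unset Strict Implicit.
Unset Printing Implicit Defensive.

Import Order.TTheory GRing.Theory Num.Theory.
Local Open Scope ring_scope.

(** * Weighted hypergraphs *)

Record hypergraph (R : realType) (V : finType) := Hypergraph {
  edges : {set {set V}};
  weight : {set V} -> R;  (* only its values on [edges] matter *)
  edges_neq0 : set0 \notin edges;
  weight_ge0 : forall e, e \in edges -> 0 <= weight e;
  vweight_gt0 : forall v, 0 < \sum_(e in edges | v \in e) weight e
}.

Section Hypergraph.
Variables (R : realType) (V : finType) (H : hypergraph R V).

Definition vweight (v : V) : R := \sum_(e in edges H | v \in e) weight H e.

Definition volume (S : {set V}) : R := \sum_(v in S) vweight v.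

Definition boundary (S : {set V}) : {set {set V}} :=
  [set e in edges H | (e :&: S != set0) && (e :&: ~: S != set0)].

(* Meaningful for S != set0; phi set0 is the junk value 0 / 0 = 0. *)
Definition expansion (S : {set V}) : R :=
  (\sum_(e in boundary S) weight H e) / volume S.

Definition inner_w (f g : V -> R) : R := \sum_v vweight v * f v * g v.

Definition orthonormal_w (k : nat) (f : 'I_k -> V -> R) : Prop :=
  forall s t, inner_w (f s) (f t) = (s == t)%:R.

(* The squares are nonnegative, so 0 is a neutral default for the maxima. *)
Definition discrepancy_ratio (f : V -> R) : R :=
  (\sum_(e in edges H)
     weight H e *
     \big[Num.max/0]_(u in e) \big[Num.max/0]_(v in e) (f u - f v) ^+ 2)
  / (\sum_u vweight u * f u ^+ 2).

Definition rank : nat := \max_(e in edges H) #|e|.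

End Hypergraph.

(* Base 2 makes log (log 2) = 0; since ln vanishes at nonpositive arguments,
   log (log 1) = 0 as well. *)
Definition log2 (R : realType) (x : R) : R := ln x / ln 2.

(** * Randomized real-RAM programs

   A real RAM with unit-cost field operations, square roots and comparisons on
   reals (no rounding), addition, truncated subtraction and comparison on
   naturals, and fair coin flips. Memory consists of a natural array and a real
   array for each name [a : nat], indexed by two naturals. Programs contain no
   real constants, array names are literals, and there is no conversion from
   reals to naturals except through tests. A program has finitely many
   expressions, each of fixed size, so charging one time unit per command is the
   unit-cost measure up to a constant factor. *)

Inductive nexp :=
| NConst of nat
| NGet of nat & nexp & nexp
| NAdd of nexp & nexp
| NSub of nexp & nexp.

Inductive rexp :=
| ROfNat of nexp
| RGet of nat & nexp & nexp
| RAdd of rexp & rexp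
| RSub of rexp & rexp
| RMul of rexp & rexp
| RDiv of rexp & rexp
| RSqrt of rexp.

Inductive test :=
| NLe of nexp & nexp
| RLe of rexp & rexp.

Inductive cmd :=
| Skip
| NSet of nat & nexp & nexp & nexp  (* NSet a i j e :  a[i, j] := e *)
| RSet of nat & nexp & nexp & rexp
| Flip of nat & nexp & nexp         (* Flip a i j :  a[i, j] := fair bit *)
| Seq of cmd & cmd
| If of test & cmd & cmd
| While of test & cmd.

Section Semantics.
Variable R : realType.

Record state := State {
  nmem : nat -> nat -> nat -> nat;
  rmem : nat -> nat -> nat -> R;
  coins : seq bool
}.

Definition upd (A : Type) (M : nat -> nat -> nat -> A) (a i j : nat) (x : A) :
    nat -> nat -> nat -> A :=
  fun a' i' j' => if [&& a' == a, i' == i & j' == j] then x else M a' i' j'.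

Fixpoint neval (s : state) (e : nexp) : nat :=
  match e with
  | NConst c => c
  | NGet a i j => nmem s a (neval s i) (neval s j)
  | NAdd e1 e2 => (neval s e1 + neval s e2)%N
  | NSub e1 e2 => (neval s e1 - neval s e2)%N
  end.

Fixpoint reval (s : state) (e : rexp) : R :=
  match e with
  | ROfNat e1 => (neval s e1)%:R
  | RGet a i j => rmem s a (neval s i) (neval s j)
  | RAdd e1 e2 => reval s e1 + reval s e2
  | RSub e1 e2 => reval s e1 - reval s e2
  | RMul e1 e2 => reval s e1 * reval s e2
  | RDiv e1 e2 => reval s e1 / reval s e2
  | RSqrt e1 => Num.sqrt (reval s e1)
  end.

Definition teval (s : state) (b : test) : bool :=
  match b with
  | NLe e1 e2 => (neval s e1 <= neval s e2)%N
  | RLe e1 e2 => reval s e1 <= reval s e2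
  end.

(* A configuration is the stack of commands still to run and the state. *)
Definition config := (seq cmd * state)%type.

Definition step (x : config) : config :=
  let: (K, s) := x in
  match K with
  | [::] => x
  | c :: K' =>
    match c with
    | Skip => (K', s)
    | NSet a i j e =>
        (K', State (upd (nmem s) a (neval s i) (neval s j) (neval s e))
                   (rmem s) (coins s))
    | RSet a i j e =>
        (K', State (nmem s)
                   (upd (rmem s) a (neval s i) (neval s j) (reval s e))
                   (coins s))
    | Flip a i j =>
        (K', State (upd (nmem s) a (neval s i) (neval s j)
                        (head false (coins s) : nat))
                   (rmem s) (behead (coins s)))
    | Seq c1 c2 => ([:: c1, c2 & K'], s)
    | If b c1 c2 => ((if teval s b then c1 else c2) :: K', s)
    | While b c1 => if teval s b then ([:: c1, c & K'], s) else (K', s)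
    end
  end.

Definition run (T : nat) (c : cmd) (s : state) : config :=
  iter T step ([:: c], s).

Definition halted (x : config) : bool := nilp x.1.

(* At most T coins are used in T steps, so the law of a computation of T steps
   is given by T independent fair coins. *)
Definition coin_prob (T : nat) (P : pred (T.-tuple bool)) : R :=
  #|[set omega | P omega]|%:R / (2 ^ T)%:R.

End Semantics.

(** * Input and output of a program on (H, f)

   V, the set of hyperedges and 'I_k are listed in the order of [enum]. Natural
   array 0 holds |V|, |E|, k in row 0, natural array 1 the incidence matrix,
   real array 0 the hyperedge weights in row 0, real array 1 the matrix of f.
   All other cells are 0. The output is the set of vertices whose entry in row 0
   of natural array 2 is nonzero. *)

Section InputOutput.
Variables (R : realType) (V : finType) (H : hypergraph R V).
Variables (k : nat) (f : 'I_k -> V -> R).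

Definition load (A : Type) (x0 : A) (M : seq (seq (seq A))) :
    nat -> nat -> nat -> A :=
  fun a i j => nth x0 (nth [::] (nth [::] M a) i) j.

Definition input (omega : seq bool) : state R := State
  (load 0%N
    [:: [:: [:: #|V|; #|edges H|; k]];
        [seq [seq (v \in e : nat) | v <- enum V] | e : {set V} <- enum (edges H)]])
  (load 0
    [:: [:: [seq weight H e | e <- enum (edges H)]];
        [seq [seq f s v | v <- enum V] | s <- enum 'I_k]])
  omega.

Definition input_size : nat := (#|V| + #|edges H| + k)%N.

End InputOutput.

Definition output_set (R : realType) (V : finType) (x : config R) : {set V} :=
  [set v | nmem x.2 2%N 0%N (index v (enum V)) != 0%N].

(* Main.v *)
Require Import Defs.
From mathcomp Require Import all_boot all_order all_algebra.
From mathcomp Require Import reals exp.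
From mathcomp Require Import ring lra zify.

(* Write u_v = (f_1 v, ..., f_k v), a_v = |u_v|^2 and mu v = w_v a_v, so that mu has
   total mass k and, by orthonormality, sum_u mu u <u/|u|, v/|v|>^2 <= 1 for every v:
   a set of nearly parallel vectors has mass O(1). Let p_(s,b) v be the positive part
   of the s-th coordinate of +-u_v/|u_v|. The squares p_y(v)^2 form a probability
   distribution on the 2k symbols y = (s,b), and the affinity sum_y p_y(u) p_y(v) of
   two of these distributions lies between the correlation rho and (1 + rho) / 2: close
   vectors have close distributions, and two orthogonal vectors have affinity at most
   1/2, because the signs are recorded. With N = O(log k) independent symbols,
   vectors that are not nearly parallel become almost disjoint.

   Soft clusters: r v = prod_j p_(y_j) v. By Hellinger's inequality, thresholding r^2
   and the norms separates two vectors at a cost O(sqrt N) times their distance.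
   Summing over a star in each hyperedge, with Cauchy-Schwarz against the vertex
   weights, gives sqrt(r log k). Hard clusters: intersections of
   the level sets {v | p_y t <= p_y v}, refined until their mass is at most 2. A hyperedge
   whose vectors are within a small constant factor of each other is cut at a cost
   independent of r; the total weight of the other hyperedges is O(xi k), which is
   harmless once the cluster has mass at least 1 / O(k log k).

   Both families are far too large to enumerate, but the symbols can be fixed one by
   one by the method of conditional expectations: g (mass minus penalties for large
   cardinality) and h (cost of the cut) have estimators for which the sum of g over the
   children of a node is at least g and that of h at most h, so some child has g > 0 and
   a ratio h / g no larger than its parent's. The algorithm is thus deterministic. *)

Set Implicit Arguments.
Unset Strict Implicit.
Unset Printing Implicit Defensive.

Import Order.TTheory GRing.Theory Num.Theory.
Local Open Scope ring_scope.

(** * A language with bounded loops, compiled to real-RAM programs *)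

(** One number of rounds [N = 8 * l], where [k <= 2 ^ l < 2 * k], serves both constructions:
    [(3/4) ^ 8] and [(7/8) ^ 8] are at most [1/2], so after [N] rounds they absorb the factor [k] by
    which the penalties are too large at the root, while [(13/12) ^ 8 <= 2] keeps the growth of the
    hard cost below [2 * k]. The program knows neither [xi] nor which of the two bounds is smaller.
    It only compares ratios of cut to volume and keeps one best set across both families; that set
    satisfies both estimates, hence their minimum. In the analysis a free parameter [z > 0] stands
    for the square root of the relevant rate. Each use of Cauchy-Schwarz becomes a weighted AM-GM
    inequality with weight [z], which is additive over hyperedges and so compatible with conditional
    expectations; square roots return only at the very end. Thresholds are always values taken at
    vertices, so a node has at most [2 * k * |V|] children. For [k <= 24] the whole of [V] is small
    enough and has expansion 0; [k >= 25] leaves room for the constants of the hard estimator. *)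

(* [BCell c x] is [c] times the cell [x] of row 0 of natural array 0, that is,
   a multiple of an input dimension. *)
Inductive bnd := BConst of nat | BCell of nat & nat.

(* [IVar l] is the loop variable introduced at nesting depth [l] (outermost 0). *)
Inductive ix :=
| IConst of nat
| IVar of nat
| IGet of nat & ix & ix
| IAdd of ix & ix
| ISub of ix & ix.

Inductive hexp :=
| HNat of ix
| HGet of nat & ix & ix
| HAdd of hexp & hexp
| HSub of hexp & hexp
| HMul of hexp & hexp
| HDiv of hexp & hexp
| HSqrt of hexp
| HLe of hexp & hexp & hexp & hexp
| HSum of bnd & hexp
| HMax of bnd & hexp.

Inductive hcmd :=
| HSkip
| HSetN of nat & ix & ix & ix
| HSetR of nat & ix & ix & hexp
| HSeq of hcmd & hcmd
| HIf of hexp & hexp & hcmd & hcmd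
| HFor of bnd & hcmd.

Section Denotation.
Variable R : realType.
Implicit Types (s : state R) (r : seq nat).

Definition bval s (b : bnd) : nat :=
  match b with
  | BConst c => c
  | BCell c x => (c * nmem s 0 0 x)%N
  end.

Fixpoint ival r s (e : ix) : nat :=
  match e with
  | IConst c => c
  | IVar l => nth 0%N r l
  | IGet a i j => nmem s a (ival r s i) (ival r s j)
  | IAdd e1 e2 => (ival r s e1 + ival r s e2)%N
  | ISub e1 e2 => (ival r s e1 - ival r s e2)%N
  end.

Fixpoint maxn_R (n : nat) (F : nat -> R) : R :=
  if n is n'.+1 then Num.max (maxn_R n' F) (F n') else 0.

Fixpoint hval r s (e : hexp) : R :=
  match e with
  | HNat e1 => (ival r s e1)%:R
  | HGet a i j => rmem s a (ival r s i) (ival r s j)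
  | HAdd e1 e2 => hval r s e1 + hval r s e2
  | HSub e1 e2 => hval r s e1 - hval r s e2
  | HMul e1 e2 => hval r s e1 * hval r s e2
  | HDiv e1 e2 => hval r s e1 / hval r s e2
  | HSqrt e1 => Num.sqrt (hval r s e1)
  | HLe e1 e2 e3 e4 =>
      if hval r s e1 <= hval r s e2 then hval r s e3 else hval r s e4
  | HSum b e1 => \sum_(i < bval s b) hval (rcons r i) s e1
  | HMax b e1 => maxn_R (bval s b) (fun i => hval (rcons r i) s e1)
  end.

Fixpoint iterN (n : nat) (F : nat -> state R -> state R) s : state R :=
  if n is n'.+1 then F n' (iterN n' F s) else s.

Fixpoint heval r (c : hcmd) s : state R :=
  match c with
  | HSkip => s
  | HSetN a i j e =>
      State (upd (nmem s) a (ival r s i) (ival r s j) (ival r s e))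
            (rmem s) (coins s)
  | HSetR a i j e =>
      State (nmem s) (upd (rmem s) a (ival r s i) (ival r s j) (hval r s e))
            (coins s)
  | HSeq c1 c2 => heval r c2 (heval r c1 s)
  | HIf e1 e2 c1 c2 =>
      if hval r s e1 <= hval r s e2 then heval r c1 s else heval r c2 s
  | HFor b c1 => iterN (bval s b) (fun i => heval (rcons r i) c1) s
  end.

End Denotation.

(* Array names below 100 belong to the source program; natural array [100 + l]
   holds loop variable [l], real arrays from 100 on hold intermediate values. *)
Fixpoint iwf (l : nat) (e : ix) : bool :=
  match e with
  | IConst _ => true
  | IVar i => (i < l)%N
  | IGet a i j => [&& (a < 100)%N, iwf l i & iwf l j]
  | IAdd e1 e2 | ISub e1 e2 => iwf l e1 && iwf l e2
  end.

Fixpoint hwf (l : nat) (e : hexp) : bool :=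
  match e with
  | HNat e1 => iwf l e1
  | HGet a i j => [&& (a < 100)%N, iwf l i & iwf l j]
  | HAdd e1 e2 | HSub e1 e2 | HMul e1 e2 | HDiv e1 e2 => hwf l e1 && hwf l e2
  | HSqrt e1 => hwf l e1
  | HLe e1 e2 e3 e4 => [&& hwf l e1, hwf l e2, hwf l e3 & hwf l e4]
  | HSum _ e1 | HMax _ e1 => hwf l.+1 e1
  end.

Fixpoint cwf (l : nat) (c : hcmd) : bool :=
  match c with
  | HSkip => true
  | HSetN a i j e => [&& (0 < a < 100)%N, iwf l i, iwf l j & iwf l e]
  | HSetR a i j e => [&& (a < 100)%N, iwf l i, iwf l j & hwf l e]
  | HSeq c1 c2 => cwf l c1 && cwf l c2
  | HIf e1 e2 c1 c2 => [&& hwf l e1, hwf l e2, cwf l c1 & cwf l c2]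
  | HFor _ c1 => cwf l.+1 c1
  end.

Definition cbnd (b : bnd) : nexp :=
  match b with
  | BConst c => NConst c
  | BCell c x => iter c (NAdd (NGet 0 (NConst 0) (NConst x))) (NConst 0)
  end.

Fixpoint cix (e : ix) : nexp :=
  match e with
  | IConst c => NConst c
  | IVar l => NGet (100 + l) (NConst 0) (NConst 0)
  | IGet a i j => NGet a (cix i) (cix j)
  | IAdd e1 e2 => NAdd (cix e1) (cix e2)
  | ISub e1 e2 => NSub (cix e1) (cix e2)
  end.

Definition rtmp (d : nat) : rexp := RGet (100 + d) (NConst 0) (NConst 0).
Definition set_rtmp (d : nat) (e : rexp) : cmd :=
  RSet (100 + d) (NConst 0) (NConst 0) e.

Definition cfor (l : nat) (b : bnd) (body : cmd) : cmd :=
  let x := NGet (100 + l) (NConst 0) (NConst 0) in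
  Seq (NSet (100 + l) (NConst 0) (NConst 0) (NConst 0))
      (While (NLe (NAdd x (NConst 1)) (cbnd b))
         (Seq body
            (NSet (100 + l) (NConst 0) (NConst 0) (NAdd x (NConst 1))))).

(** Real registers are used as a stack: the value ends in register [d], and only registers from [d]
    on and loop variables from [l] on are overwritten. *)
Fixpoint cexp (l d : nat) (e : hexp) : cmd :=
  let bin op e1 e2 :=
    Seq (Seq (cexp l d e1) (cexp l d.+1 e2))
        (set_rtmp d (op (rtmp d) (rtmp d.+1))) in
  match e with
  | HNat e1 => set_rtmp d (ROfNat (cix e1))
  | HGet a i j => set_rtmp d (RGet a (cix i) (cix j))
  | HAdd e1 e2 => bin RAdd e1 e2
  | HSub e1 e2 => bin RSub e1 e2
  | HMul e1 e2 => bin RMul e1 e2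
  | HDiv e1 e2 => bin RDiv e1 e2
  | HSqrt e1 => Seq (cexp l d e1) (set_rtmp d (RSqrt (rtmp d)))
  | HLe e1 e2 e3 e4 =>
      Seq (Seq (cexp l d e1) (cexp l d.+1 e2))
          (If (RLe (rtmp d) (rtmp d.+1)) (cexp l d e3) (cexp l d e4))
  | HSum b e1 =>
      Seq (set_rtmp d (ROfNat (NConst 0)))
          (cfor l b (Seq (cexp l.+1 d.+1 e1)
                         (set_rtmp d (RAdd (rtmp d) (rtmp d.+1)))))
  | HMax b e1 =>
      Seq (set_rtmp d (ROfNat (NConst 0)))
          (cfor l b (Seq (cexp l.+1 d.+1 e1)
                         (If (RLe (rtmp d.+1) (rtmp d)) Skip
                             (set_rtmp d (rtmp d.+1)))))
  end.

Fixpoint ccmd (l : nat) (c : hcmd) : cmd :=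
  match c with
  | HSkip => Skip
  | HSetN a i j e => NSet a (cix i) (cix j) (cix e)
  | HSetR a i j e => Seq (cexp l 0 e) (RSet a (cix i) (cix j) (rtmp 0))
  | HSeq c1 c2 => Seq (ccmd l c1) (ccmd l c2)
  | HIf e1 e2 c1 c2 =>
      Seq (Seq (cexp l 0 e1) (cexp l 1 e2))
          (If (RLe (rtmp 0) (rtmp 1)) (ccmd l c1) (ccmd l c2))
  | HFor b c1 => cfor l b (ccmd l.+1 c1)
  end.

(* Running times are bounded in terms of an upper bound [M] of the input dimensions. *)
Definition bcost (M : nat) (b : bnd) : nat :=
  match b with BConst c => c | BCell c _ => (c * M)%N end.

Definition forcost (M : nat) (b : bnd) (t : nat) : nat :=
  (bcost M b * (t + 5) + 5)%N.

Fixpoint hcost (M : nat) (e : hexp) : nat :=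
  match e with
  | HNat _ | HGet _ _ _ => 1
  | HAdd e1 e2 | HSub e1 e2 | HMul e1 e2 | HDiv e1 e2 =>
      (hcost M e1 + hcost M e2 + 5)%N
  | HSqrt e1 => (hcost M e1 + 5)%N
  | HLe e1 e2 e3 e4 =>
      (hcost M e1 + hcost M e2 + (hcost M e3 + hcost M e4) + 5)%N
  | HSum b e1 | HMax b e1 => (forcost M b (hcost M e1 + 5) + 5)%N
  end.

Fixpoint ccost (M : nat) (c : hcmd) : nat :=
  match c with
  | HSkip | HSetN _ _ _ _ => 1
  | HSetR _ _ _ e => (hcost M e + 5)%N
  | HSeq c1 c2 => (ccost M c1 + ccost M c2 + 5)%N
  | HIf e1 e2 c1 c2 =>
      (hcost M e1 + hcost M e2 + (ccost M c1 + ccost M c2) + 5)%N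
  | HFor b c1 => forcost M b (ccost M c1)
  end.

(** * Polynomial bounds on running times *)

Definition poly_bounded (F : nat -> nat) : Prop :=
  exists A D, forall M, (0 < M)%N -> (F M <= A * M ^ D)%N.

Lemma poly_bounded_const c : poly_bounded (fun=> c).
Proof. by exists c, 0%N => M _; rewrite expn0 muln1. Qed.

Lemma poly_boundedD F G :
  poly_bounded F -> poly_bounded G -> poly_bounded (fun M => F M + G M)%N.
Proof.
move=> [A [D FA]] [B [E GB]]; exists (A + B)%N, (D + E)%N => M M0.
rewrite mulnDl; apply: leq_add.
  apply: leq_trans (FA _ M0) _; rewrite leq_mul2l leq_pexp2l ?orbT //.
  by rewrite leq_addr.
apply: leq_trans (GB _ M0) _; rewrite leq_mul2l leq_pexp2l ?orbT //.
by rewrite leq_addl.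
Qed.

Lemma poly_boundedM F G :
  poly_bounded F -> poly_bounded G -> poly_bounded (fun M => F M * G M)%N.
Proof.
move=> [A [D FA]] [B [E GB]]; exists (A * B)%N, (D + E)%N => M M0.
by rewrite expnD mulnACA leq_mul ?FA ?GB.
Qed.

Lemma poly_bounded_bcost b : poly_bounded (bcost^~ b).
Proof.
case: b => [c|c x] /=; first exact: poly_bounded_const.
by exists c, 1%N => M _; rewrite expn1.
Qed.

Local Hint Resolve poly_bounded_const poly_boundedD poly_boundedM
  poly_bounded_bcost : core.

Lemma poly_bounded_forcost b F :
  poly_bounded F -> poly_bounded (fun M => forcost M b (F M)).
Proof. by move=> PF; rewrite /forcost; auto. Qed.

Local Hint Resolve poly_bounded_forcost : core.

Lemma poly_bounded_hcost e : poly_bounded (hcost^~ e).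
Proof. by elim: e => /=; intros; auto 10. Qed.

Local Hint Resolve poly_bounded_hcost : core.

Lemma poly_bounded_ccost c : poly_bounded (ccost^~ c).
Proof. by elim: c => /=; intros; auto 10. Qed.

(** * Correctness of the compiler *)

Section Compiler.
Variable R : realType.
Implicit Types (s o : state R).

(** Quantifying over the remaining stack [K] lets runs be chained and nested without a separate
    frame argument. *)
Definition runs (c : cmd) s (t : nat) s' : Prop :=
  forall K, iter t (@step R) (c :: K, s) = (K, s').

Lemma runs_step c s s' : (forall K, step (c :: K, s) = (K, s')) -> runs c s 1 s'.
Proof. by move=> h K; exact: h. Qed.

Lemma runs_seq c1 c2 s s1 s2 t1 t2 :
  runs c1 s t1 s1 -> runs c2 s1 t2 s2 -> runs (Seq c1 c2) s (t1 + t2).+1 s2.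
Proof. by move=> h1 h2 K; rewrite addnC iterSr /= iterD h1 h2. Qed.

Lemma runs_if b c1 c2 s s' t :
  runs (if teval s b then c1 else c2) s t s' -> runs (If b c1 c2) s t.+1 s'.
Proof. by move=> h K; rewrite iterSr /= h. Qed.

Definition setvar l x s : state R :=
  State (upd (nmem s) (100 + l) 0%N 0%N x) (rmem s) (coins s).

Definition var l s : nat := nmem s (100 + l) 0%N 0%N.

Lemma var_setvar l x s : var l (setvar l x s) = x.
Proof. by rewrite /var /= /upd !eqxx. Qed.

Lemma neval_cbnd s b : neval s (cbnd b) = bval s b.
Proof. by case: b => //= c x; elim: c => //= c ->; rewrite mulSn. Qed.

(** [Inv] must survive any assignment to the loop variable because the loop itself initializes and
    increments it, and the body must hand the variable back unchanged. The surcharge 5 per iteration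
    covers test, sequencing and increment. *)
Lemma runs_for l b body (Inv : nat -> state R -> Prop) s n B :
  (forall i o, Inv i o -> bval o b = n) ->
  (forall i o x, Inv i o -> Inv i (setvar l x o)) ->
  (forall i o, (i < n)%N -> Inv i o -> var l o = i ->
     exists t o', [/\ (t <= B)%N, runs body o t o', Inv i.+1 o' & var l o' = i]) ->
  Inv 0%N s ->
  exists t s', [/\ (t <= n * (B + 5) + 5)%N, runs (cfor l b body) s t s' & Inv n s'].
Proof.
move=> Hb Hv Hstep I0.
pose W := While (NLe (NAdd (NGet (100 + l) (NConst 0) (NConst 0)) (NConst 1)) (cbnd b))
   (Seq body (NSet (100 + l) (NConst 0) (NConst 0)
      (NAdd (NGet (100 + l) (NConst 0) (NConst 0)) (NConst 1)))).
suff Hw m i o : (i + m = n)%N -> Inv i o -> var l o = i ->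
    exists t s', [/\ (t <= m * (B + 5) + 1)%N, runs W o t s' & Inv n s'].
  have [t [s' [ht hr hI]]] := Hw n 0%N (setvar l 0%N s) erefl (Hv _ _ 0%N I0)
                                 (var_setvar l 0 s).
  exists (1 + t).+1, s'; split=> //; first by lia.
  by apply: runs_seq hr; apply: runs_step.
elim: m i o => [|m IH] i o him Io vo.
  have ni : i = n by lia.
  exists 1%N, o; split=> //; last by rewrite -ni.
  apply: runs_step => K.
  have cond : ((nmem o (100 + l) 0 0 + 1 <= neval o (cbnd b)) = false)%N.
    rewrite neval_cbnd (Hb i) // -/(var l o) vo; lia.
  by rewrite /= cond.
have lin : (i < n)%N by lia.
have [t1 [o1 [ht1 hr1 I1 v1]]] := Hstep i o lin Io vo.
have him2 : (i.+1 + m = n)%N by lia.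
have [t2 [s' [ht2 hr2 I2]]] := IH i.+1 (setvar l i.+1 o1) him2 (Hv _ _ _ I1) (var_setvar _ _ _).
exists (t2 + (t1 + 1).+1.+1)%N, s'; split=> //; first by nia.
move=> K; rewrite iterD.
suff -> : iter (t1 + 1).+2 (step (R:=R)) (W :: K, o) = (W :: K, setvar l i.+1 o1) by rewrite hr2.
rewrite iterSr.
have -> : step (W :: K, o) = (Seq body (NSet (100 + l) (NConst 0) (NConst 0)
      (NAdd (NGet (100 + l) (NConst 0) (NConst 0)) (NConst 1))) :: W :: K, o).
  have cond : (nmem o (100 + l) 0 0 + 1 <= neval o (cbnd b))%N.
    rewrite neval_cbnd (Hb i) // -/(var l o) vo; lia.
  by rewrite /= cond.
have h2 : runs (NSet (100 + l) (NConst 0) (NConst 0)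
      (NAdd (NGet (100 + l) (NConst 0) (NConst 0)) (NConst 1))) o1 1 (setvar l i.+1 o1).
  by move=> K'; rewrite /= -/(var l o1) v1 /setvar /= addn1.
exact: (runs_seq hr1 h2).
Qed.

(* [conc r s o]: the concrete state [o] implements the source state [s] under
   the values [r] of the loop variables. *)
Definition conc (r : seq nat) s o : Prop :=
  [/\ forall l, (l < size r)%N -> var l o = nth 0%N r l,
      forall a i j, (a < 100)%N -> nmem o a i j = nmem s a i j &
      forall a i j, (a < 100)%N -> rmem o a i j = rmem s a i j].

(** The frame of code compiled at depth [l] and register [d]. A value left in register [d] thus
    survives the evaluation of a second operand in [d.+1]. *)
Definition agree (l d : nat) o o' : Prop :=
  (forall a i j, (a < 100 + l)%N -> nmem o' a i j = nmem o a i j) /\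
  (forall a i j, (a < 100 + d)%N -> rmem o' a i j = rmem o a i j).

Lemma agree_conc r d s o o' : agree (size r) d o o' -> conc r s o -> conc r s o'.
Proof.
move=> [a1 a2] [c1 c2 c3]; split.
- by move=> l hl; rewrite -c1 // /var a1 // ltn_add2l.
- by move=> a i j ha; rewrite a1 ?c2 //; lia.
- by move=> a i j ha; rewrite a2 ?c3 //; lia.
Qed.

Lemma agree_trans l d o1 o2 o3 : agree l d o1 o2 -> agree l d o2 o3 -> agree l d o1 o3.
Proof.
by move=> [a1 a2] [b1 b2]; split=> a i j ha; [rewrite b1 ?a1|rewrite b2 ?a2].
Qed.

Lemma agree_sub l d l' d' o o' : (l <= l')%N -> (d <= d')%N ->
  agree l' d' o o' -> agree l d o o'.
Proof. by move=> hl hd [a1 a2]; split=> a i j ha; [apply: a1|apply: a2]; lia. Qed.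

Lemma neval_cix r s o e : conc r s o -> iwf (size r) e -> neval o (cix e) = ival r s e.
Proof.
move=> [c1 c2 c3]; elim: e => //=.
- by move=> a i IHi j IHj /and3P[ha hi hj]; rewrite IHi // IHj // c2.
- by move=> e1 IH1 e2 IH2 /andP[h1 h2]; rewrite IH1 // IH2.
- by move=> e1 IH1 e2 IH2 /andP[h1 h2]; rewrite IH1 // IH2.
Qed.

Lemma conc_bval r s o b : conc r s o -> bval o b = bval s b.
Proof. by case: b => //= c x [_ c2 _]; rewrite c2. Qed.

Definition rset d x o : state R :=
  State (nmem o) (upd (rmem o) (100 + d) 0%N 0%N x) (coins o).

Definition rget d o : R := rmem o (100 + d) 0%N 0%N.

Lemma runs_set_rtmp d e o : runs (set_rtmp d e) o 1 (rset d (reval o e) o).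
Proof. by []. Qed.

Lemma rget_rset d x o : rget d (rset d x o) = x.
Proof. by rewrite /rget /= /upd !eqxx. Qed.

Lemma agree_rset l d x o : agree l d o (rset d x o).
Proof.
split=> //= a i j ha; rewrite /upd; case: eqP => //= e; move: ha; rewrite e; lia.
Qed.

Lemma agree_setvar l d x o : agree l d o (setvar l x o).
Proof.
split=> //= a i j ha; rewrite /upd; case: eqP => //= e; move: ha; rewrite e; lia.
Qed.

Definition bounded_dims M s : Prop := forall x, (nmem s 0%N 0%N x <= M)%N.

Lemma bcost_bval M s b : bounded_dims M s -> (bval s b <= bcost M b)%N.
Proof. by move=> hM; case: b => //= c x; rewrite leq_mul2l hM orbT. Qed.

Definition cexp_spec M e := forall r d s o,
  hwf (size r) e -> conc r s o -> bounded_dims M s ->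
  exists t o', [/\ (t <= hcost M e)%N, runs (cexp (size r) d e) o t o',
    agree (size r) d o o' & rget d o' = hval r s e].

Lemma runs_two M e1 e2 r d s o : cexp_spec M e1 -> cexp_spec M e2 ->
  hwf (size r) e1 -> hwf (size r) e2 -> conc r s o -> bounded_dims M s ->
  exists t o', [/\ (t <= hcost M e1 + hcost M e2 + 1)%N,
    runs (Seq (cexp (size r) d e1) (cexp (size r) d.+1 e2)) o t o',
    agree (size r) d o o', rget d o' = hval r s e1 & rget d.+1 o' = hval r s e2].
Proof.
move=> H1 H2 w1 w2 co bo.
have [t1 [o1 [ht1 hr1 ag1 v1]]] := H1 r d s o w1 co bo.
have co1 := agree_conc ag1 co.
have [t2 [o2 [ht2 hr2 ag2 v2]]] := H2 r d.+1 s o1 w2 co1 bo.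
exists (t1 + t2).+1, o2; split=> //; first by lia.
- exact: runs_seq hr1 hr2.
- by apply: agree_trans ag1 _; apply: agree_sub ag2.
- by rewrite -v1 /rget; case: ag2 => _ -> //; rewrite addnS ltnS.
Qed.

Lemma cexp_bin M op (op' : R -> R -> R) e1 e2 r d s o :
  (forall o x y, reval o (op x y) = op' (reval o x) (reval o y)) ->
  cexp_spec M e1 -> cexp_spec M e2 ->
  hwf (size r) e1 && hwf (size r) e2 -> conc r s o -> bounded_dims M s ->
  exists t o', [/\ (t <= hcost M e1 + hcost M e2 + 5)%N,
    runs (Seq (Seq (cexp (size r) d e1) (cexp (size r) d.+1 e2))
        (set_rtmp d (op (rtmp d) (rtmp d.+1)))) o t o',
    agree (size r) d o o' & rget d o' = op' (hval r s e1) (hval r s e2)].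
Proof.
move=> Hop H1 H2 /andP[w1 w2] co bo.
have [t [o1 [ht hr ag v1 v2]]] := runs_two d H1 H2 w1 w2 co bo.
exists (t + 1).+1; eexists; split.
- by lia.
- by apply: runs_seq hr _; apply: runs_set_rtmp.
- by apply: agree_trans ag _; apply: agree_rset.
- by rewrite rget_rset Hop /= -/(rget d o1) -/(rget d.+1 o1) v1 v2.
Qed.

(** Common to sums and maxima: [F n] is the accumulator after [n] iterations and [upd_acc] the code
    that absorbs the next value. *)
Lemma cexp_loop M b e r d s o (F : nat -> R) upd_acc B :
  cexp_spec M e -> hwf (size r).+1 e -> conc r s o -> bounded_dims M s ->
  (forall n o1 x, (n < bval s b)%N -> rget d o1 = F n -> rget d.+1 o1 = x ->
     x = hval (rcons r n) s e ->
     exists t, (t <= B)%N /\ runs upd_acc o1 t (rset d (F n.+1) o1)) ->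
  F 0%N = 0 ->
  exists t o', [/\ (t <= forcost M b (hcost M e + B + 1) + 2)%N,
    runs (Seq (set_rtmp d (ROfNat (NConst 0)))
       (cfor (size r) b (Seq (cexp (size r).+1 d.+1 e) upd_acc))) o t o',
    agree (size r) d o o' & rget d o' = F (bval s b)].
Proof.
move=> He we co bo Hupd F0.
pose Inv n o1 := agree (size r) d o o1 /\ rget d o1 = F n.
have [||| |t [o' [ht hr [ag v]]]] := @runs_for (size r) b
   (Seq (cexp (size r).+1 d.+1 e) upd_acc) Inv (rset d 0 o) (bval s b) (hcost M e + B + 1)%N.
- by move=> i o1 [ag _]; apply: conc_bval (agree_conc ag co).
- by move=> i o1 x [ag v]; split=> //; apply: agree_trans ag _; apply: agree_setvar.
- move=> i o1 hi [ag v] vi.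
  have co1 := agree_conc ag co.
  have co2 : conc (rcons r i) s o1.
    case: co1 => c1 c2 c3; split=> // l; rewrite size_rcons ltnS nth_rcons => hl.
    case: ltngtP hl => // h _; [exact: c1|by rewrite h].
  have szr : size (rcons r i) = (size r).+1 by rewrite size_rcons.
  have := He (rcons r i) d.+1 s o1; rewrite szr => /(_ we co2 bo).
  move=> [t1 [o2 [ht1 hr1 ag1 v1]]].
  have F2 : rget d o2 = F i.
    by rewrite -v /rget; case: ag1 => _ -> //; rewrite addnS ltnS.
  have [t2 [ht2 hr2]] := Hupd i o2 (rget d.+1 o2) hi F2 erefl v1.
  exists (t1 + t2).+1, (rset d (F i.+1) o2); split.
  + by lia.
  + exact: runs_seq hr1 hr2.
  + split; last by rewrite rget_rset.
    apply: agree_trans ag _; apply: agree_trans (agree_rset _ _ _ _).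
    exact: agree_sub ag1.
  + by rewrite -vi /var; case: ag1 => /= -> //; rewrite addnS ltnS.
- by split; [apply: agree_rset|rewrite rget_rset F0].
exists (1 + t).+1, o'; split=> //.
  rewrite /forcost; apply: (@leq_trans (t + 2)); first by lia.
  rewrite leq_add2r; apply: leq_trans ht _; rewrite leq_add2r leq_mul2r.
  by rewrite (bcost_bval b bo) orbT.
by apply: runs_seq hr; apply: runs_set_rtmp.
Qed.

Lemma forcost_leq M b t t' : (t <= t')%N -> (forcost M b t <= forcost M b t')%N.
Proof. by move=> h; rewrite /forcost leq_add2r leq_mul2l leq_add2r h orbT. Qed.

Lemma cexpP M e : cexp_spec M e.
Proof.
elim: e.
- move=> e r d s o w co bo; exists 1%N; eexists; split; [by []|exact: runs_set_rtmp|..].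
  + exact: agree_rset.
  + by rewrite rget_rset /= (neval_cix co).
- move=> a i j r d s o /and3P[wa wi wj] co bo; exists 1%N; eexists; split; [by []|exact: runs_set_rtmp|..].
  + exact: agree_rset.
  + by rewrite rget_rset /= !(neval_cix co) //; case: co => _ _ ->.
- by move=> e1 H1 e2 H2 r d s o w co bo; apply: cexp_bin.
- by move=> e1 H1 e2 H2 r d s o w co bo; apply: (@cexp_bin M RSub (fun x y => x - y)).
- by move=> e1 H1 e2 H2 r d s o w co bo; apply: cexp_bin.
- by move=> e1 H1 e2 H2 r d s o w co bo; apply: (@cexp_bin M RDiv (fun x y => x / y)).
- move=> e He r d s o w co bo.
  have [t [o1 [ht hr ag v]]] := He r d s o w co bo.
  exists (t + 1).+1; eexists; split.
  + by rewrite /=; lia.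
  + by apply: runs_seq hr _; apply: runs_set_rtmp.
  + by apply: agree_trans ag _; apply: agree_rset.
  + by rewrite rget_rset /= -/(rget d o1) v.
- move=> e1 H1 e2 H2 e3 H3 e4 H4 r d s o /and4P[w1 w2 w3 w4] co bo.
  have [t [o1 [ht hr ag v1 v2]]] := runs_two d H1 H2 w1 w2 co bo.
  have co1 := agree_conc ag co.
  have [t3 [o3 [ht3 hr3 ag3 v3]]] := H3 r d s o1 w3 co1 bo.
  have [t4 [o4 [ht4 hr4 ag4 v4]]] := H4 r d s o1 w4 co1 bo.
  have tE : teval o1 (RLe (rtmp d) (rtmp d.+1)) = (hval r s e1 <= hval r s e2).
    by rewrite /= -/(rget d o1) -/(rget d.+1 o1) v1 v2.
  rewrite /=; case: ifP => hle.
  + exists (t + t3.+1).+1, o3; split=> //; first by lia.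
    * by apply: runs_seq hr _; apply: runs_if; rewrite tE hle.
    * exact: agree_trans ag ag3.
  + exists (t + t4.+1).+1, o4; split=> //; first by lia.
    * by apply: runs_seq hr _; apply: runs_if; rewrite tE hle.
    * exact: agree_trans ag ag4.
- move=> b e He r d s o w co bo.
  have [||t [o' [ht hr ag v]]] := @cexp_loop M b e r d s o
    (fun n => \sum_(i < n) hval (rcons r i) s e)
    (set_rtmp d (RAdd (rtmp d) (rtmp d.+1))) 1 He w co bo.
  + move=> n o1 x hn h1 h2 xE; exists 1%N; split=> //.
    by rewrite big_ord_recr /= -xE -h1 -h2; apply: runs_set_rtmp.
  + by rewrite big_ord0.
  exists t, o'; split=> //=; apply: leq_trans ht _.
  apply: leq_add => //; apply: forcost_leq; lia.
- move=> b e He r d s o w co bo.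
  have [||t [o' [ht hr ag v]]] := @cexp_loop M b e r d s o
    (fun n => maxn_R n (fun i => hval (rcons r i) s e))
    (If (RLe (rtmp d.+1) (rtmp d)) Skip (set_rtmp d (rtmp d.+1))) 4 He w co bo.
  + move=> n o1 x hn h1 h2 xE.
    have tE : teval o1 (RLe (rtmp d.+1) (rtmp d)) = (x <= rget d o1) by rewrite -h2.
    have -> : maxn_R n.+1 (fun i => hval (rcons r i) s e) = Num.max (rget d o1) x.
      by rewrite /= -xE h1.
    exists (1.+1); split=> //; apply: runs_if; rewrite tE maxEle.
    case: (leP x (rget d o1)) => hx; last first.
      by rewrite (ltW hx) -h2; apply: runs_set_rtmp.
    have -> : (if rget d o1 <= x then x else rget d o1) = rget d o1.
      by case: ifP => // h; apply/eqP; rewrite eq_le h hx.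
    (* The compiled maximum skips the store when the old value wins, whereas the invariant speaks of
       a store; storing the value already present is the identity on states, by extensionality. *)
    suff -> : rset d (rget d o1) o1 = o1 by [].
    case: (o1) => nm rm cs; rewrite /rset /rget /=; congr State.
    apply/boolp.funext => a; apply/boolp.funext => i; apply/boolp.funext => j.
    by rewrite /upd; case: and3P => // -[/eqP -> /eqP -> /eqP ->].
  + by [].
  exists t, o'; split=> //=; apply: leq_trans ht _.
  apply: leq_add => //; apply: forcost_leq; lia.
Qed.

(** Well-formed commands never write natural array 0, so loop bounds, which the compiled loop
    evaluates again at every test, stay constant. *)
Lemma heval_dims r c s x : cwf (size r) c ->
  nmem (heval r c s) 0%N 0%N x = nmem s 0%N 0%N x.
Proof.
elim: c r s => //=.
- move=> a i j e r s /and4P[/andP[a0 _] _ _ _]; rewrite /upd.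
  by case: eqP => // a1; rewrite -a1 in a0.
- by move=> c1 H1 c2 H2 r s /andP[w1 w2]; rewrite H2 // H1.
- move=> e1 e2 c1 H1 c2 H2 r s /and4P[_ _ w1 w2].
  by case: ifP => _; [apply: H1|apply: H2].
- move=> b c H r s w; elim: (bval s b) => //= n IH; rewrite H ?IH //.
  by rewrite size_rcons.
Qed.

Lemma ccmdP M c r s o : cwf (size r) c -> conc r s o -> bounded_dims M s ->
  exists t o', [/\ (t <= ccost M c)%N, runs (ccmd (size r) c) o t o' &
    conc r (heval r c s) o'].
Proof.
elim: c r s o.
- by move=> r s o _ co _; exists 1%N, o.
- move=> a i j e r s o /and4P[/andP[a0 a1] wi wj we] co bo.
  exists 1%N; eexists; split; [by []|exact: runs_step|].
  rewrite !(neval_cix co) //; case: co => c1 c2 c3; split=> //=.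
  + by move=> l hl; rewrite /var /= /upd; case: eqP => [h|_]; [lia|exact: c1].
  + by move=> a' i' j' ha; rewrite /upd; case: ifP => // _; apply: c2.
- move=> a i j e r s o /and4P[wa wi wj we] co bo.
  have [t [o1 [ht hr ag v]]] := cexpP 0 we co bo.
  have co1 := agree_conc ag co.
  exists (t + 1).+1; eexists; split; first by rewrite /=; lia.
  + by apply: runs_seq hr _; apply: runs_step.
  + rewrite /= !(neval_cix co1) // -[rmem o1 100 0 0]/(rget 0 o1) v.
    case: co1 => c1 c2 c3; split=> //= a' i' j' ha.
    by rewrite /upd; case: ifP => // _; apply: c3.
- move=> c1 H1 c2 H2 r s o /andP[w1 w2] co bo.
  have [t1 [o1 [ht1 hr1 co1]]] := H1 r s o w1 co bo.
  have bo1 : bounded_dims M (heval r c1 s) by move=> x; rewrite heval_dims.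
  have [t2 [o2 [ht2 hr2 co2]]] := H2 r _ o1 w2 co1 bo1.
  exists (t1 + t2).+1, o2; split=> //=; first by lia.
  exact: runs_seq hr1 hr2.
- move=> e1 e2 c1 H1 c2 H2 r s o /and4P[w1 w2 w3 w4] co bo.
  have [t [o1 [ht hr ag v1 v2]]] := runs_two 0 (@cexpP M e1) (@cexpP M e2) w1 w2 co bo.
  have co1 := agree_conc ag co.
  have [t3 [o3 [ht3 hr3 co3]]] := H1 r s o1 w3 co1 bo.
  have [t4 [o4 [ht4 hr4 co4]]] := H2 r s o1 w4 co1 bo.
  have tE : teval o1 (RLe (rtmp 0) (rtmp 1)) = (hval r s e1 <= hval r s e2).
    by rewrite /= -[rmem o1 100 0 0]/(rget 0 o1) -[rmem o1 101 0 0]/(rget 1 o1) v1 v2.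
  rewrite /=; case: ifP => hle.
  + exists (t + t3.+1).+1, o3; split=> //; first by lia.
    by apply: runs_seq hr _; apply: runs_if; rewrite tE hle.
  + exists (t + t4.+1).+1, o4; split=> //; first by lia.
    by apply: runs_seq hr _; apply: runs_if; rewrite tE hle.
- move=> b c H r s o w co bo.
  pose F := fun n => iterN n (fun i => heval (rcons r i) c) s.
  have wc i : cwf (size (rcons r i)) c by rewrite size_rcons.
  have Fd n x : nmem (F n) 0%N 0%N x = nmem s 0%N 0%N x.
    by elim: n => //= n IH; rewrite heval_dims.
  have [|||//|t [o' [ht hr co']]] := @runs_for (size r) b (ccmd (size r).+1 c)
    (fun n o1 => conc r (F n) o1) o (bval s b) (ccost M c).
  + move=> i o1 co1; rewrite (conc_bval b co1).
    by case: (b) => //= c' x; rewrite Fd.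
  + by move=> i o1 x co1; apply: agree_conc co1; apply: (@agree_setvar _ 0).
  + move=> i o1 hi co1 vi.
    have co2 : conc (rcons r i) (F i) o1.
      case: co1 => c1 c2 c3; split=> // l; rewrite size_rcons ltnS nth_rcons => hl.
      case: ltngtP hl => // h _; [exact: c1|by rewrite h].
    have bo2 : bounded_dims M (F i) by move=> x; rewrite Fd.
    have [t1 [o2 [ht1 hr1 [c1 c2 c3]]]] := H (rcons r i) (F i) o1 (wc i) co2 bo2.
    rewrite size_rcons in hr1 c1.
    exists t1, o2; split=> //.
      split=> // l hl; rewrite c1; last by rewrite ltnS ltnW.
      by rewrite nth_rcons hl.
    by rewrite c1 // nth_rcons ltnn eqxx.
  exists t, o'; split=> //=.
  apply: leq_trans ht _; rewrite /forcost leq_add2r leq_mul2r.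
  by rewrite (bcost_bval b bo) orbT.
Qed.

Lemma iter_step_halted t (s : state R) : iter t (@step R) ([::], s) = ([::], s).
Proof. by elim: t => //= t ->. Qed.

Lemma run_ccmd M c s T : cwf 0 c -> bounded_dims M s -> (ccost M c <= T)%N ->
  exists o, run T (ccmd 0 c) s = ([::], o) /\ conc [::] (heval [::] c s) o.
Proof.
move=> wc bo hT.
have cs : conc [::] s s by [].
have [t [o [ht hr co]]] := @ccmdP M c [::] s s wc cs bo.
exists o; split=> //.
rewrite /run -(subnK (leq_trans ht hT)) iterD hr; exact: iter_step_halted.
Qed.

End Compiler.

(** * Layer-cake weights *)

(** A uniformly random level as a finite sum. Remove an element [m] of maximal value: by induction
    the other weights add up to the second largest value (or to 0), and [m] receives the gap, which
    is 0 in case of a tie. *)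
Lemma layer_cake (R : realType) (T : finType) (F : T -> R) :
  (forall v, 0 <= F v) ->
  exists l : T -> R, (forall t, 0 <= l t) /\
    forall v, \sum_t l t * (F t <= F v)%R%:R = F v.
Proof.
move=> F0.
suff [l [l0 hl]] : exists l : T -> R, (forall t, 0 <= l t) /\
    forall v, v \in [set: T] -> \sum_(t in [set: T]) l t * (F t <= F v)%R%:R = F v.
  exists l; split=> // v; rewrite -[RHS]hl ?inE //.
  by apply: eq_bigl => t; rewrite inE.
have [n] := ubnP #|[set: T]|; elim: n [set: T] => // n IH A hA.
have [->|/set0Pn[v0 Av0]] := eqVneq A set0.
  by exists (fun=> 0); split=> // v; rewrite inE.
pose m := [arg max_(v > v0 in A) F v]%O.
have [Am hm] : m \in A /\ forall v, v \in A -> F v <= F m.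
  by rewrite /m; case: Order.TotalTheory.arg_maxP => // i Ai hi; split.
have [|l [l0 hl]] := IH (A :\ m).
  by move: hA; rewrite (cardsD1 m A) Am.
have sum_le : \sum_(t in A :\ m) l t <= F m.
  have [->|/set0Pn[v1 Av1]] := eqVneq (A :\ m) set0; first by rewrite big_set0.
  pose m' := [arg max_(v > v1 in A :\ m) F v]%O.
  have [Am' hm'] : m' \in A :\ m /\ forall v, v \in A :\ m -> F v <= F m'.
    by rewrite /m'; case: Order.TotalTheory.arg_maxP => // i Ai hi; split.
  have -> : \sum_(t in A :\ m) l t = F m'.
    rewrite -[RHS]hl //; apply: eq_bigr => t ht.
    by rewrite hm' // mulr1.
  by apply: hm; move: Am'; rewrite !inE => /andP[].
exists (fun t => if t == m then F m - \sum_(t in A :\ m) l t else l t).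
split=> [t|v Av]; first by case: eqP => // _; rewrite subr_ge0.
rewrite (big_setD1 m) //= eqxx.
rewrite [X in _ + X](eq_bigr (fun t => l t * (F t <= F v)%R%:R)); last first.
  by move=> t; rewrite !inE => /andP[/negPf -> _].
have [->|nvm] := eqVneq v m.
  rewrite lexx mulr1 [X in _ + X](eq_bigr l) ?subrK // => t.
  by rewrite !inE => /andP[_ /hm ->]; rewrite mulr1.
have Av' : v \in A :\ m by rewrite !inE nvm.
rewrite hl //; case: (leP (F m) (F v)) => hmv; last by rewrite mulr0 add0r.
have e : F v = F m by apply/eqP; rewrite eq_le hmv hm.
have -> : \sum_(t in A :\ m) l t = F v.
  rewrite -[RHS]hl //; apply: eq_bigr => t; rewrite !inE => /andP[_ /hm].
  by rewrite -e => ->; rewrite mulr1.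
by rewrite -e subrr mul0r add0r.
Qed.

(** Thresholds compare [G], which the program has at hand; the weights reproduce [G ^+ 2], which is
    what adds up to masses and probabilities. *)
Lemma layer_cake_sqr (R : realType) (T : finType) (G : T -> R) :
  (forall v, 0 <= G v) ->
  exists l : T -> R, (forall t, 0 <= l t) /\
    forall v, \sum_t l t * (G t <= G v)%R%:R = G v ^+ 2.
Proof.
move=> G0; have [//|l [l0 hl]] := @layer_cake R T (fun v => G v ^+ 2).
  by move=> v; apply: sqr_ge0.
exists l; split=> // v; rewrite -[RHS]hl; apply: eq_bigr => t _.
by rewrite ler_pXn2r ?nnegrE.
Qed.

Section Cake.
Variables (R : realType) (T : finType) (l G F : T -> R).
Hypothesis l0 : forall t, 0 <= l t.
Hypothesis hl : forall v, \sum_t l t * (G t <= G v)%R%:R = F v.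

Lemma cake_mono u v : G u <= G v -> F u <= F v.
Proof.
move=> huv; rewrite -!hl; apply: ler_sum => t _; apply: ler_wpM2l => //.
rewrite ler_nat; case: (leP (G t) (G u)) => // h.
by rewrite (le_trans h huv).
Qed.

(** Level sets are nested: two elements are both selected exactly when the lower one is. *)
Lemma cake_min u v :
  \sum_t l t * ((G t <= G u)%R && (G t <= G v)%R)%:R = Num.min (F u) (F v).
Proof.
wlog huv : u v / G u <= G v.
  move=> h; case: (leP (G u) (G v)) => [|/ltW] huv; first exact: h.
  by rewrite minC -h //; apply: eq_bigr => t _; rewrite andbC.
rewrite min_l ?cake_mono // -hl; apply: eq_bigr => t _.
by case: (leP (G t) (G u)) => //= h; rewrite (le_trans h huv).
Qed.

Lemma cake_ex (A : {set T}) B : 0 <= B -> (forall v, v \in A -> F v <= B) ->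
  \sum_t l t * [exists v in A, G t <= G v]%R%:R <= B.
Proof.
move=> B0 hB; have [A0|/set0Pn[v0 Av0]] := eqVneq A set0.
  rewrite big1 // => t _; suff -> : [exists v in A, G t <= G v] = false by rewrite mulr0.
  by apply/existsP => -[v]; rewrite A0 inE.
pose m := [arg max_(v > v0 in A) G v]%O.
have [Am hm] : m \in A /\ forall v, v \in A -> G v <= G m.
  by rewrite /m; case: Order.TotalTheory.arg_maxP => // i Ai hi; split.
apply: le_trans (hB m Am); rewrite -hl; apply: ler_sum => t _.
apply: ler_wpM2l => //; rewrite ler_nat; case: existsP => //= -[v /andP[Av hv]].
by rewrite (le_trans hv (hm v Av)).
Qed.

Lemma cake_total B : 0 <= B -> (forall v, F v <= B) -> \sum_t l t <= B.
Proof.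
move=> B0 hB; apply: le_trans (@cake_ex setT B B0 _) => //.
apply: ler_sum => t _; suff -> : [exists v in [set: T], G t <= G v] by rewrite mulr1.
by apply/existsP; exists t; rewrite inE lexx.
Qed.

(** Only thresholds between the minimum and the maximum over [A] separate [A], and their weight is
    the difference of the two values of [F]. The cardinality of [A] does not enter, which is how the
    hard clusters avoid the factor [r]. *)
Lemma cake_split (A : {set T}) c D : c \in A ->
  (forall v, v \in A -> `|F v - F c| <= D) ->
  \sum_t l t * ([exists v in A, G t <= G v] && ~~ [forall v in A, G t <= G v])%R%:R
    <= 2 * D.
Proof.
move=> Ac hD.
pose m := [arg max_(v > c in A) G v]%O.
have [Am hm] : m \in A /\ forall v, v \in A -> G v <= G m.
  by rewrite /m; case: Order.TotalTheory.arg_maxP => // i Ai hi; split.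
pose m' := [arg min_(v < c in A) G v]%O.
have [Am' hm'] : m' \in A /\ forall v, v \in A -> G m' <= G v.
  by rewrite /m'; case: Order.TotalTheory.arg_minP => // i Ai hi; split.
apply: (@le_trans _ _ (F m - F m')).
  rewrite -!hl -sumrB; apply: ler_sum => t _; rewrite -mulrBr.
  apply: ler_wpM2l => //.
  case: (leP (G t) (G m')) => h.
    rewrite (le_trans h (hm' _ Am)) subrr.
    suff -> : [forall v in A, G t <= G v] by rewrite andbF.
    by apply/forallP => v; apply/implyP => Av; rewrite (le_trans h (hm' _ Av)).
  rewrite subr0 ler_nat; case: existsP => //= -[v /andP[Av hv]].
  by rewrite (le_trans hv (hm _ Av)); case: (~~ _).
have := hD m Am; have := hD m' Am'; rewrite !ler_norml => /andP[? ?] /andP[? ?].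
lra.
Qed.

End Cake.

(** * The embedding of the vertices into R^k *)

Section Pos.
Variable R : realType.
Implicit Types x y : R.

Definition pos x : R := if 0 <= x then x else 0.
Definition spos (b : bool) x : R := pos (if b then - x else x).

Lemma pos_ge0 x : 0 <= pos x.
Proof. by rewrite /pos; case: ifP. Qed.

Lemma spos_ge0 b x : 0 <= spos b x.
Proof. exact: pos_ge0. Qed.

Lemma sum_spos_sq x : \sum_b spos b x ^+ 2 = x ^+ 2.
Proof.
rewrite big_bool /spos /pos /= oppr_ge0.
by case: (ltgtP x 0) => h; rewrite ?h; ring.
Qed.

(** The left side is the positive part of [x * y], that is, half of [x * y + |x * y|], and [|x * y|]
    is at most the mean of the squares. *)
Lemma sum_spos_le x y :
  \sum_b spos b x * spos b y <= (x * y + (x ^+ 2 + y ^+ 2) / 2) / 2.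
Proof.
rewrite big_bool /spos /pos /= !oppr_ge0.
have := sqr_ge0 (x - y); have := sqr_ge0 (x + y) => h1 h2.
by case: (ltgtP x 0) => hx; case: (ltgtP y 0) => hy; nra.
Qed.

Lemma sum_spos_ge x y : x * y <= \sum_b spos b x * spos b y.
Proof.
rewrite big_bool /spos /pos /= !oppr_ge0.
by case: (ltgtP x 0) => hx; case: (ltgtP y 0) => hy; nra.
Qed.

(** Positive parts are 1-Lipschitz, and [|a^2 - b^2| = |a - b| (a + b) <= D (2 b + D)]. *)
Lemma spos_sq_dist b x y D : `|x - y| <= D ->
  `|spos b x ^+ 2 - spos b y ^+ 2| <= D ^+ 2 + 2 * spos b y * D.
Proof.
rewrite ler_norml => /andP[h1 h2]; rewrite ler_norml /spos /pos.
have D0 : 0 <= D by lra.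
by case: b; case: ifP => hx; case: ifP => hy; move: hx hy;
  do 2 (move/negbT || idtac); rewrite -?ltNge => *; nra.
Qed.

Lemma sum_spos x : \sum_b spos b x = `|x|.
Proof.
rewrite big_bool /spos /pos /= oppr_ge0.
by case: (ltgtP x 0) => h; [rewrite ltr0_norm|rewrite gtr0_norm|rewrite h normr0]; lra.
Qed.

End Pos.

Section Embedding.
Variables (R : realType) (V : finType) (H : hypergraph R V).
Variables (k : nat) (f : 'I_k -> V -> R).
Hypothesis f_orth : orthonormal_w H f.

Definition sqnorm v : R := \sum_s f s v ^+ 2.
Definition nrm v : R := Num.sqrt (sqnorm v).
(** Division by 0 being 0, a zero vector gets the zero unit vector and all its features vanish; it
    also has mass 0. Hence the bounds by 1 below where one expects equalities. *)
Definition unitv s v : R := f s v / nrm v.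
Definition mass v : R := vweight H v * sqnorm v.
Definition corr u v : R := \sum_s unitv s u * unitv s v.
Definition feat (s : 'I_k) (b : bool) v : R := spos b (unitv s v).
Definition aff u v : R := \sum_s \sum_b feat s b u * feat s b v.

Lemma vweight_pos v : 0 < vweight H v.
Proof. exact: vweight_gt0. Qed.

Lemma sqnorm_ge0 v : 0 <= sqnorm v.
Proof. by apply: sumr_ge0 => s _; apply: sqr_ge0. Qed.

Lemma nrm_ge0 v : 0 <= nrm v.
Proof. exact: sqrtr_ge0. Qed.

Lemma sqr_nrm v : nrm v ^+ 2 = sqnorm v.
Proof. by rewrite sqr_sqrtr // sqnorm_ge0. Qed.

Lemma f_eq0 s v : nrm v = 0 -> f s v = 0.
Proof.
move=> h; have : sqnorm v = 0 by rewrite -sqr_nrm h expr0n.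
move/eqP; rewrite psumr_eq0 => [|i _]; last exact: sqr_ge0.
by move/allP => /(_ s); rewrite mem_index_enum => /(_ isT); rewrite sqrf_eq0 => /eqP.
Qed.

Lemma nrm_unitv s v : nrm v * unitv s v = f s v.
Proof.
rewrite /unitv mulrC; have [h|h] := eqVneq (nrm v) 0; last by rewrite divfK.
by rewrite h mulr0 f_eq0.
Qed.

Lemma sum_unitv_sq v : \sum_s unitv s v ^+ 2 = (sqnorm v != 0)%:R.
Proof.
under eq_bigr do rewrite /unitv expr_div_n sqr_nrm.
rewrite -mulr_suml -/(sqnorm v); case: eqP => [->|/eqP h]; first by rewrite mul0r.
by rewrite divff.
Qed.

Lemma sum_unitv_sq_le1 v : \sum_s unitv s v ^+ 2 <= 1.
Proof. by rewrite sum_unitv_sq; case: eqP. Qed.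

Lemma feat_ge0 s b v : 0 <= feat s b v.
Proof. exact: spos_ge0. Qed.

Lemma sum_feat_sq v : \sum_s \sum_b feat s b v ^+ 2 = (sqnorm v != 0)%:R.
Proof. by rewrite -sum_unitv_sq; apply: eq_bigr => s _; apply: sum_spos_sq. Qed.

Lemma sum_feat_sq_le1 v : \sum_s \sum_b feat s b v ^+ 2 <= 1.
Proof. by rewrite sum_feat_sq; case: eqP. Qed.

Lemma feat_sq_le1 s b v : feat s b v ^+ 2 <= 1.
Proof.
apply: le_trans (sum_feat_sq_le1 v); rewrite (bigD1 s) //= (bigD1 b) //= -addrA lerDl.
by apply: addr_ge0; do ?[apply: sumr_ge0 => ? _]; apply: sqr_ge0.
Qed.

Lemma aff_ge u v : corr u v <= aff u v.
Proof. by apply: ler_sum => s _; apply: sum_spos_ge. Qed.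

(** The natural bound is [(1 + corr) / 2]. It is traded for one in [corr ^+ 2], since only squared
    correlations are controlled on average, by [sum_mass_corr]. *)
Lemma aff_le u v : aff u v <= 3 / 4 + corr u v ^+ 2 / 4.
Proof.
apply: (@le_trans _ _ ((corr u v + 1) / 2)); last by have := sqr_ge0 (corr u v - 1); nra.
apply: (@le_trans _ _ (\sum_s (unitv s u * unitv s v
    + (unitv s u ^+ 2 + unitv s v ^+ 2) / 2) / 2)).
  by apply: ler_sum => s _; apply: sum_spos_le.
rewrite -mulr_suml big_split /= -mulr_suml big_split /= -/(corr u v).
by have := sum_unitv_sq_le1 u; have := sum_unitv_sq_le1 v; lra.
Qed.

Lemma mass_ge0 v : 0 <= mass v.
Proof. by rewrite mulr_ge0 ?sqnorm_ge0 // ltW ?vweight_pos. Qed.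

Lemma mass_unitv s t v : mass v * unitv s v * unitv t v = vweight H v * f s v * f t v.
Proof. by rewrite -(nrm_unitv s) -(nrm_unitv t) /mass -sqr_nrm; ring. Qed.

Lemma sum_mass : \sum_v mass v = k%:R.
Proof.
transitivity (\sum_(s < k) inner_w H (f s) (f s)).
  rewrite /inner_w exchange_big /=; apply: eq_bigr => v _.
  by rewrite /mass /sqnorm mulr_sumr; apply: eq_bigr => s _; rewrite -mulrA -expr2.
by under eq_bigr do rewrite f_orth eqxx; rewrite sumr_const card_ord.
Qed.

(** Orthonormality says that the matrix [sum_u w_u u u^T] is the identity, so the sum is the squared
    norm of the unit vector at [v]. *)
Lemma sum_mass_corr v : \sum_u mass u * corr u v ^+ 2 <= 1.
Proof.
apply: le_trans (sum_unitv_sq_le1 v); rewrite le_eqVlt; apply/orP; left; apply/eqP.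
transitivity (\sum_s \sum_t unitv s v * unitv t v * inner_w H (f s) (f t)).
  under [RHS]eq_bigr do under eq_bigr do rewrite /inner_w mulr_sumr.
  under [RHS]eq_bigr do rewrite exchange_big /=.
  rewrite [RHS]exchange_big /=; apply: eq_bigr => u _.
  rewrite expr2 /corr mulr_suml mulr_sumr; apply: eq_bigr => s _.
  rewrite !mulr_sumr; apply: eq_bigr => t _.
  by rewrite -mass_unitv; ring.
apply: eq_bigr => s _; rewrite (bigD1 s) //= big1 ?addr0 => [|t /negPf ts].
  by rewrite f_orth eqxx mulr1 expr2.
by rewrite f_orth eq_sym ts mulr0.
Qed.

Lemma mass_sum_feat v : mass v * \sum_s \sum_b feat s b v ^+ 2 = mass v.
Proof.
rewrite sum_feat_sq; case: eqP => [h|]; last by rewrite mulr1.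
by rewrite /mass h !(mulr0, mul0r).
Qed.

Definition sqdist u v : R := \sum_s (f s u - f s v) ^+ 2.

Lemma sqdist_ge0 u v : 0 <= sqdist u v.
Proof. by apply: sumr_ge0 => s _; apply: sqr_ge0. Qed.

Lemma sqdistE u v : sqdist u v = sqnorm u + sqnorm v - 2 * (nrm u * nrm v * corr u v).
Proof.
rewrite /sqdist /corr !mulr_sumr /sqnorm -big_split /= -sumrB; apply: eq_bigr => s _.
by rewrite -!(nrm_unitv s); ring.
Qed.

Lemma corr_le1 u v : corr u v <= 1.
Proof.
apply: (@le_trans _ _ (\sum_s (unitv s u ^+ 2 + unitv s v ^+ 2) / 2)).
  by apply: ler_sum => s _; have := sqr_ge0 (unitv s u - unitv s v); nra.
rewrite -mulr_suml big_split /=.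
by have := sum_unitv_sq_le1 u; have := sum_unitv_sq_le1 v; lra.
Qed.

Lemma nrm_dist u v : (nrm u - nrm v) ^+ 2 <= sqdist u v.
Proof.
rewrite sqdistE -!sqr_nrm.
have := nrm_ge0 u; have := nrm_ge0 v; have := corr_le1 u v => h1 h2 h3.
have := mulr_ge0 h2 h3; nra.
Qed.

(* Projecting [u_v] radially onto the smaller sphere through [u_c] is a
   contraction. *)
Lemma corr_dist c v : nrm c <= nrm v ->
  sqnorm c * (2 * (1 - corr v c)) <= sqdist v c.
Proof.
move=> h; rewrite sqdistE -!sqr_nrm.
have := nrm_ge0 c; have := corr_le1 v c => h1 h2.
have h3 : 0 <= nrm c * (nrm v - nrm c) by nra.
nra.
Qed.

End Embedding.

(** * Averaging and elementary inequalities *)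

(** If every [y] with [g y > 0] had [h y > c * g y], all terms [l y * (h y - c * g y)] would be
    nonnegative, since [h] and [c] are. Their sum is at most 0, so they all vanish; then positive
    weight occurs only where [g y <= 0], against [G0 > 0]. *)
Lemma ratio_choice (R : realType) (Y : finType) (l g h : Y -> R) (G0 c : R) :
  0 < G0 -> 0 <= c -> (forall y, 0 <= l y) -> (forall y, 0 <= h y) ->
  G0 <= \sum_y l y * g y -> \sum_y l y * h y <= c * G0 ->
  exists y, 0 < g y /\ h y <= c * g y.
Proof.
move=> G00 c0 l0 h0 hg hh.
case: (boolP [exists y, (0 < g y) && (h y <= c * g y)]).
  by move=> /existsP[y /andP[]]; exists y.
move=> /existsPn hn; exfalso.
have term y : 0 <= l y * (h y - c * g y).
  apply: mulr_ge0 => //; have := hn y; have := h0 y.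
  case: (ltP 0 (g y)) => hgy /=; first by rewrite -ltNge; lra.
  move=> h1 _; have hg0 : 0 <= - g y by lra.
  by have := mulr_ge0 c0 hg0; lra.
have sum0 : \sum_y l y * (h y - c * g y) <= 0.
  under eq_bigr do rewrite mulrBr mulrCA.
  rewrite sumrB -mulr_sumr; have := ler_wpM2l c0 hg; lra.
have /eqP : \sum_y l y * (h y - c * g y) = 0.
  by apply/eqP; rewrite eq_le sum0 sumr_ge0.
rewrite psumr_eq0 // => /allP hz.
have : \sum_y l y * g y <= 0.
  apply: sumr_le0 => y _; have := hz y; rewrite mem_index_enum => /(_ isT) /= /eqP.
  have [l00|l0y] := eqVneq (l y) 0; first by rewrite l00 !mul0r lexx.
  have ly : 0 < l y by rewrite lt_def l0y l0.
  move=> /eqP; rewrite mulf_eq0 (negPf l0y) /= subr_eq0 => /eqP e.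
  have := hn y; rewrite e lexx andbT -leNgt => hgy.
  by rewrite pmulr_rle0.
by rewrite leNgt (lt_le_trans G00 hg).
Qed.

(** Replaces Cauchy-Schwarz: applied term by term with one common [z], it can be summed over
    hyperedges without square roots. *)
Lemma young (R : realType) (z a b : R) : 0 < z -> 2 * (a * b) <= z * a ^+ 2 + z^-1 * b ^+ 2.
Proof.
move=> z0; rewrite -subr_ge0.
have -> : z * a ^+ 2 + z^-1 * b ^+ 2 - 2 * (a * b) = z * (a - z^-1 * b) ^+ 2.
  by field; rewrite gt_eqF.
by rewrite mulr_ge0 ?sqr_ge0 // ltW.
Qed.

(** The left side is [|x^2 - y^2| = |x - y| (x + y)], and [x + y <= 2 x + |x - y|]. The bound
    favours [x], the value at the vertex whose mass will be charged. *)
Lemma sqr_sub_min (R : realType) (x y : R) : 0 <= x -> 0 <= y ->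
  x ^+ 2 + y ^+ 2 - 2 * Num.min (x ^+ 2) (y ^+ 2)
    <= (x - y) ^+ 2 + 2 * (x * `|x - y|).
Proof.
move=> x0 y0; have [h|h] := ler0P (x - y).
  have hxy : x ^+ 2 <= y ^+ 2 by rewrite ler_pXn2r ?nnegrE //; lra.
  rewrite (min_l hxy); nra.
have hxy : y ^+ 2 <= x ^+ 2 by rewrite ler_pXn2r ?nnegrE //; lra.
rewrite (min_r hxy); nra.
Qed.

(** * Cuts and volumes *)

Section Cuts.
Variables (R : realType) (V : finType) (H : hypergraph R V).

Definition cut_weight (S : {set V}) : R := \sum_(e in boundary H S) weight H e.

Lemma sum_edges_vertices (F : V -> R) :
  \sum_(e in edges H) weight H e * (\sum_(v in e) F v) = \sum_v vweight H v * F v.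
Proof.
under eq_bigr do rewrite mulr_sumr.
rewrite (exchange_big_dep predT) //=; apply: eq_bigr => v _.
by rewrite /vweight mulr_suml.
Qed.

Lemma cut_weightE S :
  cut_weight S = \sum_(e in edges H) weight H e * (e \in boundary H S)%:R.
Proof.
rewrite /cut_weight [RHS](bigID (fun e => e \in boundary H S)) /=.
rewrite [X in _ = _ + X]big1 ?addr0; last first.
  by move=> e /andP[_ /negPf ->]; rewrite mulr0.
rewrite (eq_bigl (fun e => (e \in edges H) && (e \in boundary H S))); last first.
  by move=> e; rewrite /boundary !inE; case: (e \in edges H).
by apply: eq_bigr => e /andP[_ ->]; rewrite mulr1.
Qed.

Lemma volume_ge0 S : 0 <= volume H S.
Proof. by apply: sumr_ge0 => v _; apply/ltW/vweight_gt0. Qed.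

Lemma volume_gt0 S : S != set0 -> 0 < volume H S.
Proof.
case/set0Pn=> v Sv; rewrite /volume (big_setD1 v) //=.
apply: ltr_pwDl; first exact: vweight_gt0.
by apply: sumr_ge0 => u _; apply/ltW/vweight_gt0.
Qed.

Lemma cut_weight_ge0 S : 0 <= cut_weight S.
Proof.
by apply: sumr_ge0 => e; rewrite /boundary inE => /andP[he _]; apply: weight_ge0.
Qed.

(** Every cut hyperedge contains a vertex of [S]. The resulting bound 1 on the expansion settles all
    large values of [z] at the end. *)
Lemma cut_weight_le_volume S : cut_weight S <= volume H S.
Proof.
rewrite cut_weightE /volume [X in _ <= X]big_mkcond /=.
rewrite [X in _ <= X](eq_bigr (fun v => vweight H v * (v \in S)%:R)); last first.
  by move=> v _; case: (v \in S); rewrite ?mulr1 ?mulr0.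
rewrite -sum_edges_vertices; apply: ler_sum => e he.
apply: ler_wpM2l; first exact: weight_ge0.
rewrite /boundary inE he /=; case: (eqVneq (e :&: S) set0) => /= [_|/set0Pn[v]].
  by apply: sumr_ge0 => v _; apply: ler0n.
rewrite inE => /andP[ev Sv]; rewrite (bigD1 v) //= Sv.
apply: (@le_trans _ _ 1); first by case: (_ != _).
by rewrite lerDl; apply: sumr_ge0 => u _; apply: ler0n.
Qed.

(** A cut is always visible along the star joining [c] to the other vertices of [e], so these pairs
    suffice in place of all pairs. *)
Lemma boundaryPn S e c : e \in boundary H S -> c \in e ->
  exists2 v, v \in e & (v \in S) != (c \in S).
Proof.
rewrite /boundary inE => /and3P[_ /set0Pn[u] hu /set0Pn[v] hv] ce; move: hu hv.
rewrite !inE => /andP[eu Su] /andP[ev Sv].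
by case Sc: (c \in S); [exists v; rewrite ?(negPf Sv)|exists u; rewrite ?Su].
Qed.

End Cuts.

(** * Hyperedges as stars around their shortest vector *)

Section Edges.
Variables (R : realType) (V : finType) (H : hypergraph R V).
Variables (k : nat) (f : 'I_k -> V -> R) (xi : R) (c : {set V} -> V).
Hypothesis f_orth : orthonormal_w H f.
Hypothesis f_disc : forall s, discrepancy_ratio H (f s) <= xi.
(** A centre of least norm is what [corr_dist] requires: distances between unit vectors, scaled by
    the norm of the centre, are bounded by actual distances. *)
Hypothesis c_min : forall e, e \in edges H ->
  c e \in e /\ forall v, v \in e -> nrm f (c e) <= nrm f v.

Definition maxdiff (s : 'I_k) (e : {set V}) : R :=
  \big[Num.max/0]_(v in e) (f s v - f s (c e)) ^+ 2.

(** The maxima are taken coordinate by coordinate, as in the discrepancy ratios. The sum therefore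
    dominates the squared distance from the centre to every vertex, and its weighted total is at
    most [xi * k] without a factor [r]. *)
Definition diam2 (e : {set V}) : R := \sum_s maxdiff s e.

Lemma maxdiff_ge s (e : {set V}) v : v \in e -> (f s v - f s (c e)) ^+ 2 <= maxdiff s e.
Proof.
by move=> ev; apply: (le_bigmax_cond 0 (fun v => (f s v - f s (c e)) ^+ 2)).
Qed.

Lemma maxdiff_ge0 s e : 0 <= maxdiff s e.
Proof. exact: bigmax_ge_id. Qed.

Lemma diam2_ge0 e : 0 <= diam2 e.
Proof. by apply: sumr_ge0 => s _; apply: maxdiff_ge0. Qed.

Lemma sqdist_diam2 (e : {set V}) v : v \in e -> sqdist f v (c e) <= diam2 e.
Proof. by move=> ev; apply: ler_sum => s _; apply: maxdiff_ge. Qed.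

Lemma sum_diam2 : \sum_(e in edges H) weight H e * diam2 e <= xi * k%:R.
Proof.
under eq_bigr do rewrite mulr_sumr.
rewrite exchange_big /=.
rewrite mulrC -[k in k%:R]card_ord mulr_natl -sumr_const; apply: ler_sum => s _.
apply: le_trans (f_disc s); rewrite /discrepancy_ratio.
have -> : \sum_u vweight H u * f s u ^+ 2 = 1.
  transitivity (inner_w H (f s) (f s)); last by rewrite f_orth eqxx.
  by apply: eq_bigr => v _; rewrite expr2 mulrA.
rewrite divr1; apply: ler_sum => e he; apply: ler_wpM2l; first exact: weight_ge0.
have [ce _] := c_min he.
apply/bigmax_leP; split=> [|v ev]; first exact: bigmax_ge_id.
apply: le_trans (le_bigmax_cond 0 (fun u => \big[Num.max/0]_(v in e) (f s u - f s v) ^+ 2) ev).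
exact: (le_bigmax_cond 0 (fun u => (f s v - f s u) ^+ 2) ce).
Qed.

Definition star_energy : R :=
  \sum_(e in edges H) weight H e * \sum_(v in e) sqdist f v (c e).

Lemma star_energy_le : star_energy <= (rank H)%:R * (xi * k%:R).
Proof.
apply: le_trans (ler_wpM2l (ler0n _ _) sum_diam2).
rewrite mulr_sumr; apply: ler_sum => e he; rewrite mulrCA.
apply: ler_wpM2l; first exact: weight_ge0.
apply: (@le_trans _ _ (\sum_(v in e) diam2 e)).
  by apply: ler_sum => v ev; apply: sqdist_diam2.
rewrite sumr_const -[diam2 e *+ _]mulr_natl ler_wpM2r ?diam2_ge0 // ler_nat.
exact: (@leq_bigmax_cond _ (fun e => e \in edges H) (fun e : {set V} => #|e|) e he).
Qed.

(** * Soft clusters *)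

Implicit Types (r : V -> R) (e : {set V}).

Definition feat2 (y : 'I_k * bool) v : R := feat f y.1 y.2 v.

Lemma sum_feat2 u v : \sum_y feat2 y u * feat2 y v = aff f u v.
Proof. by rewrite /aff pair_bigA. Qed.

Lemma sum_feat2_sq v : \sum_y feat2 y v ^+ 2 = (sqnorm f v != 0)%:R.
Proof. by rewrite -sum_feat_sq pair_bigA. Qed.

Lemma sum_feat2_sq_le1 v : \sum_y feat2 y v ^+ 2 <= 1.
Proof. by rewrite sum_feat2_sq; case: eqP. Qed.

Lemma mass_sum_feat2 v : mass H f v * \sum_y feat2 y v ^+ 2 = mass H f v.
Proof. by rewrite -[RHS](mass_sum_feat H f v) pair_bigA. Qed.

Definition soft_child y (r : V -> R) v : R := r v * feat2 y v.
Definition soft_mass (r : V -> R) : R := \sum_v mass H f v * r v ^+ 2.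
Definition soft_pair (r : V -> R) : R := \sum_u \sum_v mass H f u * (r u * r v).
(** What remains of the pair mass when the affinity bound [3/4 + corr^2 / 4] is iterated; at the
    root it is at most the number of vertices, by [sum_mass_corr]. *)
Definition soft_close (r : V -> R) : R :=
  \sum_u \sum_v mass H f u * corr f u v ^+ 2 * ((r u ^+ 2 + r v ^+ 2) / 2).
(* With [j] symbols still to be drawn, [(3/4)^j P + (1 - (3/4)^j) Q] bounds the
   expected final value of [P], the mass-weighted size of the threshold sets of [r];
   twice the penalty that limits these sizes to 24n/k is subtracted from the mass. *)
Definition soft_good (j : nat) (r : V -> R) : R :=
  soft_mass r - k%:R / (12 * #|V|%:R) *
    ((3 / 4) ^+ j * soft_pair r + (1 - (3 / 4) ^+ j) * soft_close r).
(** Three charges for a star edge: the present separation by [r]; one increment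
    [d (r_v^2 + r_c^2) / 2] for each symbol still to be drawn; and [d r_v^2] for the final threshold
    on the norms. *)
Definition soft_term (j : nat) (r : V -> R) (e : {set V}) (v : V) : R :=
  sqnorm f (c e) * (r v - r (c e)) ^+ 2
  + j%:R / 2 * (sqdist f v (c e) * (r v ^+ 2 + r (c e) ^+ 2))
  + sqdist f v (c e) * r v ^+ 2.
Definition soft_cost (j : nat) (r : V -> R) : R :=
  \sum_(e in edges H) weight H e * \sum_(v in e) soft_term j r e v.

Let mass0 v : 0 <= mass H f v := mass_ge0 H f v.

Lemma soft_term_ge0 j r e v : 0 <= soft_term j r e v.
Proof.
have d0 := sqdist_ge0 f v (c e); have a0 := sqnorm_ge0 f (c e).
have r1 := sqr_ge0 (r v); have r2 := sqr_ge0 (r (c e)).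
have r3 := sqr_ge0 (r v - r (c e)).
rewrite /soft_term !addr_ge0 //; first exact: mulr_ge0.
  by apply: mulr_ge0; [exact: divr_ge0|apply: mulr_ge0 => //; apply: addr_ge0].
exact: mulr_ge0.
Qed.

Lemma soft_cost_ge0 j r : 0 <= soft_cost j r.
Proof.
apply: sumr_ge0 => e he; apply: mulr_ge0; first exact: weight_ge0.
by apply: sumr_ge0 => v _; apply: soft_term_ge0.
Qed.

Lemma soft_pair_ge0 r : (forall v, 0 <= r v) -> 0 <= soft_pair r.
Proof.
move=> r0; apply: sumr_ge0 => u _; apply: sumr_ge0 => v _.
by apply: mulr_ge0 => //; apply: mulr_ge0.
Qed.

Lemma sum_child_sq r v : \sum_y soft_child y r v ^+ 2 <= r v ^+ 2.
Proof.
under eq_bigr do rewrite /soft_child exprMn.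
by rewrite -mulr_sumr ler_piMr ?sqr_ge0 ?sum_feat2_sq_le1.
Qed.

Lemma sum_soft_mass r : \sum_y soft_mass (soft_child y r) = soft_mass r.
Proof.
rewrite /soft_mass exchange_big /=; apply: eq_bigr => v _.
under eq_bigr do rewrite /soft_child exprMn mulrCA.
by rewrite -!mulr_sumr mass_sum_feat2 mulrC.
Qed.

Lemma sum_soft_pair r : (forall v, 0 <= r v) ->
  \sum_y soft_pair (soft_child y r) <= 3 / 4 * soft_pair r + 1 / 4 * soft_close r.
Proof.
move=> r0; rewrite /soft_pair /soft_close exchange_big !mulr_sumr -big_split /=.
apply: ler_sum => u _; rewrite exchange_big !mulr_sumr -big_split /=.
apply: ler_sum => v _.
under eq_bigr do rewrite [soft_child _ _ _ * _]mulrACA [mass H f u * _]mulrA.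
rewrite -mulr_sumr sum_feat2.
have h1 := aff_le f u v.
have h2 : 0 <= r u * r v by rewrite mulr_ge0.
have h3 := sqr_ge0 (r u - r v); have h4 := sqr_ge0 (corr f u v).
have h5 := ler_wpM2l (mulr_ge0 (mass0 u) h2) h1.
have h6 : 0 <= mass H f u * (corr f u v ^+ 2 * (r u - r v) ^+ 2).
  by apply: mulr_ge0 => //; apply: mulr_ge0.
apply: le_trans h5 _; rewrite -subr_ge0.
suff -> : 3 / 4 * (mass H f u * (r u * r v)) +
   1 / 4 * (mass H f u * corr f u v ^+ 2 * ((r u ^+ 2 + r v ^+ 2) / 2)) -
   mass H f u * (r u * r v) * (3 / 4 + corr f u v ^+ 2 / 4) =
   mass H f u * (corr f u v ^+ 2 * (r u - r v) ^+ 2) / 8 by lra.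
by field.
Qed.

Lemma sum_soft_close r : \sum_y soft_close (soft_child y r) <= soft_close r.
Proof.
rewrite /soft_close exchange_big; apply: ler_sum => u _.
rewrite exchange_big; apply: ler_sum => v _ /=.
rewrite -mulr_sumr; apply: ler_wpM2l.
  by apply: mulr_ge0; [exact: mass0|exact: sqr_ge0].
rewrite -mulr_suml ler_wpM2r ?invr_ge0 // big_split /=.
by rewrite lerD // sum_child_sq.
Qed.

Lemma pow34 j : 0 <= (3 / 4 : R) ^+ j <= 1.
Proof.
have h0 : 0 <= 3 / 4 :> R by lra.
have h1 : 3 / 4 <= 1 :> R by lra.
by rewrite exprn_ge0 // exprn_ile1.
Qed.

(** The two coefficients are chosen to telescope: with [q = (3/4)^j],
    [q (3/4 P + 1/4 Q) + (1 - q) Q] is exactly the combination for [j.+1]. *)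
Lemma soft_good_step j r : (forall v, 0 <= r v) ->
  soft_good j.+1 r <= \sum_y soft_good j (soft_child y r).
Proof.
move=> r0; rewrite /soft_good sumrB sum_soft_mass lerD2l lerN2 -mulr_sumr.
apply: ler_wpM2l; first by rewrite divr_ge0 ?mulr_ge0.
rewrite big_split /= -!mulr_sumr exprSr.
have /andP[q0 q1] := pow34 j; set q := _ ^+ j in q0 q1 *.
have h1 := ler_wpM2l q0 (sum_soft_pair r0).
have q1' : 0 <= 1 - q by lra.
have h2 := ler_wpM2l q1' (sum_soft_close r).
apply: le_trans (lerD h1 h2) _; lra.
Qed.

(** Expanding the square, the children of [(r_v - r_c)^2] sum to at most
    [(r_v - r_c)^2 + 2 (1 - corr) r_v r_c]. Multiplied by the squared norm of the centre, the excess
    is at most [d r_v r_c] by [corr_dist], hence at most the increment released when [j] drops by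
    one. *)
Lemma soft_cost_step j r : (forall v, 0 <= r v) ->
  \sum_y soft_cost j (soft_child y r) <= soft_cost j.+1 r.
Proof.
move=> r0; rewrite /soft_cost exchange_big; apply: ler_sum => e he /=.
rewrite -mulr_sumr; apply: ler_wpM2l; first exact: weight_ge0.
rewrite exchange_big; apply: ler_sum => v ev /=.
have [ce cm] := c_min he.
rewrite /soft_term !big_split /= -!mulr_sumr.
set a := sqnorm f _; set d := sqdist f _ _.
have d0 : 0 <= d by apply: sqdist_ge0.
have a0 : 0 <= a by apply: sqnorm_ge0.
have sv := sum_child_sq r v; have sc := sum_child_sq r (c e).
have h1 : \sum_y (soft_child y r v - soft_child y r (c e)) ^+ 2 <=
    (r v - r (c e)) ^+ 2 + 2 * (1 - corr f v (c e)) * (r v * r (c e)).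
  have -> : \sum_y (soft_child y r v - soft_child y r (c e)) ^+ 2 =
     \sum_y soft_child y r v ^+ 2 + \sum_y soft_child y r (c e) ^+ 2
     - 2 * (r v * r (c e)) * aff f v (c e).
    rewrite -sum_feat2 mulr_sumr -big_split -sumrB /=; apply: eq_bigr => y _.
    by rewrite /soft_child; ring.
  have := ler_wpM2l (mulr_ge0 (r0 v) (r0 (c e))) (aff_ge f v (c e)); lra.
have h2 := ler_wpM2l a0 h1.
have h3 := ler_wpM2r (mulr_ge0 (r0 v) (r0 (c e))) (corr_dist (cm v ev)).
rewrite -/a -/d in h3.
have h4 := ler_wpM2l d0 (lerD sv sc).
have h5 := ler_wpM2l d0 sv.
have h6 := mulr_ge0 d0 (sqr_ge0 (r v - r (c e))).
have j0 : 0 <= j%:R / 2 :> R by rewrite divr_ge0.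
have h7 := ler_wpM2l j0 h4.
rewrite -[j.+1]addn1 natrD.
set S1 := \sum_y (_ - _) ^+ 2 in h1 h2 *.
set Sv := \sum_y soft_child y r v ^+ 2 in sv h4 h5 h7 *.
set Sc := \sum_y soft_child y r (c e) ^+ 2 in sc h4 h7 *.
have -> : (j%:R + 1) / 2 * (d * (r v ^+ 2 + r (c e) ^+ 2)) =
  j%:R / 2 * (d * (r v ^+ 2 + r (c e) ^+ 2)) + d * (r v ^+ 2 + r (c e) ^+ 2) / 2.
  by field.
rewrite big_split /= -/Sv -/Sc.
have -> : d * (r v ^+ 2 + r (c e) ^+ 2) / 2 =
  d * (r v * r (c e)) + d * (r v - r (c e)) ^+ 2 / 2 by field.
lra.
Qed.

Lemma soft_step j r (t : R) : (forall v, 0 <= r v) -> 0 <= t ->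
  0 < soft_good j.+1 r -> soft_cost j.+1 r <= t * soft_good j.+1 r ->
  exists y, 0 < soft_good j (soft_child y r) /\
    soft_cost j (soft_child y r) <= t * soft_good j (soft_child y r).
Proof.
move=> r0 t0 hg hh.
apply: (@ratio_choice _ _ (fun=> 1) _ _ (soft_good j.+1 r)) => //.
- by move=> y; apply: soft_cost_ge0.
- by under eq_bigr do rewrite mul1r; apply: soft_good_step.
- by under eq_bigr do rewrite mul1r; apply: le_trans hh; apply: soft_cost_step.
Qed.

Lemma soft_cost_root N : soft_cost N (fun=> 1) = (N%:R + 1) * star_energy.
Proof.
rewrite /soft_cost /star_energy mulr_sumr; apply: eq_bigr => e _.
rewrite mulrCA; congr (_ * _); rewrite mulr_sumr; apply: eq_bigr => v _.
by rewrite /soft_term; field.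
Qed.

(** With [(3/4)^N k <= 1] both parts of the penalty are at most [|V|], so the penalty costs at most
    [k / 6] of the mass [k]. *)
Lemma soft_good_root N : (0 < k)%N -> (3 / 4 : R) ^+ N * k%:R <= 1 ->
  k%:R / 2 <= soft_good N (fun=> 1).
Proof.
move=> k0 hN; rewrite /soft_good.
have -> : soft_mass (fun=> 1) = k%:R.
  by rewrite -(sum_mass f_orth); apply: eq_bigr => v _; rewrite expr1n mulr1.
have -> : soft_pair (fun=> 1) = #|V|%:R * k%:R.
  rewrite -(sum_mass f_orth) mulr_sumr; apply: eq_bigr => u _.
  by rewrite sumr_const mulr1 mulr1 mulr_natl.
have hc : soft_close (fun=> 1) <= #|V|%:R.
  rewrite /soft_close exchange_big /= -sum1_card natr_sum; apply: ler_sum => v _.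
  apply: le_trans (sum_mass_corr f_orth v).
  by apply: ler_sum => u _; rewrite expr1n; lra.
have k0' : 0 < k%:R :> R by rewrite ltr0n.
have n0 : 0 < #|V|%:R :> R.
  rewrite ltr0n lt0n; apply/eqP => V0.
  have := sum_mass f_orth; rewrite big1 => [h|v _]; first by rewrite -h ltxx in k0'.
  by have := card0_eq V0 v; rewrite inE.
have /andP[q0 q1] := pow34 N; set q := _ ^+ N in hN q0 q1 *.
set n := #|V|%:R in hc n0 *; set K := k%:R in hN k0' *.
set Q := soft_close _ in hc *.
have h1 : q * (n * K) + (1 - q) * Q <= 2 * n.
  have q1' : 0 <= 1 - q by lra.
  have := ler_wpM2l q1' hc; have := ler_wpM2r (ltW n0) hN.
  have := mulr_ge0 q0 (ltW n0); nra.
have hz : 0 <= K / (12 * n) by rewrite divr_ge0 // ?mulr_ge0 // ltW.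
have := ler_wpM2l hz h1.
have -> : K / (12 * n) * (2 * n) = K / 6 by field; rewrite gt_eqF.
lra.
Qed.

(** A vertex is selected with weight [r v ^+ 2] times its squared norm, so the expected volume is
    [soft_mass]. Hard clusters are swept with the same sets, [r] being an indicator. *)
Definition soft_set (r : V -> R) (y : V * V) : {set V} :=
  [set v | (r y.1 <= r v) && (nrm f y.2 <= nrm f v)].

(** Random thresholds give expected volume [soft_mass r], expected volume times cardinality at most
    [soft_pair r], and expected cut at most [(3 z + z^2) soft_mass r]. The factor 2 in [B0] and the
    doubled penalty in [soft_good] leave half the volume for each requirement, so some threshold
    pair meets both. *)
Lemma soft_leaf r (z : R) : (forall v, 0 <= r v) -> 0 < z ->
  (0 < k)%N -> 0 < soft_good 0 r -> soft_cost 0 r <= z ^+ 2 * soft_good 0 r ->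
  exists y, let S := soft_set r y in
    [/\ S != set0, (#|S| * k <= 24 * #|V|)%N & cut_weight H S <= 2 * (3 * z + z ^+ 2) * volume H S].
Proof.
move=> r0 z0 k0 hg hh; set B0 := 2 * (3 * z + z ^+ 2).
have B00 : 0 < B0 by rewrite mulr_gt0 // addr_gt0 ?mulr_gt0 ?exprn_gt0.
have [lr [lr0 hlr]] := layer_cake_sqr r0.
have [la [la0 hla]] := layer_cake_sqr (nrm_ge0 f).
pose l (y : V * V) := lr y.1 * la y.2.
have l0 y : 0 <= l y by rewrite mulr_ge0.
have Eb u v : \sum_y l y * ((u \in soft_set r y) && (v \in soft_set r y))%:R =
   Num.min (r u ^+ 2) (r v ^+ 2) * Num.min (nrm f u ^+ 2) (nrm f v ^+ 2).
  rewrite -(cake_min lr0 hlr) -(cake_min la0 hla) big_distrlr /= pair_bigA /=.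
  apply: eq_bigr => -[p t] _; rewrite /l /= !inE /= mulrACA -natrM mulnb.
  by congr (_ * (nat_of_bool _)%:R); rewrite andbACA.
have Es v : \sum_y l y * (v \in soft_set r y)%:R = r v ^+ 2 * sqnorm f v.
  by have := Eb v v; rewrite !minxx sqr_nrm => <-; under [RHS]eq_bigr do rewrite andbb.
have Ev : \sum_y l y * volume H (soft_set r y) = soft_mass r.
  rewrite /soft_mass /volume.
  under eq_bigr do rewrite big_mkcond /= mulr_sumr.
  rewrite exchange_big /=; apply: eq_bigr => v _.
  rewrite /mass -mulrA [sqnorm _ _ * _]mulrC -Es mulr_sumr; apply: eq_bigr => y _.
  by case: (v \in _); rewrite ?(mulr1, mulr0) // mulrC.
have Ec : \sum_y l y * (volume H (soft_set r y) * #|soft_set r y|%:R) <= soft_pair r.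
  have -> : \sum_y l y * (volume H (soft_set r y) * #|soft_set r y|%:R) =
     \sum_u \sum_v vweight H u * (\sum_y l y * ((u \in soft_set r y) && (v \in soft_set r y))%:R).
    under [RHS]eq_bigr do under eq_bigr do rewrite mulr_sumr.
    under [RHS]eq_bigr do rewrite exchange_big /=.
    rewrite [RHS]exchange_big /=; apply: eq_bigr => y _.
    rewrite -sum1_card natr_sum big_mkcond /volume [\sum_(v in _) vweight _ _]big_mkcond /=.
    rewrite big_distrlr /= mulr_sumr; apply: eq_bigr => u _; rewrite mulr_sumr.
    apply: eq_bigr => v _.
    by case: (u \in _); case: (v \in _); rewrite /= ?(mulr1, mulr0, mul0r) // mulrC.
  apply: ler_sum => u _; apply: ler_sum => v _; rewrite Eb /mass -mulrA.
  apply: ler_wpM2l; first exact/ltW/vweight_gt0.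
  rewrite mulrC; apply: ler_pM; rewrite ?le_min ?sqr_ge0 //.
    by rewrite sqr_nrm ge_min lexx.
  have := r0 u; have := r0 v => h1 h2.
  rewrite ge_min; case: (leP (r u) (r v)) => huv; apply/orP; [left|right]; nra.
have Eb2 : \sum_y l y * cut_weight H (soft_set r y) <=
   2 * z * soft_mass r + (1 + z^-1) * soft_cost 0 r.
  under eq_bigr do rewrite cut_weightE mulr_sumr.
  have -> : soft_mass r = \sum_(e in edges H) weight H e * \sum_(v in e) sqnorm f v * r v ^+ 2.
    by rewrite sum_edges_vertices; apply: eq_bigr => v _; rewrite /mass mulrA.
  rewrite exchange_big /= /soft_cost !mulr_sumr -big_split /=.
  apply: ler_sum => e he; have [ce cm] := c_min he.
  rewrite ![_ * (weight H e * _)]mulrCA -mulrDr.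
  under eq_bigr do rewrite mulrCA.
  rewrite -mulr_sumr; apply: ler_wpM2l; first exact: weight_ge0.
  rewrite !mulr_sumr -big_split /=.
  apply: (@le_trans _ _ (\sum_y l y * \sum_(v in e)
     ((v \in soft_set r y)%:R + (c e \in soft_set r y)%:R
      - 2 * ((v \in soft_set r y) && (c e \in soft_set r y))%:R))).
    apply: ler_sum => y _; apply: ler_wpM2l => //.
    have t0 v : 0 <= ((v \in soft_set r y)%:R + (c e \in soft_set r y)%:R
      - 2 * ((v \in soft_set r y) && (c e \in soft_set r y))%:R) :> R.
      by case: (v \in _); case: (c e \in _) => /=; lra.
    case: (boolP (e \in _)) => hb; last by apply: sumr_ge0.
    have [v ev hv] := boundaryPn hb ce.
    rewrite (bigD1 v) //=; apply: ler_wpDr; first by apply: sumr_ge0.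
    by move: hv; case: (v \in _); case: (c e \in _) => //= _; lra.
under [X in X <= _]eq_bigr do rewrite mulr_sumr.
  rewrite exchange_big /=; apply: ler_sum => v ev.
  have -> : \sum_y l y * ((v \in soft_set r y)%:R + (c e \in soft_set r y)%:R
      - 2 * ((v \in soft_set r y) && (c e \in soft_set r y))%:R) =
     r v ^+ 2 * sqnorm f v + r (c e) ^+ 2 * sqnorm f (c e)
     - 2 * (Num.min (r v ^+ 2) (r (c e) ^+ 2) * Num.min (nrm f v ^+ 2) (nrm f (c e) ^+ 2)).
    rewrite -Eb -!Es mulr_sumr -big_split -sumrB /=; apply: eq_bigr => y _; ring.
  have hcv := cm v ev; have nc0 := nrm_ge0 f (c e); have nv0 := nrm_ge0 f v.
  rewrite [Num.min (nrm f v ^+ 2) _]min_r; last by rewrite ler_pXn2r ?nnegrE.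
  rewrite /soft_term -!sqr_nrm mul0r mul0r addr0.
  have d2 := nrm_dist f v (c e).
  set d := sqdist f _ _ in d2 *.
  (* [y1] treats the threshold on [r], [y2] the one on the norms; each charges [z] times the mass at
     [v] and [1 / z] times a part of the cost. *)
  have y1 := young (nrm f (c e) * r v) (nrm f (c e) * `|r v - r (c e)|) z0.
  have y2 := young (nrm f v) (nrm f v - nrm f (c e)) z0.
  have zi0 : 0 < z^-1 by rewrite invr_gt0.
  have rv := r0 v; have rc := r0 (c e).
  have habs : `|r v - r (c e)| ^+ 2 = (r v - r (c e)) ^+ 2 by rewrite real_normK ?num_real.
  rewrite !exprMn habs in y1.
  have hm : r v ^+ 2 + r (c e) ^+ 2 - 2 * Num.min (r v ^+ 2) (r (c e) ^+ 2) <=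
     (r v - r (c e)) ^+ 2 + 2 * (r v * `|r v - r (c e)|).
    exact: sqr_sub_min.
  set A := nrm f (c e) in nc0 hcv d2 y1 y2 *; set B := nrm f v in nv0 hcv d2 y2 *.
  set D := `|_| in habs y1 hm; set M := Num.min _ _ in hm *.
  have h1 := ler_wpM2l (sqr_ge0 A) hm.
  have hAB : A ^+ 2 <= B ^+ 2 by rewrite ler_pXn2r ?nnegrE.
  have h2 : z * (A ^+ 2 * r v ^+ 2) <= z * (B ^+ 2 * r v ^+ 2).
    by rewrite ler_pM2l // ler_wpM2r ?sqr_ge0.
  have h3 : B ^+ 2 - A ^+ 2 <= z * B ^+ 2 + z^-1 * d.
    have : B ^+ 2 - A ^+ 2 <= 2 * (B * (B - A)) by nra.
    have := ler_wpM2l (ltW zi0) d2; lra.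
  have h4 := ler_wpM2l (sqr_ge0 (r v)) h3.
  have h5 : 0 <= d * r v ^+ 2 by rewrite mulr_ge0 ?sqr_ge0 ?sqdist_ge0.
  have -> : r v ^+ 2 * B ^+ 2 + r (c e) ^+ 2 * A ^+ 2 - 2 * (M * A ^+ 2) =
    A ^+ 2 * (r v ^+ 2 + r (c e) ^+ 2 - 2 * M) + r v ^+ 2 * (B ^+ 2 - A ^+ 2) by ring.
  apply: le_trans (lerD h1 h4) _.
  have -> : A ^+ 2 * ((r v - r (c e)) ^+ 2 + 2 * (r v * D)) =
     A ^+ 2 * (r v - r (c e)) ^+ 2 + 2 * (A * r v * (A * D)) by ring.
  lra.
pose n := #|V|%:R : R; pose K := k%:R : R.
have K0 : 0 < K by rewrite ltr0n.
have m0 : 0 < soft_mass r.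
  apply: lt_le_trans hg _; rewrite /soft_good expr0 subrr mul0r addr0 mul1r.
  by rewrite gerBl mulr_ge0 ?soft_pair_ge0 ?divr_ge0 ?mulr_ge0.
have n0 : 0 < n.
  rewrite ltr0n lt0n; apply/eqP => V0.
  move: m0; rewrite /soft_mass big1 ?ltxx // => v _.
  by have := card0_eq V0 v; rewrite inE.
case: (boolP [exists y, [&& soft_set r y != set0, (#|soft_set r y| * k <= 24 * #|V|)%N
   & cut_weight H (soft_set r y) <= B0 * volume H (soft_set r y)]]).
  by move=> /existsP[y /and3P[]]; exists y.
move=> /existsPn hn; exfalso.
(* A nonempty set violating one of the two requirements has its volume dominated by the
   corresponding term; for the empty set the volume is 0. *)
have key y : l y * volume H (soft_set r y) <=
   l y * (K / (24 * n) * (volume H (soft_set r y) * #|soft_set r y|%:R)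
     + B0^-1 * cut_weight H (soft_set r y)).
  apply: ler_wpM2l => //; set S := soft_set r y; have := hn y; rewrite -/S.
  have c0 := cut_weight_ge0 H S; have v0 := volume_ge0 H S.
  have zi : 0 < B0^-1 by rewrite invr_gt0.
  have t1 : 0 <= K / (24 * n) * (volume H S * #|S|%:R).
    by rewrite mulr_ge0 ?divr_ge0 ?mulr_ge0 // ltW.
  have t2 := mulr_ge0 (ltW zi) c0.
  have [S0|S0] := eqVneq S set0.
    by move=> _; rewrite {1}/volume S0 big_set0; rewrite S0 in t1 t2; lra.
  case: leqP => /= hS.
    rewrite -ltNge => hc; have := ler_wpM2l (ltW zi) (ltW hc).
    rewrite mulKf; first by lra.
    by rewrite gt_eqF.
  move=> _; apply: ler_wpDr => //.
  rewrite mulrCA ler_peMr // mulrAC ler_pdivlMr ?mul1r; last by rewrite mulr_gt0.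
  by rewrite /n /K -!natrM ler_nat [(k * _)%N]mulnC ltnW.
have : \sum_y l y * volume H (soft_set r y) <=
   \sum_y l y * (K / (24 * n) * (volume H (soft_set r y) * #|soft_set r y|%:R)
     + B0^-1 * cut_weight H (soft_set r y)) by apply: ler_sum => y _; apply: key.
rewrite Ev.
under eq_bigr do rewrite mulrDr [l _ * (K / _ * _)]mulrCA [l _ * (_^-1 * _)]mulrCA.
rewrite big_split /= -!mulr_sumr => hfin.
have k24 : 0 <= K / (24 * n) by rewrite divr_ge0 ?mulr_ge0 // ltW.
have zi : 0 < B0^-1 by rewrite invr_gt0.
have h1 := ler_wpM2l k24 Ec; have h2 := ler_wpM2l (ltW zi) Eb2.
have hgE : soft_good 0 r = soft_mass r - 2 * (K / (24 * n) * soft_pair r).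
  rewrite /soft_good expr0 subrr mul0r addr0 mul1r -/n -/K; field.
  by rewrite gt_eqF.
have gm : soft_good 0 r <= soft_mass r.
  have : 0 <= K / (24 * n) * soft_pair r.
    by rewrite mulr_ge0 ?soft_pair_ge0.
  by rewrite hgE; lra.
have h3 : soft_cost 0 r <= z ^+ 2 * soft_mass r.
  by apply: le_trans hh _; rewrite ler_wpM2l ?sqr_ge0.
have h4 : (1 + z^-1) * soft_cost 0 r <= (z ^+ 2 + z) * soft_mass r.
  have z1i : 0 <= 1 + z^-1 by rewrite addr_ge0 // invr_ge0 ltW.
  apply: le_trans (ler_wpM2l z1i h3) _; rewrite mulrA ler_wpM2r ?(ltW m0) //.
  by rewrite le_eqVlt; apply/orP; left; apply/eqP; field; rewrite gt_eqF.
have h5 : B0^-1 * (2 * z * soft_mass r + (1 + z^-1) * soft_cost 0 r) <= soft_mass r / 2.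
  apply: (@le_trans _ _ (B0^-1 * (B0 * (soft_mass r / 2)))).
    by apply: ler_wpM2l; [exact: ltW|rewrite /B0; lra].
  by rewrite mulKf // gt_eqF.
rewrite hgE in hg; lra.
Qed.

End Edges.

(** * Hard clusters *)

Section Hard.
Variables (R : realType) (V : finType) (H : hypergraph R V).
Variables (k : nat) (f : 'I_k -> V -> R) (xi : R) (c : {set V} -> V).
Variable N : nat.
Hypothesis f_orth : orthonormal_w H f.
Hypothesis f_disc : forall s, discrepancy_ratio H (f s) <= xi.
Hypothesis c_min : forall e, e \in edges H ->
  c e \in e /\ forall v, v \in e -> nrm f (c e) <= nrm f v.
Hypothesis k0 : (0 < k)%N.
Hypothesis N0 : (0 < N)%N.

Implicit Types (S e : {set V}).
Local Notation K := (k%:R : R).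
Local Notation n := (#|V|%:R : R).
Local Notation nu e := (nrm f (c e)).

Definition diam e : R := Num.sqrt (diam2 f c e).
(** If this fails, every norm in [e] is at most [101 * diam e], so [e] can be paid for entirely out
    of [diam2], at total price [101 ^+ 2 * (xi * k)]. *)
Definition short e : bool := 100 * diam e <= nu e.

Definition hard_child (y : ('I_k * bool) * V) S : {set V} :=
  [set v in S | feat2 f y.1 y.2 <= feat2 f y.1 v].
Definition hard_mass S : R := \sum_(v in S) mass H f v.
(* The constant term is a fee per final cluster, so that its mass exceeds
   1 / (8kN); the term [j / (8N)] prepays the fees of the at most 2k children of each
   node, whose mass exceeds 2. The last two terms limit the size of the final cluster and
   force its mass below 2: an intersection step shrinks the expected squared mass by 7/8. *)
Definition hard_good (j : nat) S : R :=
  hard_mass S * (1 - j%:R / (8 * N%:R)) - (8 * K * N%:R)^-1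
  - K / (12 * n) * #|S|%:R - hard_mass S ^+ 2 * (7 / 8) ^+ j / 2.
(* An uncut short hyperedge is cut with probability proportional to [diam e / nu e];
   once cut, it meets at most [13/12] children on average. *)
Definition hard_term (j : nat) S e : R :=
  if e \subset S then nu e * diam e * (24 * j%:R + 6)
  else if e :&: S != set0 then 2 * nu e ^+ 2 else 0.
Definition hard_cost (j : nat) S : R :=
  \sum_(e in edges H | short e) weight H e * ((13 / 12) ^+ j * hard_term j S e).

Let K0 : 0 < K. Proof. by rewrite ltr0n. Qed.
Let NR0 : 0 < N%:R :> R. Proof. by rewrite ltr0n. Qed.

Let n0 : 0 < n.
Proof.
rewrite ltr0n lt0n; apply/eqP => V0.
have := sum_mass f_orth; rewrite big1 => [h|v _]; first by have := K0; rewrite -h ltxx.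
by have := card0_eq V0 v; rewrite inE.
Qed.

Let mass0 v : 0 <= mass H f v := mass_ge0 H f v.

Lemma hard_mass_ge0 S : 0 <= hard_mass S.
Proof. exact: sumr_ge0. Qed.

Lemma diam_ge0 e : 0 <= diam e.
Proof. exact: sqrtr_ge0. Qed.

Lemma sqr_diam e : diam e ^+ 2 = diam2 f c e.
Proof. by rewrite sqr_sqrtr ?diam2_ge0. Qed.

Lemma hard_term_ge0 j S e : 0 <= hard_term j S e.
Proof.
have h := mulr_ge0 (nrm_ge0 f (c e)) (diam_ge0 e).
rewrite /hard_term; case: ifP => _.
  by apply: mulr_ge0 => //; apply: addr_ge0 => //; apply: mulr_ge0.
by case: ifP => _ //; rewrite mulr_ge0 ?sqr_ge0.
Qed.

Lemma hard_cost_ge0 j S : 0 <= hard_cost j S.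
Proof.
apply: sumr_ge0 => e /andP[he _]; apply: mulr_ge0; first exact: weight_ge0.
by apply: mulr_ge0; [apply: exprn_ge0; lra|exact: hard_term_ge0].
Qed.

Lemma nrm_le_diam e v : e \in edges H -> v \in e -> nrm f v <= nu e + diam e.
Proof.
move=> he ev; have [ce cm] := c_min he.
rewrite -lerBlDl -(@ler_pXn2r _ 2) ?nnegrE ?diam_ge0 ?subr_ge0 ?cm //.
by rewrite sqr_diam; apply: le_trans (nrm_dist f v (c e)) _; apply: sqdist_diam2.
Qed.

Section Spread.
Variable e : {set V}.
Hypotheses (he : e \in edges H) (hs : short e) (hnu : 0 < nu e).

Let x : R := diam e / nu e.
(** Bounds the variation of the [s]-th unit coordinate over all of [e] at once, from [u_v/|u_v| -
    u_c/|u_c| = ((u_v - u_c) + (|u_c| - |u_v|) u_c/|u_c|) / |u_v|]. *)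
Let D (s : 'I_k) : R :=
  (Num.sqrt (maxdiff f c s e) + `|unitv f s (c e)| * diam e) / nu e.
Definition feat_spread (y : 'I_k * bool) : R :=
  D y.1 ^+ 2 + 2 * feat2 f y (c e) * D y.1.

Let D0 s : 0 <= D s.
Proof.
by rewrite /D divr_ge0 ?(ltW hnu) // addr_ge0 ?mulr_ge0 ?sqrtr_ge0 ?diam_ge0.
Qed.

Lemma feat_spread_ge0 y : 0 <= feat_spread y.
Proof.
rewrite /feat_spread addr_ge0 ?sqr_ge0 //; apply: mulr_ge0 => //.
by apply: mulr_ge0 => //; apply: feat_ge0.
Qed.

Let unitv_dist s v : v \in e -> `|unitv f s v - unitv f s (c e)| <= D s.
Proof.
move=> ev; have [ce cm] := c_min he; have hv := cm v ev.
have nv0 : 0 < nrm f v by apply: lt_le_trans hv.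
have -> : unitv f s v - unitv f s (c e) =
   ((f s v - f s (c e)) + unitv f s (c e) * (nu e - nrm f v)) / nrm f v.
  by rewrite /unitv; field; rewrite !gt_eqF.
rewrite normrM normfV (gtr0_norm nv0) /D.
have A0 : 0 <= Num.sqrt (maxdiff f c s e) + `|unitv f s (c e)| * diam e.
  by rewrite addr_ge0 ?mulr_ge0 ?sqrtr_ge0 ?diam_ge0.
apply: (@le_trans _ _ ((Num.sqrt (maxdiff f c s e) + `|unitv f s (c e)| * diam e) / nrm f v)).
  rewrite ler_pM2r ?invr_gt0 //; apply: le_trans (ler_normD _ _) _; apply: lerD.
    by rewrite -sqrtr_sqr ler_wsqrtr // maxdiff_ge.
  rewrite normrM ler_wpM2l // ler0_norm ?subr_le0 // opprB lerBlDl.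
  exact: nrm_le_diam.
by apply: ler_wpM2l => //; rewrite lef_pV2 ?posrE.
Qed.

Lemma feat_spreadP y v : v \in e ->
  `|feat2 f y v ^+ 2 - feat2 f y (c e) ^+ 2| <= feat_spread y.
Proof. by move=> ev; apply/spos_sq_dist/unitv_dist. Qed.

Let sum_D_sq : \sum_s D s ^+ 2 <= 4 * x ^+ 2.
Proof.
have E s : D s ^+ 2 <= 2 * (maxdiff f c s e + unitv f s (c e) ^+ 2 * diam2 f c e) / nu e ^+ 2.
  rewrite expr_div_n ler_pM2r ?invr_gt0 ?exprn_gt0 //.
  have h1 : Num.sqrt (maxdiff f c s e) ^+ 2 = maxdiff f c s e.
    by rewrite sqr_sqrtr ?maxdiff_ge0.
  have h2 : (`|unitv f s (c e)| * diam e) ^+ 2 = unitv f s (c e) ^+ 2 * diam2 f c e.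
    by rewrite exprMn sqr_diam real_normK ?num_real.
  rewrite -{2}h1 -h2; set a := Num.sqrt _; set b := _ * _.
  by have := sqr_ge0 (a - b); nra.
apply: le_trans (ler_sum _ (fun s _ => E s)) _.
rewrite -mulr_suml -mulr_sumr big_split /= -mulr_suml -/(diam2 f c e).
rewrite /x expr_div_n sqr_diam mulrA ler_pM2r ?invr_gt0 ?exprn_gt0 //.
have := ler_wpM2r (diam2_ge0 f c e) (sum_unitv_sq_le1 f (c e)); lra.
Qed.

(** The squares of [D] sum to at most [4 x^2], so AM-GM with weight [x] gives [8 x^2 + 5 x], and
    [x <= 1/100] for a short hyperedge. The case [x = 0] is apart because of the weight [1 / x]. *)
Lemma sum_feat_spread : \sum_y feat_spread y <= 6 * x.
Proof.
have -> : \sum_y feat_spread y = \sum_s (2 * D s ^+ 2 + 2 * (`|unitv f s (c e)| * D s)).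
  rewrite -(pair_bigA _ (fun s b => feat_spread (s, b))) /=; apply: eq_bigr => s _.
  by rewrite -sum_spos !big_bool /feat_spread /feat2 /feat /=; ring.
have x0 : 0 <= x by rewrite /x divr_ge0 ?diam_ge0 ?(ltW hnu).
have x1 : x <= 1 / 100.
  by rewrite /x ler_pdivrMr //; move: hs; rewrite /short; lra.
have [x00|xp] := eqVneq x 0.
  have hD : \sum_s D s ^+ 2 = 0.
    apply/eqP; rewrite eq_le sumr_ge0 ?andbT => [|s _]; last exact: sqr_ge0.
    by have := sum_D_sq; rewrite x00 expr0n mulr0.
  rewrite x00 mulr0 big1 // => s _.
  have : D s ^+ 2 = 0.
    have /eqP := hD; rewrite psumr_eq0 => [|? _]; last exact: sqr_ge0.
    by move/allP => /(_ s); rewrite mem_index_enum => /(_ isT) /= /eqP.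
  by move/eqP; rewrite sqrf_eq0 => /eqP ->; rewrite expr0n /= !mulr0 addr0.
have {x0 xp}x0 : 0 < x by rewrite lt_def xp x0.
have E s : 2 * D s ^+ 2 + 2 * (`|unitv f s (c e)| * D s) <=
    (2 + x^-1) * D s ^+ 2 + x * unitv f s (c e) ^+ 2.
  have := young (`|unitv f s (c e)|) (D s) x0; rewrite real_normK ?num_real //; lra.
apply: le_trans (ler_sum _ (fun s _ => E s)) _.
rewrite big_split /= -!mulr_sumr.
have h1 := ler_wpM2l (ltW x0) (sum_unitv_sq_le1 f (c e)).
have xi0 : 0 <= 2 + x^-1 by rewrite addr_ge0 // invr_ge0 ltW.
have h2 := ler_wpM2l xi0 sum_D_sq.
have h3 : (2 + x^-1) * (4 * x ^+ 2) = 8 * x ^+ 2 + 4 * x by field; rewrite gt_eqF.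
rewrite h3 in h2; have h4 : x ^+ 2 <= x / 100 by nra.
lra.
Qed.

End Spread.

Lemma hard_weights : exists l : 'I_k * bool -> V -> R,
  forall y, (forall t, 0 <= l y t) /\
    forall v, \sum_t l y t * (feat2 f y t <= feat2 f y v)%R%:R = feat2 f y v ^+ 2.
Proof.
have h y : exists l : V -> R, (forall t, 0 <= l t) /\
    forall v, \sum_t l t * (feat2 f y t <= feat2 f y v)%R%:R = feat2 f y v ^+ 2.
  by apply: layer_cake_sqr => v; exact: feat_ge0.
exact: (@fin_all_exists _ (fun=> V -> R) (fun y (l : V -> R) => (forall t, 0 <= l t) /\
    forall v, \sum_t l t * (feat2 f y t <= feat2 f y v)%R%:R = feat2 f y v ^+ 2) h).
Qed.

Section Step.
Variable l : 'I_k * bool -> V -> R.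
Hypothesis l0 : forall y t, 0 <= l y t.
Hypothesis hl : forall y v,
  \sum_t l y t * (feat2 f y t <= feat2 f y v)%R%:R = feat2 f y v ^+ 2.

Let L (z : ('I_k * bool) * V) : R := l z.1 z.2.

Lemma sum_hard_in v : \sum_z L z * (feat2 f z.1 z.2 <= feat2 f z.1 v)%R%:R =
  \sum_y feat2 f y v ^+ 2.
Proof.
rewrite -(pair_bigA _ (fun y t => l y t * (feat2 f y t <= feat2 f y v)%R%:R)) /=.
by apply: eq_bigr => y _; rewrite hl.
Qed.

Lemma hard_massE z S : hard_mass (hard_child z S) =
  \sum_(v in S) mass H f v * (feat2 f z.1 z.2 <= feat2 f z.1 v)%R%:R.
Proof.
rewrite /hard_mass /hard_child big_mkcond [RHS]big_mkcond; apply: eq_bigr => v _.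
by rewrite inE; case: (v \in S) => //=; case: (_ <= _); rewrite ?mulr1 ?mulr0.
Qed.

Lemma sum_hard_mass S : \sum_z L z * hard_mass (hard_child z S) = hard_mass S.
Proof.
under eq_bigr do rewrite hard_massE mulr_sumr.
rewrite exchange_big /=; apply: eq_bigr => v _.
under eq_bigr do rewrite mulrCA.
by rewrite -mulr_sumr sum_hard_in mass_sum_feat2.
Qed.

Lemma sum_hard_card S : \sum_z L z * #|hard_child z S|%:R <= #|S|%:R.
Proof.
have E z : #|hard_child z S|%:R = \sum_(v in S) (feat2 f z.1 z.2 <= feat2 f z.1 v)%R%:R :> R.
  rewrite -sum1_card natr_sum big_mkcond [RHS]big_mkcond /=; apply: eq_bigr => v _.
  by rewrite inE; case: (v \in S) => //=; case: (_ <= _).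
under eq_bigr do rewrite E mulr_sumr.
rewrite exchange_big /= -sum1_card natr_sum; apply: ler_sum => v _.
by rewrite sum_hard_in sum_feat2_sq_le1.
Qed.

(** Each of the [2 k] symbols contributes thresholds of total weight at most 1. This is the expected
    number of fees charged at a node. *)
Lemma sum_hard_weight : \sum_z L z <= 2 * K.
Proof.
rewrite -(pair_bigA _ (fun y t => l y t)) /=.
apply: (@le_trans _ _ (\sum_(y : 'I_k * bool) 1)).
  apply: ler_sum => y _; apply: (cake_total (l0 y) (hl y)) => // v.
  exact: feat_sq_le1.
by rewrite sumr_const card_prod card_ord card_bool -mulr_natl mulr1 natrM mulrC.
Qed.

(** Two vertices survive together with weight [min (p_u^2, p_v^2) <= p_u p_v], so the affinity bound
    gives [3/4 m^2 + m / 4], and [m < m^2 / 2] because [m > 2]. *)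
Lemma sum_hard_mass_sq S : 2 < hard_mass S ->
  \sum_z L z * hard_mass (hard_child z S) ^+ 2 <= 7 / 8 * hard_mass S ^+ 2.
Proof.
move=> h2.
have -> : \sum_z L z * hard_mass (hard_child z S) ^+ 2 =
  \sum_(u in S) \sum_(v in S) mass H f u * mass H f v *
    (\sum_y Num.min (feat2 f y u ^+ 2) (feat2 f y v ^+ 2)).
  under [RHS]eq_bigr => u _ do under eq_bigr => v _ do
    (under eq_bigr => y _ do rewrite -(cake_min (l0 y) (hl y));
     rewrite pair_bigA mulr_sumr).
  under [RHS]eq_bigr do rewrite exchange_big /=.
  rewrite [RHS]exchange_big /=; apply: eq_bigr => z _.
  rewrite hard_massE expr2 big_distrlr /= mulr_sumr; apply: eq_bigr => u _.
  rewrite mulr_sumr; apply: eq_bigr => v _.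
  rewrite /L; case: (_ <= _); case: (_ <= _); rewrite /=; ring.
apply: (@le_trans _ _ (\sum_(u in S) \sum_(v in S)
   (3 / 4 * (mass H f u * mass H f v) + 1 / 4 * mass H f v * (mass H f u * corr f u v ^+ 2)))).
  apply: ler_sum => u _; apply: ler_sum => v _.
  have h1 : \sum_y Num.min (feat2 f y u ^+ 2) (feat2 f y v ^+ 2) <= aff f u v.
    rewrite -sum_feat2; apply: ler_sum => y _.
    have a0 : 0 <= feat2 f y u by apply: feat_ge0.
    have b0 : 0 <= feat2 f y v by apply: feat_ge0.
    rewrite ge_min; case: (leP (feat2 f y u) (feat2 f y v)) => h; apply/orP; [left|right]; nra.
  have h3 := le_trans h1 (aff_le f u v).
  by have := ler_wpM2l (mulr_ge0 (mass0 u) (mass0 v)) h3; lra.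
under eq_bigr do rewrite big_split /=.
rewrite big_split /=.
have -> : \sum_(u in S) \sum_(v in S) 3 / 4 * (mass H f u * mass H f v) = 3 / 4 * hard_mass S ^+ 2.
  rewrite expr2 /hard_mass big_distrlr /= mulr_sumr; apply: eq_bigr => u _.
  by rewrite mulr_sumr.
have h4 : \sum_(u in S) \sum_(v in S) 1 / 4 * mass H f v * (mass H f u * corr f u v ^+ 2)
   <= 1 / 4 * hard_mass S.
  rewrite exchange_big mulr_sumr /=; apply: ler_sum => v _.
  rewrite -mulr_sumr; apply: ler_piMr; first by apply: mulr_ge0 => //; apply: divr_ge0.
  apply: le_trans (sum_mass_corr f_orth v).
  rewrite big_mkcond /=; apply: ler_sum => u _.
  by case: ifP => // _; apply: mulr_ge0; rewrite ?sqr_ge0.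
have h5 : hard_mass S * 2 <= hard_mass S ^+ 2 by nra.
lra.
Qed.

(** The fees of the children total at most [2 k / (8 k N) = 2 / (8 N)]; the coefficient of the mass
    changes by [1 / (8 N)], which pays for them exactly because the mass exceeds 2. *)
Lemma hard_good_step j S : 2 < hard_mass S ->
  hard_good j.+1 S <= \sum_z L z * hard_good j (hard_child z S).
Proof.
move=> h2.
have -> : \sum_z L z * hard_good j (hard_child z S) =
   (\sum_z L z * hard_mass (hard_child z S)) * (1 - j%:R / (8 * N%:R))
   - (8 * K * N%:R)^-1 * \sum_z L z
   - K / (12 * n) * (\sum_z L z * #|hard_child z S|%:R)
   - (\sum_z L z * hard_mass (hard_child z S) ^+ 2) * ((7 / 8) ^+ j / 2).
  rewrite !mulr_suml !mulr_sumr -!sumrB; apply: eq_bigr => z _.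
  by rewrite /hard_good; ring.
rewrite sum_hard_mass /hard_good -[j.+1]addn1 natrD exprD expr1.
have q0 : 0 <= (7 / 8 : R) ^+ j by apply: exprn_ge0; lra.
have q2 : 0 <= (7 / 8 : R) ^+ j / 2 by rewrite divr_ge0.
have h3 := ler_wpM2r q2 (sum_hard_mass_sq h2).
have kn : 0 <= K / (12 * n) by rewrite divr_ge0 ?mulr_ge0.
have h4 := ler_wpM2l kn (sum_hard_card S).
have kk : 0 <= (8 * K * N%:R)^-1 by rewrite invr_ge0 !mulr_ge0.
have h5 := ler_wpM2l kk sum_hard_weight.
have h6 : (8 * K * N%:R)^-1 * (2 * K) = 2 / (8 * N%:R).
  by field; rewrite !gt_eqF.
rewrite h6 in h5.
have N8 : 0 < (8 * N%:R : R)^-1 by rewrite invr_gt0 mulr_gt0.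
have h7 : 2 / (8 * N%:R) <= hard_mass S / (8 * N%:R) by rewrite ler_pM2r // ltW.
have -> : hard_mass S * (1 - (j%:R + 1) / (8 * N%:R)) =
  hard_mass S * (1 - j%:R / (8 * N%:R)) - hard_mass S / (8 * N%:R) by ring.
lra.
Qed.

(** With [x = diam / nu], an uncut hyperedge becomes cut with weight at most [12 x], and [12 x]
    times the charge [2 nu^2] is the increment [24 nu diam] of one round. A hyperedge already cut is
    met by children of total weight at most [1 + 6 x <= 13/12]. *)
Lemma hard_cost_step j S :
  \sum_z L z * hard_cost j (hard_child z S) <= hard_cost j.+1 S.
Proof.
rewrite /hard_cost; under eq_bigr do rewrite mulr_sumr.
rewrite exchange_big /=; apply: ler_sum => e /andP[he hs].
under eq_bigr do rewrite mulrCA.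
rewrite -mulr_sumr; apply: ler_wpM2l; first exact: weight_ge0.
under eq_bigr do rewrite mulrCA.
rewrite -mulr_sumr exprSr -mulrA; apply: ler_wpM2l; first by apply: exprn_ge0; lra.
have d0 := diam_ge0 e; have u0 := nrm_ge0 f (c e); have [ce cm] := c_min he.
have [nu0|nup] := eqVneq (nu e) 0.
  have z S' i : hard_term i S' e = 0.
    by rewrite /hard_term nu0 !mul0r expr0n mulr0 !if_same.
  by rewrite z mulr0 big1 // => y _; rewrite z mulr0.
have nu0 : 0 < nu e by rewrite lt_def nup u0.
pose A z := [exists v in e, feat2 f z.1 z.2 <= feat2 f z.1 v].
pose B z := [forall v in e, feat2 f z.1 z.2 <= feat2 f z.1 v].
have hsp := sum_feat_spread hs nu0.
have hA : \sum_z L z * (A z)%:R <= 1 + 6 * (diam e / nu e).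
  rewrite -(pair_bigA _ (fun y t => l y t * (A (y, t))%:R)) /=.
  apply: (@le_trans _ _ (\sum_y (feat2 f y (c e) ^+ 2 + feat_spread e y))).
    apply: ler_sum => y _; apply: (cake_ex (l0 y) (hl y)).
      by rewrite addr_ge0 ?sqr_ge0 ?feat_spread_ge0.
    move=> v ev; have := feat_spreadP he nu0 y ev.
    by rewrite ler_norml => /andP[_]; lra.
  rewrite big_split /=; apply: lerD => //; exact: sum_feat2_sq_le1.
have hAB : \sum_z L z * (A z && ~~ B z)%:R <= 2 * (6 * (diam e / nu e)).
  rewrite -(pair_bigA _ (fun y t => l y t * (A (y, t) && ~~ B (y, t))%:R)) /=.
  apply: (@le_trans _ _ (\sum_y 2 * feat_spread e y)).
    apply: ler_sum => y _; apply: (cake_split (l0 y) (hl y) ce) => v ev.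
    exact: (feat_spreadP he nu0).
  by rewrite -mulr_sumr ler_pM2l.
have hB : \sum_z L z * (B z)%:R <= 1.
  apply: le_trans (sum_feat2_sq_le1 f (c e)); rewrite -sum_hard_in.
  apply: ler_sum => z _; apply: ler_wpM2l; first exact: l0.
  rewrite ler_nat; case: (boolP (B z)) => // /forallP /(_ (c e)).
  by rewrite ce /= => ->.
have xE : diam e / nu e * nu e = diam e by rewrite divfK.
have x1 : diam e / nu e <= 1 / 100.
  by rewrite ler_pdivrMr //; move: hs; rewrite /short; lra.
rewrite {2}/hard_term; case: ifP => [eS|eS].
  have E z : hard_term j (hard_child z S) e =
     (B z)%:R * (nu e * diam e * (24 * j%:R + 6)) + (A z && ~~ B z)%:R * (2 * nu e ^+ 2).
    have -> : B z = (e \subset hard_child z S).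
      apply/forallP/subsetP => [h v ev|h v].
        by rewrite inE (subsetP eS) //=; have := h v; rewrite ev.
      by apply/implyP => /h; rewrite inE => /andP[].
    rewrite /hard_term; case: ifP => _ /=; first by rewrite andbF mul1r mul0r addr0.
    have -> : A z = (e :&: hard_child z S != set0).
      apply/existsP/set0Pn => -[v].
        by move=> /andP[ev h]; exists v; rewrite !inE ev (subsetP eS) //.
      by rewrite !inE => /and3P[ev _ h]; exists v; rewrite ev.
    by rewrite andbT mul0r add0r; case: (_ != _); rewrite ?mul1r ?mul0r.
  under eq_bigr do rewrite E mulrDr !mulrA.
  rewrite big_split /= -!mulr_suml.
  have g1 := mulr_ge0 u0 d0; have u2 : 0 <= 2 * nu e ^+ 2 by rewrite mulr_ge0 ?sqr_ge0.
  have j0 : 0 <= 24 * j%:R + 6 :> R by rewrite addr_ge0 ?mulr_ge0.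
  have h1 := ler_wpM2r (mulr_ge0 g1 j0) hB.
  have h2 := ler_wpM2r u2 hAB.
  have h3 : 2 * (6 * (diam e / nu e)) * (2 * nu e ^+ 2) = 24 * (nu e * diam e).
    by field; rewrite gt_eqF.
  rewrite h3 in h2; rewrite !mulrA in h1 h2 *.
  rewrite -[j.+1]addn1 natrD.
  have h4 := mulr_ge0 g1 (ler0n R j).
  lra.
have E z : hard_term j (hard_child z S) e <= (A z)%:R * (if e :&: S != set0 then 2 * nu e ^+ 2 else 0).
  rewrite /hard_term; case: ifP => [h|_].
    by move/negP: eS; case; apply: subset_trans h _; apply/subsetP => v; rewrite inE => /andP[].
  case: (eqVneq (e :&: hard_child z S) set0) => /= [_|/set0Pn[v]].
    by apply: mulr_ge0 => //; case: ifP => // _; rewrite mulr_ge0 ?sqr_ge0.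
  rewrite !inE => /and3P[ev Sv hv].
  have -> : A z by apply/existsP; exists v; rewrite ev.
  suff -> : e :&: S != set0 by rewrite mul1r.
  by apply/set0Pn; exists v; rewrite inE ev.
apply: (@le_trans _ _ (\sum_z L z * ((A z)%:R * (if e :&: S != set0 then 2 * nu e ^+ 2 else 0)))).
  by apply: ler_sum => z _; apply: ler_wpM2l => //; apply: l0.
under eq_bigr do rewrite mulrA.
rewrite -mulr_suml; apply: ler_wpM2r; last by lra.
by case: ifP => // _; rewrite mulr_ge0 ?sqr_ge0.
Qed.

End Step.

Lemma hard_step j S (t : R) : 2 < hard_mass S -> 0 <= t ->
  0 < hard_good j.+1 S -> hard_cost j.+1 S <= t * hard_good j.+1 S ->
  exists y, 0 < hard_good j (hard_child y S) /\
    hard_cost j (hard_child y S) <= t * hard_good j (hard_child y S).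
Proof.
move=> h2 t0 hg hh; have [l hl] := hard_weights.
have l0 y t' : 0 <= l y t' by case: (hl y).
have hl' y := (hl y).2.
apply: (@ratio_choice _ _ (fun z => l z.1 z.2) _ _ (hard_good j.+1 S)) => //.
- by move=> y; apply: hard_cost_ge0.
- exact: hard_good_step.
- by apply: le_trans hh; apply: hard_cost_step.
Qed.

(** Of the mass [k], one eighth prepays fees, one twelfth is the cardinality penalty and one half
    bounds the squared mass, as [(7/8)^N k <= 1]. The fee itself is at most [1/8], which [k >= 25]
    absorbs. *)
Lemma hard_good_root : (25 <= k)%N -> (7 / 8 : R) ^+ N * K <= 1 ->
  K / 4 <= hard_good N setT.
Proof.
move=> k25 hN.
have k25' : 25 <= K :> R by rewrite ler_nat.
have N1 : 1 <= N%:R :> R by rewrite ler1n.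
have mE : hard_mass setT = K.
  by rewrite -(sum_mass f_orth); apply: eq_bigl => v; rewrite inE.
rewrite /hard_good mE cardsT.
have -> : N%:R / (8 * N%:R) = 1 / 8 :> R by field; rewrite gt_eqF.
have -> : K / (12 * n) * n = K / 12 by field; rewrite gt_eqF.
have h1 : (8 * K * N%:R)^-1 <= 1 / 8.
  rewrite invf_ple ?posrE ?mulr_gt0 //; last by lra.
  have -> : (1 / 8 : R)^-1 = 8 by field.
  by nra.
have := ler_wpM2l (ltW K0) hN.
rewrite expr2; lra.
Qed.

Lemma sum_nu_sq : \sum_(e in edges H) weight H e * nu e ^+ 2 <= K.
Proof.
apply: (@le_trans _ _ (\sum_(e in edges H) weight H e * \sum_(v in e) sqnorm f v)).
  apply: ler_sum => e he; apply: ler_wpM2l; first exact: weight_ge0.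
  have [ce _] := c_min he; rewrite sqr_nrm (bigD1 (c e)) //= lerDl.
  by apply: sumr_ge0 => v _; apply: sqnorm_ge0.
by rewrite sum_edges_vertices (sum_mass f_orth).
Qed.

(** At the root all hyperedges are uncut. AM-GM with weight [z] splits [nu * diam]; both [nu ^+ 2]
    and [diam2 / z ^+ 2] have weighted total at most [k]. *)
Lemma hard_cost_root (z : R) : 0 < z -> xi <= z ^+ 2 ->
  hard_cost N setT <= (13 / 12) ^+ N * (24 * N%:R + 6) * (z * K).
Proof.
move=> z0 hz.
have q0 : 0 <= (13 / 12 : R) ^+ N * (24 * N%:R + 6).
  by apply: mulr_ge0; [apply: exprn_ge0; lra|apply: addr_ge0 => //; apply: mulr_ge0].
apply: (@le_trans _ _ ((13 / 12) ^+ N * (24 * N%:R + 6) *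
   \sum_(e in edges H) weight H e * (z / 2 * nu e ^+ 2 + z^-1 / 2 * diam2 f c e))).
  rewrite /hard_cost mulr_sumr big_mkcondr /=; apply: ler_sum => e he.
  have yg := young (nu e) (diam e) z0; rewrite sqr_diam in yg.
  have b0 := mulr_ge0 (nrm_ge0 f (c e)) (diam_ge0 e).
  have w0 := weight_ge0 he.
  have h : nu e * diam e <= z / 2 * nu e ^+ 2 + z^-1 / 2 * diam2 f c e by lra.
  case: ifP => _.
    rewrite /hard_term subsetT [X in _ <= X]mulrCA; apply: ler_wpM2l => //.
    rewrite [nu e * _ * _]mulrC mulrA.
    exact: ler_wpM2l.
  rewrite mulr_ge0 // mulr_ge0 //; lra.
apply: ler_wpM2l => //.
under eq_bigr do rewrite mulrDr [weight H _ * (z / 2 * _)]mulrCA [weight H _ * (z^-1 / 2 * _)]mulrCA.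
rewrite big_split /= -!mulr_sumr.
have z2 : 0 <= z / 2 by rewrite divr_ge0 // ltW.
have zi2 : 0 <= z^-1 / 2 by rewrite divr_ge0 // invr_ge0 ltW.
have h1 := ler_wpM2l z2 sum_nu_sq.
have h2 := le_trans (sum_diam2 f_orth f_disc c_min) (ler_wpM2r (ltW K0) hz).
have h3 := ler_wpM2l zi2 h2.
have h4 : z^-1 / 2 * (z ^+ 2 * K) = z / 2 * K by field; rewrite gt_eqF.
rewrite h4 in h3; lra.
Qed.

(** The final mass lies between [1 / (8 k N)], by the fee, and 2; for [j = 0] the upper bound comes
    from [m - m^2 / 2 > 0]. The upper bound limits the cardinality; the lower one turns the cost
    [101^2 xi k] of the long hyperedges into a multiple of the mass. A threshold on the norms inside
    [S] then makes the expected volume equal to the mass. *)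
Lemma hard_leaf j S (t z : R) : (j <= N)%N -> 0 < z -> xi <= z ^+ 2 -> 0 <= t ->
  0 < hard_good j S -> hard_cost j S <= t * hard_good j S ->
  (j = 0%N \/ hard_mass S <= 2) ->
  (#|S| * k <= 24 * #|V|)%N /\
  exists u, let S' := S :&: [set v | nrm f u <= nrm f v] in
    S' != set0 /\
    cut_weight H S' <= (t + 8 * 101 ^+ 2 * (K ^+ 2 * N%:R * z ^+ 2)) * volume H S'.
Proof.
move=> jN z0 hz t0 hg hc hj.
have m0 := hard_mass_ge0 S.
have kn : 0 <= K / (12 * n) by rewrite divr_ge0 ?mulr_ge0.
have a1 : 0 <= K / (12 * n) * #|S|%:R by rewrite mulr_ge0.
have a2 : 0 <= hard_mass S ^+ 2 * (7 / 8) ^+ j / 2.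
  by rewrite divr_ge0 // mulr_ge0 ?sqr_ge0 // exprn_ge0 //; lra.
have kk : 0 < (8 * K * N%:R)^-1 by rewrite invr_gt0 !mulr_gt0.
have a3 : 0 <= hard_mass S * (j%:R / (8 * N%:R)) by rewrite mulr_ge0 // divr_ge0 ?mulr_ge0.
have gm : hard_good j S <= hard_mass S by rewrite /hard_good; lra.
have mk : (8 * K * N%:R)^-1 < hard_mass S by move: hg; rewrite /hard_good; lra.
have mp : 0 < hard_mass S by apply: lt_trans mk.
have m2 : hard_mass S <= 2.
  case: hj => // j0; move: hg; rewrite /hard_good j0 expr0 mul0r; nra.
split.
  have : K / (12 * n) * #|S|%:R < 2 by move: hg; rewrite /hard_good; lra.
  rewrite mulrAC ltr_pdivrMr ?mulr_gt0 //.
  have -> : 2 * (12 * n) = (24 * #|V|)%:R by rewrite natrM; ring.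
  rewrite -natrM ltr_nat => h.
  by rewrite mulnC ltnW.
have [l [l0 hl]] := layer_cake_sqr (nrm_ge0 f).
pose St u := S :&: [set v | nrm f u <= nrm f v].
suff [u [u1 u2]] : exists u, 0 < volume H (St u) /\
    cut_weight H (St u) <= (t + 8 * 101 ^+ 2 * (K ^+ 2 * N%:R * z ^+ 2)) * volume H (St u).
  exists u; split=> //; apply/eqP => S0.
  by move: u1; rewrite /St S0 /volume big_set0 ltxx.
apply: (@ratio_choice _ _ l _ _ (hard_mass S)) => //.
- have c1 : 0 <= 8 * 101 ^+ 2 :> R by lra.
  have c2 : 0 <= K ^+ 2 * N%:R * z ^+ 2 by rewrite mulr_ge0 ?sqr_ge0 // mulr_ge0 ?sqr_ge0.
  by rewrite addr_ge0 // mulr_ge0.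
- by move=> u; apply: cut_weight_ge0.
- rewrite le_eqVlt; apply/orP; left; apply/eqP.
  rewrite /hard_mass; under [LHS]eq_bigr do rewrite /mass -sqr_nrm -hl mulr_sumr.
  rewrite exchange_big /=; apply: eq_bigr => u _; rewrite /volume mulr_sumr.
  rewrite big_mkcond [RHS]big_mkcond; apply: eq_bigr => v _; rewrite !inE.
  by case: (v \in S) => //=; case: (_ <= _); rewrite ?(mulr1, mulr0) // mulrC.
apply: (@le_trans _ _ (hard_cost j S + 101 ^+ 2 * (xi * K))); last first.
  have h1 : hard_cost j S <= t * hard_mass S by apply: le_trans hc _; apply: ler_wpM2l.
  have h2 : xi * K <= z ^+ 2 * K by rewrite ler_pM2r.
  have h3 : z ^+ 2 * K = 8 * (K ^+ 2 * N%:R * z ^+ 2) * (8 * K * N%:R)^-1.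
    by field; rewrite !gt_eqF.
  have h4 : 0 <= 8 * (K ^+ 2 * N%:R * z ^+ 2).
    by rewrite mulr_ge0 // mulr_ge0 ?sqr_ge0 // mulr_ge0 ?sqr_ge0.
  have := ler_wpM2l h4 (ltW mk); lra.
under eq_bigr do rewrite cut_weightE mulr_sumr.
rewrite exchange_big /=.
apply: (@le_trans _ _ (hard_cost j S + 101 ^+ 2 * \sum_(e in edges H) weight H e * diam2 f c e)); last first.
  rewrite lerD2l; apply: ler_wpM2l; first by lra.
  exact: (sum_diam2 f_orth f_disc c_min).
rewrite /hard_cost big_mkcondr mulr_sumr -big_split /=; apply: ler_sum => e he.
have w0 := weight_ge0 he; have d0 := diam_ge0 e; have u0 := nrm_ge0 f (c e).
have [ce cm] := c_min he.
under eq_bigr do rewrite mulrCA.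
rewrite -mulr_sumr.
have hex u : e \in boundary H (St u) -> [exists v in e, nrm f u <= nrm f v].
  rewrite /boundary inE => /and3P[_ /set0Pn[v]].
  by rewrite !inE => /and3P[ev _ hv] _; apply/existsP; exists v; rewrite ev.
have dd := diam2_ge0 f c e.
(* A long hyperedge is cut with weight at most its largest squared norm, hence at most
   [101 ^+ 2 * diam2]. *)
case: ifP => [hs|hs]; last first.
  rewrite add0r [101 ^+ 2 * _]mulrCA; apply: ler_wpM2l => //.
  apply: le_trans (cake_ex l0 hl (A := e) (B := 101 ^+ 2 * diam2 f c e) _ _).
  - by apply: ler_sum => u _; apply: ler_wpM2l => //; rewrite ler_nat; case: (boolP (e \in _)) => // /hex ->.
  - by apply: mulr_ge0 => //; lra.
  - move=> v ev; have h := nrm_le_diam he ev; have v0 := nrm_ge0 f v.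
    rewrite -sqr_diam; move/negbT: hs; rewrite /short -ltNge => hs.
    have : nrm f v <= 101 * diam e by lra.
    nra.
apply: ler_wpDr; first by apply: mulr_ge0; [lra|exact: mulr_ge0].
apply: ler_wpM2l => //.
have q1 : 1 <= (13 / 12 : R) ^+ j by apply: exprn_ege1; lra.
apply: (@le_trans _ _ (hard_term j S e)); last by rewrite ler_peMl ?hard_term_ge0.
have nd := mulr_ge0 u0 d0; move: (hs); rewrite /short => hs'.
rewrite /hard_term; case: ifP => [eS|eS].
  (* Inside [S] only the norm threshold can cut [e]. Squared norms differ from that of the centre by
     at most [2 nu diam + diam^2 <= 3 nu diam]; this is the constant 6 of [hard_term]. *)
  apply: (@le_trans _ _ (2 * (3 * (nu e * diam e)))).
    apply: le_trans (cake_split l0 hl ce (D := 3 * (nu e * diam e)) _).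
      apply: ler_sum => u _; apply: ler_wpM2l => //; rewrite ler_nat.
      case: (boolP (e \in _)) => // hb; rewrite (hex _ hb) /=.
      case: (boolP [forall v in e, _]) => // /forallP hf.
      move: hb; rewrite /boundary inE => /and3P[_ _ /set0Pn[v]]; rewrite !inE => /andP[ev].
      by have := hf v; rewrite ev (subsetP eS) //= => ->.
    move=> v ev; have h := nrm_le_diam he ev; have h' := cm v ev.
    rewrite ger0_norm ?subr_ge0 ?ler_pXn2r ?nnegrE //; last exact: nrm_ge0.
    nra.
  have := mulr_ge0 nd (ler0n R j); lra.
case: ifP => [eS2|eS2].
  apply: le_trans (cake_ex l0 hl (A := e) (B := 2 * nu e ^+ 2) _ _).
  - by apply: ler_sum => u _; apply: ler_wpM2l => //; rewrite ler_nat; case: (boolP (e \in _)) => // /hex ->.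
  - by rewrite mulr_ge0 ?sqr_ge0.
  - move=> v ev; have h := nrm_le_diam he ev; have v0 := nrm_ge0 f v.
    have : nrm f v <= 101 / 100 * nu e by lra.
    nra.
rewrite big1 // => u _; suff -> : e \in boundary H (St u) = false by rewrite mulr0.
apply/negP; rewrite /boundary inE => /and3P[_ /set0Pn[v]].
rewrite !inE => /and3P[ev Sv _] _.
suff : e :&: S != set0 by rewrite eS2.
by apply/set0Pn; exists v; rewrite inE ev.
Qed.

End Hard.

(** * Reasoning about source programs *)

Fixpoint modN (c : hcmd) : seq nat :=
  match c with
  | HSkip | HSetR _ _ _ _ => [::]
  | HSetN a _ _ _ => [:: a]
  | HSeq c1 c2 | HIf _ _ c1 c2 => modN c1 ++ modN c2
  | HFor _ c1 => modN c1
  end.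

Fixpoint modR (c : hcmd) : seq nat :=
  match c with
  | HSkip | HSetN _ _ _ _ => [::]
  | HSetR a _ _ _ => [:: a]
  | HSeq c1 c2 | HIf _ _ c1 c2 => modR c1 ++ modR c2
  | HFor _ c1 => modR c1
  end.

Section Frame.
Variable R : realType.
Implicit Types (s : state R) (r : seq nat).

Lemma upd_neq (A : Type) (M : nat -> nat -> nat -> A) a i j x b :
  b != a -> upd M a i j x b = M b.
Proof.
move=> /negPf ba; apply/boolp.funext => i'; apply/boolp.funext => j'.
by rewrite /upd ba.
Qed.

Lemma updE (A : Type) (M : nat -> nat -> nat -> A) a i j x i' j' :
  upd M a i j x a i' j' = if (i' == i) && (j' == j) then x else M a i' j'.
Proof. by rewrite /upd eqxx. Qed.

Lemma hevalN r c s a : a \notin modN c -> nmem (heval r c s) a = nmem s a.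
Proof.
elim: c r s => //=.
- by move=> b i j e r s; rewrite inE => h; apply: upd_neq.
- by move=> c1 H1 c2 H2 r s; rewrite mem_cat negb_or => /andP[h1 h2]; rewrite H2 ?H1.
- move=> e1 e2 c1 H1 c2 H2 r s; rewrite mem_cat negb_or => /andP[h1 h2].
  by case: ifP => _; [rewrite H1|rewrite H2].
- by move=> b c H r s h; elim: (bval s b) => //= n IH; rewrite H ?IH.
Qed.

Lemma hevalR r c s a : a \notin modR c -> rmem (heval r c s) a = rmem s a.
Proof.
elim: c r s => //=.
- by move=> b i j e r s; rewrite inE => h; apply: upd_neq.
- by move=> c1 H1 c2 H2 r s; rewrite mem_cat negb_or => /andP[h1 h2]; rewrite H2 ?H1.
- move=> e1 e2 c1 H1 c2 H2 r s; rewrite mem_cat negb_or => /andP[h1 h2].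
  by case: ifP => _; [rewrite H1|rewrite H2].
- by move=> b c H r s h; elim: (bval s b) => //= n IH; rewrite H ?IH.
Qed.

Lemma iterN_inv (P : nat -> state R -> Prop) n F s :
  P 0%N s -> (forall i s, (i < n)%N -> P i s -> P i.+1 (F i s)) -> P n (iterN n F s).
Proof.
move=> P0 h; suff: forall m, (m <= n)%N -> P m (iterN m F s) by exact.
by elim=> // m IH hm; apply: h => //; apply: IH; apply: ltnW.
Qed.

(** For exhaustive searches: [G] is reached at the latest when the witness [i0] is tried, and is
    never lost afterwards. *)
Lemma iterN_hit (I G : state R -> Prop) n F s i0 : (i0 < n)%N -> I s ->
  (forall i s, (i < n)%N -> I s -> I (F i s)) ->
  (forall i s, (i < n)%N -> I s -> G s -> G (F i s)) ->
  (forall s, I s -> G (F i0 s)) ->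
  I (iterN n F s) /\ G (iterN n F s).
Proof.
move=> hi0 Is hI hG hh.
have [] := @iterN_inv (fun i s => I s /\ ((i0 < i)%N -> G s)) n F s.
- by [].
- move=> i s' hi [Is' Gs']; split; first exact: hI.
  rewrite ltnS leq_eqVlt => /orP[/eqP <-|h]; first exact: hh.
  by apply: hG => //; apply: Gs'.
- by move=> I' G'; split=> //; apply: G'.
Qed.

Lemma fill1 r b a e s n (val : nat -> R) (Q : state R -> Prop) :
  bval s b = n -> Q s ->
  (forall s' i x, Q s' -> Q (State (nmem s') (upd (rmem s') a 0 i x) (coins s'))) ->
  (forall s' i, (i < n)%N -> Q s' -> hval (rcons r i) s' e = val i) ->
  let s1 := heval r (HFor b (HSetR a (IConst 0) (IVar (size r)) e)) s in
  Q s1 /\ forall i, (i < n)%N -> rmem s1 a 0%N i = val i.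
Proof.
move=> /= -> Qs hQ hv.
apply: (@iterN_inv (fun m s1 => Q s1 /\ forall i, (i < m)%N -> rmem s1 a 0%N i = val i)).
  by [].
move=> i s' hi [Q' h']; rewrite /= nth_rcons ltnn eqxx; split; first exact: hQ.
move=> i'; rewrite ltnS updE eqxx /=; case: eqP => [-> _|/eqP ne hle]; first exact: hv.
by apply: h'; rewrite ltn_neqAle ne.
Qed.

Lemma fill2 b1 b2 a e s n m (val : nat -> nat -> R) (Q : state R -> Prop) :
  Q s ->
  (forall s', Q s' -> bval s' b1 = n /\ bval s' b2 = m) ->
  (forall s' i j x, Q s' -> Q (State (nmem s') (upd (rmem s') a i j x) (coins s'))) ->
  (forall s' i j, (i < n)%N -> (j < m)%N -> Q s' -> hval [:: i; j] s' e = val i j) ->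
  let s1 := heval [::] (HFor b1 (HFor b2 (HSetR a (IVar 0) (IVar 1) e))) s in
  Q s1 /\ forall i j, (i < n)%N -> (j < m)%N -> rmem s1 a i j = val i j.
Proof.
move=> Qs hb hQ hv /=; have [-> _] := hb _ Qs.
apply: (@iterN_inv (fun p s1 => Q s1 /\
   forall i j, (i < p)%N -> (j < m)%N -> rmem s1 a i j = val i j)); first by [].
move=> i s' hi [Q' h'] /=; have [_ ->] := hb _ Q'.
have [||Q2 [h2 h3]] := @iterN_inv (fun p s1 => Q s1 /\
   ((forall i' j, (i' < i)%N -> (j < m)%N -> rmem s1 a i' j = val i' j) /\
    forall j, (j < p)%N -> rmem s1 a i j = val i j)) m
   (fun j s0 => State (nmem s0) (upd (rmem s0) a i j (hval [:: i; j] s0 e)) (coins s0)) s'.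
- by [].
- move=> j s2 hj [Q2 [h2 h3]]; split; first exact: hQ.
  split=> [i' j' hi' hj'|j'] /=; rewrite updE.
    by rewrite (ltn_eqF hi') /= h2.
  rewrite eqxx ltnS /=; case: eqP => [-> _|/eqP ne hle]; first exact: hv.
  by apply: h3; rewrite ltn_neqAle ne.
split=> // i' j'; rewrite ltnS leq_eqVlt => /orP[/eqP ->|]; first exact: h3.
exact: h2.
Qed.

End Frame.

(** * The program *)

Definition iV := IVar.
Definition c0 := IConst 0.
Definition bV := BCell 1 0.
Definition bE := BCell 1 1.
Definition bK := BCell 1 2.
Definition lit (m : nat) := HNat (IConst m).
Definition sqe e := HMul e e.

(* Natural arrays: 3 holds 1 + (vertex of least norm) of each hyperedge, cell
   (5, 0, 0) the number of rounds left, row 0 of 6 ceil(log2 k), 2 ^ ceil(log2 k)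
   and the number of rounds. Real arrays: 2 vertex weights, 3 norms, 4 unit
   vectors, 5 squared distances to the least vector of a hyperedge, 6 diameters,
   7 squared correlations, 8 current cluster, 9 candidate cluster, 10 best
   candidate, 11 and 12 scores, 13 candidate output set, 14-16 powers. *)
Definition eW x := HGet 0 c0 x.
Definition eF s x := HGet 1 s x.
Definition eVW x := HGet 2 c0 x.
Definition eNrm x := HGet 3 c0 x.
Definition eUnit s x := HGet 4 s x.
Definition eDist e x := HGet 5 e x.
Definition eDiam e := HGet 6 c0 e.
Definition eCorr2 x y := HGet 7 x y.
Definition eMass x := HMul (eVW x) (sqe (eNrm x)).
Definition iC e := ISub (IGet 3 c0 e) (IConst 1).
Definition iJ := IGet 5 c0 c0.
Definition iJ1 := ISub iJ (IConst 1).
Definition iN := IGet 6 c0 (IConst 2).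
Definition nV := HNat (IGet 0 c0 (IConst 0)).
Definition nK := HNat (IGet 0 c0 (IConst 2)).
Definition ifinc e x t := HLe (lit 1) (HNat (IGet 1 e x)) t (lit 0).

(** Loop bounds are constants or multiples of input dimensions, so the table runs up to [8 * k],
    which is at least the number of rounds. *)
Definition powers (a num den : nat) : hcmd :=
  HSeq (HSetR a c0 c0 (lit 1))
    (HFor (BCell 8 2)
       (HSetR a c0 (IAdd (iV 0) (IConst 1))
          (HMul (HGet a c0 (iV 0)) (HDiv (lit num) (lit den))))).

Definition rounds : hcmd :=
  HSeq (HSetN 6 c0 c0 c0)
 (HSeq (HSetN 6 c0 (IConst 1) (IConst 1))
 (HSeq (HFor bK
         (HIf (HNat (IGet 0 c0 (IConst 2))) (HNat (IGet 6 c0 (IConst 1))) HSkip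
           (HSeq (HSetN 6 c0 c0 (IAdd (IGet 6 c0 c0) (IConst 1)))
                 (HSetN 6 c0 (IConst 1) (IAdd (IGet 6 c0 (IConst 1)) (IGet 6 c0 (IConst 1)))))))
   (let d x := IAdd x x in HSetN 6 c0 (IConst 2) (d (d (d (IGet 6 c0 c0))))))).

Definition least : hcmd :=
  HFor bE (HFor bV
    (HIf (lit 1) (HNat (IGet 1 (iV 0) (iV 1)))
       (let set := HSetN 3 c0 (iV 0) (IAdd (iV 1) (IConst 1)) in
        HIf (lit 1) (HNat (IGet 3 c0 (iV 0)))
          (HIf (eNrm (iC (iV 0))) (eNrm (iV 1)) HSkip set) set)
       HSkip)).

Definition tab_vweight : hcmd :=
  HFor bV (HSetR 2 c0 (iV 0) (HSum bE (ifinc (iV 1) (iV 0) (eW (iV 1))))).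
Definition tab_norm : hcmd :=
  HFor bV (HSetR 3 c0 (iV 0) (HSqrt (HSum bK (sqe (eF (iV 1) (iV 0)))))).
Definition tab_unit : hcmd :=
  HFor bK (HFor bV (HSetR 4 (iV 0) (iV 1) (HDiv (eF (iV 0) (iV 1)) (eNrm (iV 1))))).
Definition tab_dist : hcmd :=
  HFor bE (HFor bV (HSetR 5 (iV 0) (iV 1)
    (HSum bK (sqe (HSub (eF (iV 2) (iV 1)) (eF (iV 2) (iC (iV 0)))))))).
Definition tab_diam : hcmd :=
  HFor bE (HSetR 6 c0 (iV 0) (HSqrt (HSum bK (HMax bV
    (ifinc (iV 0) (iV 2) (sqe (HSub (eF (iV 1) (iV 2)) (eF (iV 1) (iC (iV 0)))))))))).
Definition tab_corr : hcmd :=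
  HFor bV (HFor bV (HSetR 7 (iV 0) (iV 1)
    (sqe (HSum bK (HMul (eUnit (iV 2) (iV 0)) (eUnit (iV 2) (iV 1))))))).

Definition prep : hcmd :=
  foldr HSeq HSkip
    [:: rounds; powers 14 3 4; powers 15 7 8; powers 16 13 12; tab_vweight; tab_norm;
        tab_unit; least; tab_dist; tab_diam; tab_corr].

(* Comparing the ratios h / g (for g > 0) spares the program any knowledge of [xi]. *)
Definition consider (a : nat) (g h : hexp) (take : hcmd) : hcmd :=
  let x m := HGet a c0 (IConst m) in
  let accept := HSeq (HSetR a c0 (IConst 2) (x 0%N))
               (HSeq (HSetR a c0 (IConst 3) (x 1%N)) take) in
  HSeq (HSetR a c0 c0 g)
 (HSeq (HSetR a c0 (IConst 1) h)
       (HIf (x 0%N) (lit 0) HSkip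
       (HIf (x 2) (lit 0) accept
       (HIf (HMul (x 3) (x 0%N)) (HMul (x 1%N) (x 2)) HSkip accept)))).

(** Loop variables in a round: 0 is the round counter of [search], 1 the coordinate, 2 the sign, 3
    the threshold vertex, 4 the vertex being filled in. The expressions for children, scores and
    features rely on this numbering. *)
Definition candidates (ch g h : hexp) : hcmd :=
  HFor bK (HFor (BConst 2) (HFor bV
    (HSeq (HFor bV (HSetR 9 c0 (iV 4) ch))
       (consider 11 g h (HFor bV (HSetR 10 c0 (iV 4) (HGet 9 c0 (iV 4)))))))).

Definition round (ch g h : hexp) : hcmd :=
  HSeq (HSetR 11 c0 (IConst 2) (lit 0))
 (HSeq (candidates ch g h)
 (HSeq (HFor bV (HSetR 8 c0 (iV 1) (HGet 10 c0 (iV 1))))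
       (HSetN 5 c0 c0 iJ1))).

(** The loop has a fixed length and idles once no round is left or [stop <= 2]. The soft search
    passes the constant 3, so it always uses all its rounds. *)
Definition search (ch g h stop : hexp) : hcmd :=
  HSeq (HFor bV (HSetR 8 c0 (iV 0) (lit 1)))
 (HSeq (HSetN 5 c0 c0 iN)
  (HFor (BCell 8 2)
     (HIf (lit 1) (HNat iJ) (HIf stop (lit 2) HSkip (round ch g h)) HSkip))).

Definition eFeat x : hexp :=
  let y := HLe (HNat (iV 2)) (lit 0) (eUnit (iV 1) x) (HSub (lit 0) (eUnit (iV 1) x)) in
  HLe (lit 0) y y (lit 0).

Definition cand_val x := HGet 9 c0 x.

Definition soft_ch := HMul (HGet 8 c0 (iV 4)) (eFeat (iV 4)).
Definition soft_g :=
  let q := HGet 14 c0 iJ1 in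
  let P := HSum bV (HSum bV (HMul (eMass (iV 4)) (HMul (cand_val (iV 4)) (cand_val (iV 5))))) in
  let Q := HSum bV (HSum bV (HMul (HMul (eMass (iV 4)) (eCorr2 (iV 4) (iV 5)))
             (HDiv (HAdd (sqe (cand_val (iV 4))) (sqe (cand_val (iV 5)))) (lit 2)))) in
  HSub (HSum bV (HMul (eMass (iV 4)) (sqe (cand_val (iV 4)))))
       (HMul (HDiv nK (HMul (lit 12) nV))
             (HAdd (HMul q P) (HMul (HSub (lit 1) q) Q))).
Definition soft_h :=
  let c := iC (iV 4) in
  let d := eDist (iV 4) (iV 5) in
  HSum bE (HMul (eW (iV 4)) (HSum bV (ifinc (iV 4) (iV 5)
    (HAdd (HAdd (HMul (sqe (eNrm c)) (sqe (HSub (cand_val (iV 5)) (cand_val c))))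
                (HMul (HDiv (HNat iJ1) (lit 2))
                      (HMul d (HAdd (sqe (cand_val (iV 5))) (sqe (cand_val c))))))
          (HMul d (sqe (cand_val (iV 5)))))))).

Definition hard_ch := HMul (HGet 8 c0 (iV 4))
  (HLe (eFeat (iV 3)) (eFeat (iV 4)) (lit 1) (lit 0)).
Definition hard_g :=
  let m := HSum bV (HMul (eMass (iV 4)) (cand_val (iV 4))) in
  HSub (HSub (HSub
    (HMul m (HSub (lit 1) (HDiv (HNat iJ1) (HMul (lit 8) (HNat iN)))))
    (HDiv (lit 1) (HMul (HMul (lit 8) nK) (HNat iN))))
    (HMul (HDiv nK (HMul (lit 12) nV)) (HSum bV (cand_val (iV 4)))))
    (HDiv (HMul (sqe m) (HGet 15 c0 iJ1)) (lit 2)).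
Definition hard_h :=
  let nu := eNrm (iC (iV 4)) in
  let cnt := HSum bV (ifinc (iV 4) (iV 5) (cand_val (iV 5))) in
  let size := HSum bV (ifinc (iV 4) (iV 5) (lit 1)) in
  HSum bE (HLe (HMul (lit 100) (eDiam (iV 4))) nu
    (HMul (eW (iV 4)) (HMul (HGet 16 c0 iJ1)
       (HLe size cnt
          (HMul (HMul nu (eDiam (iV 4))) (HAdd (HMul (lit 24) (HNat iJ1)) (lit 6)))
          (HLe cnt (lit 0) (lit 0) (HMul (lit 2) (sqe nu))))))
    (lit 0)).
Definition hard_stop := HSum bV (HMul (eMass (iV 1)) (HGet 8 c0 (iV 1))).

Definition flag_val x := HGet 13 c0 x.
(** A hyperedge is cut when the number of flagged vertices in it is neither 0 nor its size. Empty
    sets are rejected by [consider], because their volume is not positive. *)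
Definition sweep : hcmd :=
  let vol := HSum bV (HMul (eVW (iV 2)) (flag_val (iV 2))) in
  let cnt := HSum bV (ifinc (iV 2) (iV 3) (flag_val (iV 3))) in
  let size := HSum bV (ifinc (iV 2) (iV 3) (lit 1)) in
  let cut := HSum bE (HMul (eW (iV 2))
     (HLe cnt (lit 0) (lit 0) (HLe size cnt (lit 0) (lit 1)))) in
  HFor bV (HFor bV
    (HSeq (HFor bV (HSetR 13 c0 (iV 2)
             (HLe (HGet 8 c0 (iV 0)) (HGet 8 c0 (iV 2))
                (HLe (eNrm (iV 1)) (eNrm (iV 2)) (lit 1) (lit 0)) (lit 0))))
       (HIf (HMul (HSum bV (flag_val (iV 2))) nK) (HMul (lit 24) nV)
          (consider 12 vol cut
             (HFor bV (HIf (lit 1) (flag_val (iV 2)) (HSetN 2 c0 (iV 2) (IConst 1))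
                           (HSetN 2 c0 (iV 2) (IConst 0)))))
          HSkip))).

(** The record in real array 12 is cleared only before the first sweep: hard sets compete with the
    best soft set, so the survivor is at least as good as both. *)
Definition algorithm : hcmd :=
  HIf nK (lit 24) (HFor bV (HSetN 2 c0 (iV 0) (IConst 1)))
   (HSeq prep
   (HSeq (search soft_ch soft_g soft_h (lit 3))
   (HSeq (HSetR 12 c0 (IConst 2) (lit 0))
   (HSeq sweep
   (HSeq (search hard_ch hard_g hard_h hard_stop) sweep))))).

Lemma algorithm_wf : cwf 0 algorithm.
Proof. by []. Qed.

(** * Keeping the candidate of best ratio *)

Section Consider.
Variable R : realType.
Implicit Types (s : state R) (r : seq nat).

Definition best_g a s : R := rmem s a 0%N 2%N.
Definition best_h a s : R := rmem s a 0%N 3%N.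
Definition good_ratio a t s : Prop := 0 < best_g a s /\ best_h a s <= t * best_g a s.

(** [Q] collects the facts that writing scores does not disturb. The last two clauses hold for every
    [t], a bound that the program never sees: a candidate of ratio at most [t] leaves such a record,
    and a record of this kind is never spoiled. *)
Lemma considerP r a g h take s gv hv (Q : state R -> Prop) :
  Q s -> (forall s' j x, Q s' -> Q (State (nmem s') (upd (rmem s') a 0 j x) (coins s'))) ->
  (forall s', Q s' -> hval r s' g = gv) -> (forall s', Q s' -> hval r s' h = hv) ->
  a \notin modR take ->
  let s' := heval r (consider a g h take) s in
  exists s2, [/\ Q s2,
    (s' = s2 /\ best_g a s2 = best_g a s /\ best_h a s2 = best_h a s) \/
    (s' = heval r take s2 /\ 0 < gv /\ best_g a s' = gv /\ best_h a s' = hv),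
    forall t, 0 < gv -> hv <= t * gv -> good_ratio a t s' &
    forall t, good_ratio a t s -> good_ratio a t s'].
Proof.
move=> Qs hQ hg hh ha.
rewrite /consider /= hg // hh; last exact: hQ.
rewrite !updE /=.
set s1 := State _ _ _; pose s2 := State (nmem s1) (upd (rmem s1) a 0 2 gv) (coins s1).
pose s3 := State (nmem s2) (upd (rmem s2) a 0 3 hv) (coins s2).
have Q1 : Q s1 by apply: (hQ (State _ _ _)); apply: hQ.
have Q3 : Q s3 by apply: (hQ s2); apply: hQ.
have g1 : best_g a s1 = best_g a s by rewrite /best_g /s1 /= !updE.
have h1 : best_h a s1 = best_h a s by rewrite /best_h /s1 /= !updE.
have g3 : best_g a (heval r take s3) = gv.
  by rewrite /best_g hevalR // /s3 /s2 /= !updE.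
have h3 : best_h a (heval r take s3) = hv.
  by rewrite /best_h hevalR // /s3 /s2 /= !updE.
rewrite -/(best_g a s) -/(best_h a s).
case: ifP => [gv0|/negbT].
  exists s1; split=> //; first by left.
    by move=> t gv1; have := lt_le_trans gv1 gv0; rewrite ltxx.
  by move=> t; rewrite /good_ratio g1 h1.
rewrite -ltNge => gv0.
have acc : (0 < best_g a s -> hv * best_g a s <= best_h a s * gv) ->
   exists s2 : state R,
  [/\ Q s2, heval r take s3 = s2 /\
         best_g a s2 = best_g a s /\ best_h a s2 = best_h a s \/
         heval r take s3 = heval r take s2 /\
         0 < gv /\ best_g a (heval r take s3) = gv /\ best_h a (heval r take s3) = hv,
      forall t, 0 < gv -> hv <= t * gv -> good_ratio a t (heval r take s3)
    & forall t, good_ratio a t s -> good_ratio a t (heval r take s3)].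
  move=> hle; exists s3; split=> //; first by right.
  - by move=> t _ hgv; split; rewrite g3 ?h3.
  - move=> t [b0 b1]; split; rewrite g3 // h3.
    have := hle b0; have := ler_wpM2r (ltW gv0) b1 => b2 b3.
    rewrite -(ler_pM2r b0); apply: le_trans b3 _; apply: le_trans b2 _.
    by rewrite mulrAC.
case: ifP => [b0|/negbT].
  by apply: acc => b1; have := lt_le_trans b1 b0; rewrite ltxx.
rewrite -ltNge => b0; case: ifP => [le1|/negbT].
  exists s1; split=> //; first by left.
  - move=> t _ hgv; split; rewrite g1 // h1 -(ler_pM2r gv0).
    apply: le_trans le1 _; rewrite mulrAC ler_pM2r //.
  - by move=> t; rewrite /good_ratio g1 h1.
by rewrite -ltNge => /ltW le1; apply: acc.
Qed.

End Consider.

(** * Finite types and their positions in [enum] *)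

Section Indexing.
Variables (R : realType) (T : finType) (A : {pred T}).

Definition pos_in (x : T) : nat := index x (enum A).

Lemma pos_in_lt x : x \in A -> (pos_in x < #|A|)%N.
Proof. by move=> Ax; rewrite cardE index_mem mem_enum. Qed.

Lemma pos_in_inj : {in A &, injective pos_in}.
Proof.
move=> x y Ax Ay h; rewrite -(@nth_index _ x x (enum A)) ?mem_enum //.
by rewrite -/(pos_in x) h nth_index ?mem_enum.
Qed.

Lemma pos_in_surj i : (i < #|A|)%N -> exists2 x, x \in A & i = pos_in x.
Proof.
rewrite cardE => hi; have [x0 _] : exists x0 : T, true.
  by move: hi; case: (enum A) => // x s _; exists x.
exists (nth x0 (enum A) i); first by rewrite -mem_enum mem_nth.
by rewrite /pos_in index_uniq ?enum_uniq.
Qed.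

Lemma sum_pos_in (F : nat -> R) : \sum_(i < #|A|) F i = \sum_(x in A) F (pos_in x).
Proof.
case: (pickP A) => [x0 Ax0|A0]; last first.
  rewrite [RHS]big_pred0 // big1 // => -[i hi] _.
  by exfalso; move: hi; rewrite eq_card0.
rewrite -(big_enum _ _ A) /= (big_nth x0) -cardE big_mkord; apply: eq_bigr => i _.
by rewrite /pos_in index_uniq ?enum_uniq // -cardE.
Qed.

(** Turns a function on elements into one on positions, the form in which the array-filling lemmas
    state their values; 0 off the range. *)
Definition lift_pos (F : T -> R) (i : nat) : R :=
  if [pick x in A | pos_in x == i] is Some x then F x else 0.

Lemma lift_posE F x : x \in A -> lift_pos F (pos_in x) = F x.
Proof.
move=> Ax; rewrite /lift_pos; case: pickP => [y /andP[Ay /eqP h]|/(_ x)].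
  by rewrite (pos_in_inj Ay Ax h).
by rewrite Ax eqxx.
Qed.

End Indexing.

Section MaxR.
Variable R : realType.
Implicit Types (F : nat -> R).

Lemma maxn_R_ge0 n F : 0 <= maxn_R n F.
Proof. by elim: n => //= n IH; rewrite le_max IH. Qed.

Lemma maxn_R_ge n F i : (i < n)%N -> F i <= maxn_R n F.
Proof.
elim: n => //= n IH; rewrite ltnS leq_eqVlt => /orP[/eqP ->|hi].
  by rewrite le_max lexx orbT.
by rewrite le_max IH.
Qed.

Lemma maxn_R_le n F B : 0 <= B -> (forall i, (i < n)%N -> F i <= B) -> maxn_R n F <= B.
Proof.
move=> B0; elim: n => //= n IH h; rewrite ge_max h // IH // => i hi.
by apply: h; apply: ltnW.
Qed.

End MaxR.

(** * Tables computed from the input *)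

Section Tables.
Variables (R : realType) (V : finType) (H : hypergraph R V).
Variables (k : nat) (f : 'I_k -> V -> R).

Definition vi (v : V) : nat := pos_in V v.
Definition ei (e : {set V}) : nat := pos_in (edges H) e.

Lemma vi_lt v : (vi v < #|V|)%N.
Proof. exact: pos_in_lt. Qed.

Lemma vi_inj : injective vi.
Proof. by move=> u v; apply: pos_in_inj. Qed.

Lemma vi_surj i : (i < #|V|)%N -> exists v, i = vi v.
Proof. by case/pos_in_surj => v _ ->; exists v. Qed.

Lemma ei_surj i : (i < #|edges H|)%N -> exists2 e, e \in edges H & i = ei e.
Proof. exact: pos_in_surj. Qed.

Lemma sum_vi (F : nat -> R) n : n = #|V| -> \sum_(i < n) F i = \sum_v F (vi v).
Proof. by move=> ->; rewrite sum_pos_in; apply: eq_bigl. Qed.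

Lemma sum_ei (F : nat -> R) n : n = #|edges H| ->
  \sum_(i < n) F i = \sum_(e in edges H) F (ei e).
Proof. by move=> ->; rewrite sum_pos_in. Qed.

Lemma if_nat_bool (A : Type) (b : bool) (x y : A) :
  (if (1%:R <= (b : nat)%:R :> R) then x else y) = if b then x else y.
Proof. by rewrite ler_nat; case: b. Qed.

Implicit Types (A : nat -> nat -> nat) (B : nat -> nat -> R) (s : state R).

Definition sizesP A := [/\ A 0%N 0%N = #|V|, A 0%N 1%N = #|edges H| & A 0%N 2%N = k].
Definition incP A := forall e v, e \in edges H -> A (ei e) (vi v) = (v \in e) :> nat.
Definition wP B := forall e, e \in edges H -> B 0%N (ei e) = weight H e.
Definition fP B := forall (i : 'I_k) v, B i (vi v) = f i v.
Definition vwP B := forall v, B 0%N (vi v) = vweight H v.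
Definition nrmP B := forall v, B 0%N (vi v) = nrm f v.
Definition unitP B := forall (i : 'I_k) v, B i (vi v) = unitv f i v.
Definition leastP (c : {set V} -> V) A :=
  forall e, e \in edges H -> A 0%N (ei e) = (vi (c e)).+1.
Definition distP (c : {set V} -> V) B :=
  forall e v, e \in edges H -> B (ei e) (vi v) = sqdist f v (c e).
Definition diamP (c : {set V} -> V) B :=
  forall e, e \in edges H -> B 0%N (ei e) = diam f c e.
Definition corrP B := forall u v, B (vi u) (vi v) = corr f u v ^+ 2.
Definition powP (q : R) B := forall j, (j <= 8 * k)%N -> B 0%N j = q ^+ j.
Definition least_vertex (c : {set V} -> V) := forall e, e \in edges H ->
  c e \in e /\ forall v, v \in e -> nrm f (c e) <= nrm f v.

Lemma bval_V s : sizesP (nmem s 0) -> bval s bV = #|V|.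
Proof. by case=> h _ _; rewrite /= mul1n h. Qed.
Lemma bval_E s : sizesP (nmem s 0) -> bval s bE = #|edges H|.
Proof. by case=> _ h _; rewrite /= mul1n h. Qed.
Lemma bval_K s : sizesP (nmem s 0) -> bval s bK = k.
Proof. by case=> _ _ h; rewrite /= mul1n h. Qed.

Lemma hsum_V r s e : sizesP (nmem s 0) ->
  hval r s (HSum bV e) = \sum_v hval (rcons r (vi v)) s e.
Proof.
by move=> h; apply: (sum_vi (fun i => hval (rcons r i) s e)); rewrite -(bval_V h).
Qed.

Lemma hsum_E r s e : sizesP (nmem s 0) ->
  hval r s (HSum bE e) = \sum_(x in edges H) hval (rcons r (ei x)) s e.
Proof.
by move=> h; apply: (sum_ei (fun i => hval (rcons r i) s e)); rewrite -(bval_E h).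
Qed.

Lemma hsum_K r s e : sizesP (nmem s 0) ->
  hval r s (HSum bK e) = \sum_(i < k) hval (rcons r i) s e.
Proof.
by move=> h; rewrite -[in RHS](bval_K h).
Qed.

Lemma rpow2 (x : R) : x * x = x ^+ 2.
Proof. by rewrite expr2. Qed.

Lemma powersP a num den s : sizesP (nmem s 0) ->
  powP (num%:R / den%:R) (rmem (heval [::] (powers a num den) s) a).
Proof.
move=> sz /= j; set s0 := State _ _ _.
have -> : (8 * nmem s 0 0 2 = 8 * k)%N by case: sz => _ _ ->.
move: j; apply: (@iterN_inv _ (fun m s1 => forall j, (j <= m)%N ->
   rmem s1 a 0%N j = (num%:R / den%:R) ^+ j)).
  by case=> // _; rewrite /s0 /= updE.
move=> i s' hi h j; rewrite /= updE eqxx /= addn1.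
case: eqP => [-> _|/eqP ne]; first by rewrite h // mulrC -exprS.
by rewrite leq_eqVlt (negPf ne) /= ltnS; apply: h.
Qed.

Lemma tab_vweightP s : sizesP (nmem s 0) -> incP (nmem s 1) -> wP (rmem s 0) ->
  vwP (rmem (heval [::] tab_vweight s) 2).
Proof.
move=> sz inc w v.
have [|||_ h] := @fill1 R [::] bV 2 (HSum bE (ifinc (iV 1) (iV 0) (eW (iV 1)))) s #|V|
   (lift_pos V (vweight H))
   (fun s => [/\ sizesP (nmem s 0), incP (nmem s 1) & wP (rmem s 0)]) (bval_V sz).
- by [].
- by move=> s' i x [h1 h2 h3]; split=> //=; rewrite upd_neq.
- move=> s' i /vi_surj[u ->] [h1 h2 h3].
  rewrite lift_posE // hsum_E // /vweight [RHS]big_mkcondr /=; apply: eq_bigr => e he.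
  by rewrite h2 // if_nat_bool h3.
by rewrite [LHS]h ?vi_lt // lift_posE.
Qed.

Lemma tab_normP s : sizesP (nmem s 0) -> fP (rmem s 1) ->
  nrmP (rmem (heval [::] tab_norm s) 3).
Proof.
move=> sz hf v.
have [|||_ h] := @fill1 R [::] bV 3 (HSqrt (HSum bK (sqe (eF (iV 1) (iV 0))))) s #|V|
   (lift_pos V (nrm f)) (fun s => sizesP (nmem s 0) /\ fP (rmem s 1)) (bval_V sz).
- by [].
- by move=> s' i x [h1 h2]; split=> //=; rewrite upd_neq.
- move=> s' i /vi_surj[u ->] [h1 h2]; rewrite lift_posE //= -/bK.
  have := hsum_K [:: vi u] (sqe (eF (iV 1) (iV 0))) h1; rewrite /= => ->.
  by congr Num.sqrt; apply: eq_bigr => t _; rewrite h2 rpow2.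
by rewrite [LHS]h ?vi_lt // lift_posE.
Qed.

Lemma tab_unitP s : sizesP (nmem s 0) -> fP (rmem s 1) -> nrmP (rmem s 3) ->
  unitP (rmem (heval [::] tab_unit s) 4).
Proof.
move=> sz hf hn i v.
have [||||_ h] := @fill2 R bK bV 4 (HDiv (eF (iV 0) (iV 1)) (eNrm (iV 1))) s k #|V|
   (fun i => lift_pos V (fun v => if insub i is Some i' then unitv f i' v else 0))
   (fun s => [/\ sizesP (nmem s 0), fP (rmem s 1) & nrmP (rmem s 3)]).
- by [].
- by move=> s' [h1 _ _]; rewrite bval_K // bval_V.
- by move=> s' i' j x [h1 h2 h3]; split=> //=; rewrite upd_neq.
- move=> s' i' j hi /vi_surj[u ->] [h1 h2 h3]; rewrite lift_posE // insubT /=.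
  by rewrite h3 /unitv -h2.
by rewrite [LHS]h ?vi_lt // lift_posE // valK.
Qed.

Lemma tab_corrP s : sizesP (nmem s 0) -> unitP (rmem s 4) ->
  corrP (rmem (heval [::] tab_corr s) 7).
Proof.
move=> sz hu u v.
have [||||_ h] := @fill2 R bV bV 7
   (sqe (HSum bK (HMul (eUnit (iV 2) (iV 0)) (eUnit (iV 2) (iV 1))))) s #|V| #|V|
   (fun i => lift_pos V (fun v => lift_pos V (fun u => corr f u v ^+ 2) i))
   (fun s => sizesP (nmem s 0) /\ unitP (rmem s 4)).
- by [].
- by move=> s' [h1 _]; rewrite bval_V.
- by move=> s' i' j x [h1 h2]; split=> //=; rewrite upd_neq.
- move=> s' i j /vi_surj[u' ->] /vi_surj[v' ->] [h1 h2]; rewrite !lift_posE // /sqe.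
  rewrite [LHS]/= rpow2; congr (_ ^+ 2).
  have := hsum_K [:: vi u'; vi v'] (HMul (eUnit (iV 2) (iV 0)) (eUnit (iV 2) (iV 1))) h1.
  by rewrite /= => ->; apply: eq_bigr => t _; rewrite !h2.
by rewrite [LHS]h ?vi_lt // !lift_posE.
Qed.

Lemma tab_distP s c : sizesP (nmem s 0) -> fP (rmem s 1) -> leastP c (nmem s 3) ->
  distP c (rmem (heval [::] tab_dist s) 5).
Proof.
move=> sz hf hc e v he.
have [||||_ h] := @fill2 R bE bV 5
   (HSum bK (sqe (HSub (eF (iV 2) (iV 1)) (eF (iV 2) (iC (iV 0)))))) s #|edges H| #|V|
   (fun i => lift_pos V (fun v => lift_pos (edges H) (fun e => sqdist f v (c e)) i))
   (fun s => [/\ sizesP (nmem s 0), fP (rmem s 1) & leastP c (nmem s 3)]).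
- by [].
- by move=> s' [h1 _ _]; rewrite bval_V // bval_E.
- by move=> s' i' j x [h1 h2]; split=> //=; rewrite upd_neq.
- move=> s' i j /ei_surj[e' he' ->] /vi_surj[v' ->] [h1 h2 h3].
  rewrite !lift_posE // hsum_K //; apply: eq_bigr => t _.
  by rewrite /sqe /= h3 // subn1 /= !h2 rpow2.
by rewrite [LHS]h ?vi_lt ?pos_in_lt // !lift_posE.
Qed.

Lemma tab_diamP s c : sizesP (nmem s 0) -> incP (nmem s 1) -> fP (rmem s 1) ->
  leastP c (nmem s 3) -> diamP c (rmem (heval [::] tab_diam s) 6).
Proof.
move=> sz hi hf hc e he.
have [|||_ h] := @fill1 R [::] bE 6 (HSqrt (HSum bK (HMax bV
    (ifinc (iV 0) (iV 2) (sqe (HSub (eF (iV 1) (iV 2)) (eF (iV 1) (iC (iV 0))))))))) s #|edges H|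
   (lift_pos (edges H) (diam f c))
   (fun s => [/\ sizesP (nmem s 0), incP (nmem s 1), fP (rmem s 1) & leastP c (nmem s 3)]) (bval_E sz).
- by [].
- by move=> s' i x [h1 h2 h3 h4]; split=> //=; rewrite upd_neq.
- move=> s' i0 /ei_surj[e' he' ->] [h1 h2 h3 h4]; rewrite lift_posE // /diam.
  rewrite [LHS]/=; congr Num.sqrt.
  have := hsum_K [:: ei e'] (HMax bV
    (ifinc (iV 0) (iV 2) (sqe (HSub (eF (iV 1) (iV 2)) (eF (iV 1) (iC (iV 0))))))) h1.
  rewrite [X in X = _ -> _]/= => ->; apply: eq_bigr => i _.
  have := bval_V h1; rewrite /= => ->.
  have E v : (if 1%:R <= (nmem s' 1 (ei e') (vi v))%:R :> R
   then
    (rmem s' 1 i (vi v) - rmem s' 1 i (nmem s' 3 0 (ei e') - 1)) *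
    (rmem s' 1 i (vi v) - rmem s' 1 i (nmem s' 3 0 (ei e') - 1))
   else 0) = if v \in e' then (f i v - f i (c e')) ^+ 2 else 0.
    by rewrite h2 // if_nat_bool h4 // subn1 /= !h3 rpow2.
  apply/eqP; rewrite eq_le; apply/andP; split.
    apply: maxn_R_le => [|j /vi_surj[v ->]]; first exact: maxdiff_ge0.
    by rewrite E; case: ifP => ev; [exact: maxdiff_ge|exact: maxdiff_ge0].
  apply/bigmax_leP; split=> [|v ev]; first exact: maxn_R_ge0.
  apply: le_trans (maxn_R_ge _ (vi_lt v)).
  by rewrite E ev.
by rewrite [LHS]h ?pos_in_lt // lift_posE.
Qed.

Lemma leastE s (v0 : V) : sizesP (nmem s 0) -> incP (nmem s 1) -> nrmP (rmem s 3) ->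
  (forall i, nmem s 3 0%N i = 0%N) ->
  exists c, least_vertex c /\ leastP c (nmem (heval [::] least s) 3).
Proof.
move=> sz hi hn h0.
pose Q s' := [/\ sizesP (nmem s' 0), incP (nmem s' 1) & nrmP (rmem s' 3)].
(* Meaning of a cell after the first [m] vertices: 0 for no vertex of [e] so far, otherwise the
   successor of the position of the shortest one. *)
pose P0 m (e : {set V}) x := 
  if x is y.+1 then exists c, [/\ y = vi c, c \in e & forall v, (vi v < m)%N -> v \in e -> nrm f c <= nrm f v]
  else forall v, (vi v < m)%N -> v \notin e.
have key : Q (heval [::] least s) /\ forall e, e \in edges H ->
    P0 #|V| e (nmem (heval [::] least s) 3 0%N (ei e)).
  rewrite /least [heval _ _ _]/=; have /= -> := bval_E sz.
  pose I m s' := [/\ Q s', forall e, e \in edges H -> (ei e < m)%N ->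
      P0 #|V| e (nmem s' 3 0%N (ei e)) & forall i, (m <= i)%N -> nmem s' 3 0%N i = 0%N].
  set s1 := iterN _ _ s; suff : I #|edges H| s1.
    by move=> [Q' h _]; split=> // e he; apply: h => //; apply: pos_in_lt.
  apply: iterN_inv; first by split.
  - move=> i s' /ei_surj[e he ->] [Q' h1 h2]; have [sz' _ _] := Q'.
    have /= -> := bval_V sz'.
    pose J m s1 := [/\ Q s1, forall i, i != ei e ->
        nmem s1 3 0%N i = nmem s' 3 0%N i & P0 m e (nmem s1 3 0%N (ei e))].
    set s2 := iterN _ _ s'; suff : J #|V| s2.
      move=> [Q2 g1 g2]; split=> //.
        move=> e1 he1; rewrite ltnS leq_eqVlt => /orP[/eqP h|h].
          by rewrite (pos_in_inj he1 he h).
        have ne : ei e1 != ei e by rewrite neq_ltn h.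
        by rewrite g1 //; apply: h1.
      move=> i' hi'; have ne : i' != ei e by rewrite neq_ltn hi' orbT.
      by rewrite g1 // h2 // ltnW.
    apply: iterN_inv; first by split=> //; rewrite h2.
    + move=> j s3 /vi_surj[v ->] [[sz1 i1 n1] g1 g2].
      rewrite i1 // if_nat_bool.
      have Qu x : Q (State (upd (nmem s3) 3 0 (ei e) x) (rmem s3) (coins s3)).
        by split=> //=; rewrite upd_neq.
      have vstep (P : V -> Prop) : (forall u, (vi u < vi v)%N -> P u) -> P v ->
          forall u, (vi u < (vi v).+1)%N -> P u.
        move=> h hv u; rewrite ltnS leq_eqVlt => /orP[/eqP/vi_inj -> //|]; exact: h.
      case: ifP => ev; last first.
        split=> //; move: g2; rewrite /P0; case: (nmem s3 3 0 (ei e)) => [h|y [c [yc ce h]]].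
          by apply: vstep => //; rewrite ev.
        by exists c; split=> //; apply: vstep => //; rewrite ev.
      have new : (forall u, (vi u < vi v)%N -> u \in e -> nrm f v <= nrm f u) ->
        [/\ Q (State (upd (nmem s3) 3 0 (ei e) (vi v + 1)) (rmem s3) (coins s3)),
          forall i0 : nat, i0 != ei e ->
            nmem (State (upd (nmem s3) 3 0 (ei e) (vi v + 1)) (rmem s3) (coins s3)) 3 0 i0 =
            nmem s' 3 0 i0
        & P0 (vi v).+1 e
           (nmem (State (upd (nmem s3) 3 0 (ei e) (vi v + 1)) (rmem s3) (coins s3)) 3 0 (ei e))].
        move=> h; split=> //=.
          by move=> i0 /negPf hi0; rewrite updE hi0 g1 ?hi0.
        rewrite updE !eqxx -[X in P0 _ _ X]/(vi v + 1)%N addn1.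
        by exists v; split=> //; apply: vstep.
      rewrite ler_nat; move: g2; case E : (nmem s3 3 0 (ei e)) => [|y] /=.
        move=> h; apply: new => u hu ue; by have := h u hu; rewrite ue.
      move=> [c [yc ce h]]; rewrite subn1 /= yc !n1.
      case: ifP => hcv.
        by split=> //; rewrite E; exists c; split=> //; apply: vstep.
      apply: new => u hu ue; apply: le_trans (h u hu ue).
      by move/negbT: hcv; rewrite -ltNge => /ltW.
have {}key e : exists c, e \in edges H -> [/\ c \in e, forall v, v \in e -> nrm f c <= nrm f v
    & nmem (heval [::] least s) 3 0%N (ei e) = (vi c).+1].
  case: (boolP (e \in edges H)) => he; last by exists v0.
  case: key => _ /(_ e he); rewrite /P0; case: (nmem _ 3 0%N (ei e)) => [h|y [c [-> ce h]]].
    have [v ev] : exists v, v \in e.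
      by apply/set0Pn; apply/eqP => e0; have := edges_neq0 H; rewrite -e0 he.
    by have := h v (vi_lt v); rewrite ev.
  by exists c => _; split=> // v; apply: h; apply: vi_lt.
have [c hc] := @fin_all_exists _ (fun=> V) _ key.
by exists c; split=> e he; have [h1 h2 h3] := hc e he.
Qed.

End Tables.

Ltac frames := repeat first
  [ rewrite hevalR; [|by []] | rewrite hevalN; [|by []]
  | rewrite hevalR; [by []|] | rewrite hevalN; [by []|] ].

Lemma heval_foldr_cons (R : realType) r p l (s : state R) :
  heval r (foldr HSeq HSkip (p :: l)) s = heval r (foldr HSeq HSkip l) (heval r p s).
Proof. by []. Qed.

Section Prep.
Variables (R : realType) (V : finType) (H : hypergraph R V).
Variables (k : nat) (f : 'I_k -> V -> R).
Implicit Types (s : state R).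

(** The exponent grows only while [2 ^ l < k], so [2 ^ l] stays below [2 * k]; [k] iterations
    suffice because [k < 2 ^ k]. *)
Lemma roundsP s : sizesP H k (nmem s 0) -> (2 <= k)%N ->
  exists l, [/\ (k <= 2 ^ l)%N, (2 ^ l < 2 * k)%N, (0 < l <= k)%N &
    nmem (heval [::] rounds s) 6 0%N 2%N = (8 * l)%N].
Proof.
move=> sz k2; rewrite /rounds [heval _ _ _]/=.
set m := (X in iterN X _ _).
have -> : m = k by case: sz => _ _ h; rewrite -[m]/(1 * nmem s 0 0 2)%N h mul1n.
set F := (X in iterN _ X _); set s0 := (X in iterN _ _ X).
pose I m s' := sizesP H k (nmem s' 0) /\ exists l, [/\ nmem s' 6 0%N 0%N = l,
  nmem s' 6 0%N 1%N = (2 ^ l)%N, (l <= m)%N, (2 ^ l < 2 * k)%N & (k <= 2 ^ l)%N \/ l = m].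
suff : I k (iterN k F s0).
  move=> [_ [l [h0 h1 lk h2 h3]]]; exists l.
  have hk : (k <= 2 ^ l)%N.
    by case: h3 => // ->; apply/ltnW/ltn_expl.
  split=> //.
    rewrite lk andbT lt0n; apply/eqP => l0; move: hk; rewrite l0 expn0; lia.
  by rewrite /= updE /= h0; lia.
apply: iterN_inv.
  split; first by rewrite /s0 /= !upd_neq.
  by exists 0%N; rewrite /s0 /= !updE /=; split=> //; [lia|right].
move=> i s' hi [sz' [l [h0 h1 li h2 h3]]]; rewrite /F.
have kE : nmem s' 0 0%N 2%N = k by case: sz'.
rewrite /= kE h1 ler_nat; case: leqP => hk.
  split=> //; exists l; split=> //; [by apply: leqW|by left].
have il : l = i by case: h3 => // h3; lia.
split; first by rewrite /= !upd_neq.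
exists l.+1; rewrite /= !updE /= h0 h1; split.
- by rewrite addn1.
- by rewrite expnS mul2n addnn.
- by rewrite ltnS.
- by rewrite expnS; lia.
- by right; rewrite il.
Qed.

Record tab (c : {set V} -> V) (N : nat) s : Prop := Tab {
  t_sz : sizesP H k (nmem s 0);
  t_inc : incP H (nmem s 1);
  t_least : leastP H c (nmem s 3);
  t_N : nmem s 6 0%N 2%N = N;
  t_w : wP H (rmem s 0);
  t_vw : vwP H (rmem s 2);
  t_nrm : nrmP f (rmem s 3);
  t_unit : unitP f (rmem s 4);
  t_dist : distP H f c (rmem s 5);
  t_diam : diamP H f c (rmem s 6);
  t_corr : corrP f (rmem s 7);
  t_34 : powP k (3%:R / 4%:R) (rmem s 14);
  t_78 : powP k (7%:R / 8%:R) (rmem s 15);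
  t_1312 : powP k (13%:R / 12%:R) (rmem s 16) }.

Definition tabN : seq nat := [:: 0; 1; 3; 6]%N.
Definition tabR : seq nat := [:: 0; 2; 3; 4; 5; 6; 7; 14; 15; 16]%N.

Lemma tab_eq c N s s' : tab c N s ->
  (forall a, a \in tabN -> nmem s' a = nmem s a) ->
  (forall a, a \in tabR -> rmem s' a = rmem s a) -> tab c N s'.
Proof. by case=> ? ? ? ? ? ? ? ? ? ? ? ? ? ? hN hR; split; rewrite ?hN ?hR. Qed.

Lemma tab_heval c N r p s : all (fun a => a \notin modN p) tabN ->
  all (fun a => a \notin modR p) tabR -> tab c N s -> tab c N (heval r p s).
Proof.
move=> /allP h1 /allP h2 ht; apply: tab_eq ht _ _ => a ha.
  by rewrite hevalN // h1.
by rewrite hevalR // h2.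
Qed.

Lemma tab_updR c N s a i j x : a \notin tabR -> tab c N s ->
  tab c N (State (nmem s) (upd (rmem s) a i j x) (coins s)).
Proof.
move=> ha ht; apply: tab_eq ht _ _ => // b hb; rewrite /= upd_neq //.
by apply: contraNneq ha => <-.
Qed.

Lemma prepP s (v0 : V) : (2 <= k)%N -> sizesP H k (nmem s 0) -> incP H (nmem s 1) ->
  wP H (rmem s 0) -> fP f (rmem s 1) -> (forall i, nmem s 3 0%N i = 0%N) ->
  exists c l, [/\ least_vertex H f c, (k <= 2 ^ l)%N, (2 ^ l < 2 * k)%N,
    (0 < l <= k)%N & tab c (8 * l) (heval [::] prep s)].
Proof.
move=> k2 sz inc w hf h0.
pose s1 := heval [::] rounds s.
pose s2 := heval [::] (powers 14 3 4) s1.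
pose s3 := heval [::] (powers 15 7 8) s2.
pose s4 := heval [::] (powers 16 13 12) s3.
pose s5 := heval [::] tab_vweight s4.
pose s6 := heval [::] tab_norm s5.
pose s7 := heval [::] tab_unit s6.
pose s8 := heval [::] least s7.
pose s9 := heval [::] tab_dist s8.
pose s10 := heval [::] tab_diam s9.
pose s11 := heval [::] tab_corr s10.
rewrite /prep !heval_foldr_cons [foldr _ _ _]/= -/s1 -/s2 -/s3 -/s4 -/s5 -/s6 -/s7 -/s8 -/s9 -/s10 -/s11.
have [l [l1 l2 l3 l4]] := roundsP sz k2.
have sz1 : sizesP H k (nmem s1 0) by rewrite /s1; frames.
have sz2 : sizesP H k (nmem s2 0) by rewrite /s2; frames.
have sz3 : sizesP H k (nmem s3 0) by rewrite /s3; frames.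
have sz4 : sizesP H k (nmem s4 0) by rewrite /s4; frames.
have sz5 : sizesP H k (nmem s5 0) by rewrite /s5; frames.
have sz6 : sizesP H k (nmem s6 0) by rewrite /s6; frames.
have sz7 : sizesP H k (nmem s7 0) by rewrite /s7; frames.
have sz8 : sizesP H k (nmem s8 0) by rewrite /s8; frames.
have sz9 : sizesP H k (nmem s9 0) by rewrite /s9; frames.
have sz10 : sizesP H k (nmem s10 0) by rewrite /s10; frames.
have a34 := powersP 14 3 4 sz1; have a78 := powersP 15 7 8 sz2.
have a13 := powersP 16 13 12 sz3.
rewrite -/s2 in a34; rewrite -/s3 in a78; rewrite -/s4 in a13.
have inc4 : incP H (nmem s4 1) by rewrite /s4 /s3 /s2 /s1; frames.
have w4 : wP H (rmem s4 0) by rewrite /s4 /s3 /s2 /s1; frames.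
have f5 : fP f (rmem s5 1) by rewrite /s5 /s4 /s3 /s2 /s1; frames.
have f6 : fP f (rmem s6 1) by rewrite /s6; frames.
have vw5 := tab_vweightP sz4 inc4 w4; rewrite -/s5 in vw5.
have n6 := tab_normP sz5 f5; rewrite -/s6 in n6.
have u7 := tab_unitP sz6 f6 n6; rewrite -/s7 in u7.
have inc7 : incP H (nmem s7 1) by rewrite /s7 /s6 /s5; frames.
have n7 : nrmP f (rmem s7 3) by rewrite /s7; frames.
have h7 : forall i, nmem s7 3 0%N i = 0%N by rewrite /s7 /s6 /s5 /s4 /s3 /s2 /s1; frames.
have [c [hc l8]] := leastE v0 sz7 inc7 n7 h7; rewrite -/s8 in l8.
have f8 : fP f (rmem s8 1) by rewrite /s8 /s7; frames.
have f9 : fP f (rmem s9 1) by rewrite /s9; frames.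
have inc9 : incP H (nmem s9 1) by rewrite /s9 /s8; frames.
have l9 : leastP H c (nmem s9 3) by rewrite /s9; frames.
have d9 := tab_distP sz8 f8 l8; rewrite -/s9 in d9.
have d10 := tab_diamP sz9 inc9 f9 l9; rewrite -/s10 in d10.
have u10 : unitP f (rmem s10 4) by rewrite /s10 /s9 /s8; frames.
have c11 := tab_corrP sz10 u10; rewrite -/s11 in c11.
exists c, l; split=> //; split=> //.
- by rewrite /s11; frames.
- by rewrite /s11 /s10; frames.
- by rewrite /s11 /s10; frames.
- rewrite -l4 -/s1 /s11 /s10 /s9 /s8 /s7 /s6 /s5 /s4 /s3 /s2.
  move: (s1) => s1'; by frames.
- by rewrite /s11 /s10 /s9 /s8 /s7 /s6 /s5; frames.
- by rewrite /s11 /s10 /s9 /s8 /s7 /s6; frames.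
- by rewrite /s11 /s10 /s9 /s8; frames.
- by rewrite /s11; frames.
- by rewrite /s11 /s10; frames.
- by rewrite /s11; frames.
- by rewrite /s11 /s10 /s9 /s8 /s7 /s6 /s5 /s4 /s3; frames.
- by rewrite /s11 /s10 /s9 /s8 /s7 /s6 /s5 /s4; frames.
- by rewrite /s11 /s10 /s9 /s8 /s7 /s6 /s5; frames.
Qed.

Lemma inputP omega : let s := input H f omega in
  [/\ sizesP H k (nmem s 0), incP H (nmem s 1), wP H (rmem s 0), fP f (rmem s 1) &
      forall i, nmem s 3 0%N i = 0%N].
Proof.
split=> //.
- move=> e v he; rewrite /= /load /=.
  have ee : e \in enum (edges H) by rewrite mem_enum.
  have vv : v \in enum V by rewrite mem_enum.
  rewrite (nth_map e) ?index_mem // nth_index // (nth_map v) ?index_mem // nth_index //.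
- move=> e he; rewrite /= /load /=.
  have ee : e \in enum (edges H) by rewrite mem_enum.
  by rewrite (nth_map e) ?index_mem // nth_index.
- move=> i v; rewrite /= /load /=.
  have vv : v \in enum V by rewrite mem_enum.
  rewrite (nth_map i) ?size_enum_ord // nth_ord_enum (nth_map v) ?index_mem // nth_index //.
- by case.
Qed.

End Prep.

(** * The method of conditional expectations as a program *)

Section Search.
Variables (R : realType) (V : finType) (H : hypergraph R V).
Variables (k : nat) (f : 'I_k -> V -> R) (c : {set V} -> V) (N : nat).
Implicit Types (s : state R) (x : V -> R) (y : ('I_k * bool) * V).

Local Notation tab := (tab H f c N).

Definition denotes s a x : Prop := forall v, rmem s a 0%N (vi v) = x v.

Lemma denotes_eq s s' a x : rmem s' a = rmem s a -> denotes s a x -> denotes s' a x.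
Proof. by move=> h hr v; rewrite h. Qed.

Lemma fill_denotes r a e s x (Q : state R -> Prop) : Q s ->
  (forall s', Q s' -> sizesP H k (nmem s' 0)) ->
  (forall s' i z, Q s' -> Q (State (nmem s') (upd (rmem s') a 0 i z) (coins s'))) ->
  (forall s' v, Q s' -> hval (rcons r (vi v)) s' e = x v) ->
  let s1 := heval r (HFor bV (HSetR a (IConst 0) (IVar (size r)) e)) s in
  Q s1 /\ denotes s1 a x.
Proof.
move=> Qs hsz hQ hv.
have [||||Q1 h] := @fill1 R r bV a e s #|V| (lift_pos V x) Q.
- exact: bval_V (hsz _ Qs).
- by [].
- by [].
- by move=> s' i /vi_surj[v ->] Q'; rewrite lift_posE // hv.
by split=> // v; rewrite h ?vi_lt // lift_posE.
Qed.

(** Soft and hard searches are two instances: [Val] singles out the admissible contents of the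
    cluster array (nonnegative functions, indicators), and [child], [gf], [hf], [stopf] are the
    mathematical counterparts of the four expressions. *)
Variables (ch g h stop : hexp).
Variables (Val : (V -> R) -> Prop) (child : ('I_k * bool) * V -> (V -> R) -> V -> R).
Variables (gf hf : nat -> (V -> R) -> R) (stopf : (V -> R) -> bool).
Hypothesis Hch : forall s m (i : 'I_k) (b : bool) t v x, tab s -> denotes s 8 x ->
  hval [:: m; nat_of_ord i; nat_of_bool b; vi t; vi v] s ch = child ((i, b), t) x v.
Hypothesis Hg : forall s m1 m2 m3 m4 x j, tab s -> denotes s 9 x -> Val x ->
  nmem s 5 0%N 0%N = j.+1 -> (j < N)%N -> hval [:: m1; m2; m3; m4] s g = gf j x.
Hypothesis Hh : forall s m1 m2 m3 m4 x j, tab s -> denotes s 9 x -> Val x ->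
  nmem s 5 0%N 0%N = j.+1 -> (j < N)%N -> hval [:: m1; m2; m3; m4] s h = hf j x.
Hypothesis Hstop : forall s m x, tab s -> denotes s 8 x -> Val x ->
  (hval [:: m] s stop <= 2%:R) = stopf x.
Hypothesis Val_child : forall y x, Val x -> Val (child y x).

Section Candidates.
Variables (t : R) (x : V -> R) (j m : nat) (y0 : ('I_k * bool) * V).
Hypotheses (jN : (j < N)%N) (Vx : Val x).
Hypotheses (g0 : 0 < gf j (child y0 x)) (h0 : hf j (child y0 x) <= t * gf j (child y0 x)).

Definition cand_inv s : Prop :=
  [/\ tab s, denotes s 8 x, nmem s 5 0%N 0%N = j.+1 &
    0 < best_g 11 s -> exists y, [/\ denotes s 10 (child y x),
      best_g 11 s = gf j (child y x) & best_h 11 s = hf j (child y x)]].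

Definition cand_body : hcmd :=
  HSeq (HFor bV (HSetR 9 c0 (iV 4) ch))
       (consider 11 g h (HFor bV (HSetR 10 c0 (iV 4) (HGet 9 c0 (iV 4))))).

Lemma cand_bodyP s (i : 'I_k) (b : bool) v : cand_inv s ->
  let s' := heval [:: m; nat_of_ord i; nat_of_bool b; vi v] cand_body s in
  [/\ cand_inv s', good_ratio 11 t s -> good_ratio 11 t s' &
      y0 = ((i, b), v) -> good_ratio 11 t s'].
Proof.
move=> [T r8 hj hb].
set r := [:: m; nat_of_ord i; nat_of_bool b; vi v].
pose y := ((i, b), v).
pose s1 := heval r (HFor bV (HSetR 9 c0 (iV 4) ch)) s.
pose take := HFor bV (HSetR 10 c0 (iV 4) (HGet 9 c0 (iV 4))).
rewrite -[heval r cand_body s]/(heval r (consider 11 g h take) s1).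
have [||||[T1 r81] r91] := @fill_denotes r 9 ch s (child y x) (fun s => tab s /\ denotes s 8 x).
- by [].
- by move=> s' [/t_sz].
- move=> s' i' z [T' r']; by split=> //; exact: tab_updR.
- by move=> s' u [T' r']; exact: (Hch m i b v u T' r').
rewrite -/s1 in T1 r81 r91.
have e10 : rmem s1 10 = rmem s 10 by rewrite /s1; frames.
have e11 : rmem s1 11 = rmem s 11 by rewrite /s1; frames.
have j1 : nmem s1 5 0%N 0%N = j.+1 by rewrite /s1; frames.
have Vy : Val (child y x) by apply: Val_child.
have [||||//|s2 [[T2 r82 r92 j2 e2] hcase hhit hmono]] := @considerP R r 11 g h take s1
   (gf j (child y x)) (hf j (child y x))
   (fun s => [/\ tab s, denotes s 8 x, denotes s 9 (child y x), nmem s 5 0%N 0%N = j.+1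
      & rmem s 10 = rmem s1 10]).
- by [].
- move=> s' q z [T' r8' r9' j' e']; split=> //; exact: tab_updR.
- by move=> s' [T' _ r9' j' _]; apply: Hg.
- by move=> s' [T' _ r9' j' _]; apply: Hh.
have bg1 : best_g 11 s1 = best_g 11 s by rewrite /best_g e11.
have bh1 : best_h 11 s1 = best_h 11 s by rewrite /best_h e11.
set s' := heval r (consider _ _ _ _) s1 in hcase hhit hmono *.
split.
- case: hcase => [[e [b1 b2]]|[e [gp [b1 b2]]]].
    rewrite e; split=> // hp.
    have [|z [z1 z2 z3]] := hb; first by rewrite -bg1 -b1.
    exists z; rewrite b1 b2 bg1 bh1; split=> //.
    by apply: denotes_eq z1; rewrite e2.
  have [||||[T3 r83] r103] := @fill_denotes r 10 (HGet 9 c0 (iV 4)) s2 (child y x)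
     (fun s => (tab s /\ denotes s 8 x) /\ (denotes s 9 (child y x) /\ nmem s 5 0%N 0%N = j.+1)).
  + by [].
  + by move=> s3 [[/t_sz]].
  + move=> s3 i' z [[T' r8'] [r9' j']]; split; split=> //.
    exact: tab_updR.
  + by move=> s3 u [_ [r9' _]]; rewrite /= r9'.
  rewrite -[heval r _ s2]/(heval r take s2) -e in T3 r83 r103.
  case: T3 r83 => T3 r83 [_ j3]; split=> // _.
  by exists y.
- by move=> [b1 b2]; apply: hmono; split; rewrite ?bg1 ?bh1.
- by move=> ey; have ey' : y = y0 by []; apply: hhit; rewrite ey'.
Qed.

(** The child [y0] supplied by averaging is tried at some iteration, which makes the recorded ratio
    at most [t]. The child finally recorded may be another one. *)
Lemma candidatesP s : cand_inv s ->
  cand_inv (heval [:: m] (candidates ch g h) s) /\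
  good_ratio 11 t (heval [:: m] (candidates ch g h) s).
Proof.
move=> Is; have [i0 [b0 [t0 ey0]]] : exists i b v, y0 = (i, b, v).
  by case: y0 => -[i b] v; exists i, b, v.
have ord_ex i : (i < k)%N -> exists i' : 'I_k, i = i' by move=> hi; exists (Ordinal hi).
have bool_ex i : (i < 2)%N -> exists b : bool, i = b.
  by case: i => [|[|//]] _; [exists false|exists true].
have sizes s' : cand_inv s' -> sizesP H k (nmem s' 0) by case=> /t_sz.
have inner i b s' : cand_inv s' ->
  let s1 := heval [:: m; nat_of_ord i; nat_of_bool b] (HFor bV cand_body) s' in
  [/\ cand_inv s1, good_ratio 11 t s' -> good_ratio 11 t s1 &
    (i0, b0) = (i, b) -> good_ratio 11 t s1].
  move=> I'; rewrite /=; have /= -> := bval_V (sizes _ I').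
  have step q s1 : (q < #|V|)%N -> cand_inv s1 -> let s2 :=
      heval [:: m; nat_of_ord i; nat_of_bool b; q] cand_body s1 in
      [/\ cand_inv s2, good_ratio 11 t s1 -> good_ratio 11 t s2 &
      (i0, b0, t0) = (i, b, t0) /\ q = vi t0 -> good_ratio 11 t s2].
    move=> /vi_surj[v ->] I1; have [q1 q2 q3] := cand_bodyP i b v I1.
    by split=> // -[[ei eb] /vi_inj ev]; apply: q3; rewrite ey0 ei eb ev.
  split.
  - apply: (@iterN_inv R (fun _ => cand_inv)) => // q s1 hq I1.
    by have [] := step q s1 hq I1.
  - move=> G0.
    apply: (proj2 (@iterN_inv R (fun _ s => cand_inv s /\ good_ratio 11 t s) #|V|
      (fun q => heval [:: m; nat_of_ord i; nat_of_bool b; q] cand_body) s' _ _)) => //.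
    by move=> q s1 hq [I1 G1]; have [q1 q2 _] := step q s1 hq I1; split; [|apply: q2].
  - move=> [ei eb].
    apply: (proj2 (@iterN_hit R cand_inv (good_ratio 11 t) #|V|
      (fun q => heval [:: m; nat_of_ord i; nat_of_bool b; q] cand_body) s' (vi t0)
      (vi_lt t0) I' _ _ _)).
    + by move=> q s1 hq I1; have [] := step q s1 hq I1.
    + by move=> q s1 hq I1 G1; have [_ q2 _] := step q s1 hq I1; apply: q2.
    + move=> s1 I1; have [_ _ q3] := step (vi t0) s1 (vi_lt t0) I1.
      by apply: q3; rewrite ei eb.
have middle i s' : cand_inv s' ->
  let s1 := heval [:: m; nat_of_ord i] (HFor (BConst 2) (HFor bV cand_body)) s' in
  [/\ cand_inv s1, good_ratio 11 t s' -> good_ratio 11 t s1 &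
    i0 = i -> good_ratio 11 t s1].
  move=> I'; pose F q := @heval R [:: m; nat_of_ord i; q] (HFor bV cand_body).
  rewrite -[heval _ _ s']/(iterN 2 F s').
  have step q s1 : (q < 2)%N -> cand_inv s1 ->
      [/\ cand_inv (F q s1), good_ratio 11 t s1 -> good_ratio 11 t (F q s1) &
      i0 = i /\ q = b0 -> good_ratio 11 t (F q s1)].
    move=> /bool_ex[b ->] I1; have [q1 q2 q3] := inner i b s1 I1.
    split=> // -[e eb]; apply: q3; rewrite e; congr pair.
    by move: eb; case: (b); case: (b0).
  split.
  - apply: (@iterN_inv R (fun _ => cand_inv)) => // q s1 hq I1.
    by have [] := step q s1 hq I1.
  - move=> G0.
    apply: (proj2 (@iterN_inv R (fun _ s => cand_inv s /\ good_ratio 11 t s) 2 F s' _ _)) => //.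
    by move=> q s1 hq [I1 G1]; have [q1 q2 _] := step q s1 hq I1; split; [|apply: q2].
  - move=> ei.
    have b02 : (b0 < 2)%N by case: (b0).
    apply: (proj2 (@iterN_hit R cand_inv (good_ratio 11 t) 2 F s' b0 b02 I' _ _ _)).
    + by move=> q s1 hq I1; have [] := step q s1 hq I1.
    + by move=> q s1 hq I1 G1; have [_ q2 _] := step q s1 hq I1; apply: q2.
    + move=> s1 I1; have [_ _ q3] := step b0 s1 b02 I1.
      by apply: q3.
pose F q := @heval R [:: m; q] (HFor (BConst 2) (HFor bV cand_body)).
have -> : heval [:: m] (candidates ch g h) s = iterN k F s.
  by rewrite -[in RHS](bval_K (sizes _ Is)).
apply: (@iterN_hit R cand_inv (good_ratio 11 t) k F s i0) => //.
- by move=> q s1 /ord_ex[i ->] I1; have [] := middle i s1 I1.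
- by move=> q s1 /ord_ex[i ->] I1 G1; have [_ q2 _] := middle i s1 I1; apply: q2.
- by move=> s1 I1; have [_ _ q3] := middle i0 s1 I1; apply: q3.
Qed.

End Candidates.

Hypothesis Hstep : forall x j t, Val x -> 0 <= t -> stopf x = false ->
  0 < gf j.+1 x -> hf j.+1 x <= t * gf j.+1 x ->
  exists y, 0 < gf j (child y x) /\ hf j (child y x) <= t * gf j (child y x).

Definition search_inv (t : R) x j s : Prop :=
  [/\ tab s, denotes s 8 x, Val x, nmem s 5 0%N 0%N = j &
    [/\ (j <= N)%N, 0 < gf j x & hf j x <= t * gf j x]].

Lemma roundP t x j m s : 0 <= t -> stopf x = false -> search_inv t x j.+1 s ->
  exists x', search_inv t x' j (heval [:: m] (round ch g h) s).
Proof.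
move=> t0 sx [T r8 Vx hj [jN gp hp]].
have [y0 [y1 y2]] := Hstep Vx t0 sx gp hp.
pose s1 := heval [:: m] (HSetR 11 c0 (IConst 2) (lit 0)) s.
pose s2 := heval [:: m] (candidates ch g h) s1.
pose s3 := heval [:: m] (HFor bV (HSetR 8 c0 (iV 1) (HGet 10 c0 (iV 1)))) s2.
pose s4 := heval [:: m] (HSetN 5 c0 c0 iJ1) s3.
rewrite -[heval _ _ s]/s4.
have I1 : cand_inv x j s1.
  split.
  - exact: tab_heval T.
  - by apply: denotes_eq r8; rewrite /s1; frames.
  - by rewrite /s1; frames.
  - by rewrite /best_g /s1 /= updE /= ltxx.
have [[T2 r82 j2 b2] [G1 G2]] := candidatesP m jN Vx y1 y2 I1; rewrite -/s2 in T2 r82 j2 b2 G1 G2.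
have [y [z1 z2 z3]] := b2 G1.
have [||||[T3 _] r83] := @fill_denotes [:: m] 8 (HGet 10 c0 (iV 1)) s2 (child y x)
     (fun s => tab s /\ denotes s 10 (child y x)).
- by [].
- by move=> s' [/t_sz].
- move=> s' i' z [T' r']; by split=> //; exact: tab_updR.
- by move=> s' u [_ r9']; rewrite /= r9'.
rewrite -[heval _ _ s2]/s3 in T3 r83.
exists (child y x); split.
- exact: tab_heval T3.
- by apply: denotes_eq r83; rewrite /s4 hevalR.
- exact: Val_child.
- have -> : nmem s4 5 0%N 0%N = (nmem s3 5 0%N 0%N - 1)%N by rewrite /= updE.
  have -> : nmem s3 5 = nmem s2 5 by rewrite /s3 hevalN.
  by rewrite j2 subn1.
- by split; [exact: ltnW|rewrite -z2|rewrite -z2 -z3].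
Qed.

Lemma searchP t s : 0 <= t -> Val (fun=> 1) -> (N <= 8 * k)%N -> tab s ->
  0 < gf N (fun=> 1) -> hf N (fun=> 1) <= t * gf N (fun=> 1) ->
  exists x j, search_inv t x j (heval [::] (search ch g h stop) s) /\
    (j = 0%N \/ stopf x).
Proof.
move=> t0 V1 N8 T gp hp.
pose s1 := heval [::] (HFor bV (HSetR 8 c0 (iV 0) (lit 1))) s.
pose s2 := heval [::] (HSetN 5 c0 c0 iN) s1.
have [||||T1 r81] := @fill_denotes [::] 8 (lit 1) s (fun=> 1) tab.
- by [].
- by move=> s' /t_sz.
- by move=> s' i' z T'; exact: tab_updR.
- by [].
rewrite -[heval _ _ s]/s1 in T1 r81.
have I2 : search_inv t (fun=> 1) N s2.
  split=> //; first exact: tab_heval T1.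
  by rewrite /s2 /= updE /=; exact: t_N T1.
pose body := HIf (lit 1) (HNat iJ) (HIf stop (lit 2) HSkip (round ch g h)) HSkip.
have -> : heval [::] (search ch g h stop) s = iterN (8 * k) (fun q => heval [:: q] body) s2.
  by case: I2 => /t_sz[_ _ h2] _ _ _ _; rewrite -h2.
(* While the search is not stopped, [q] iterations leave [N - q] rounds; after [8 * k >= N]
   iterations none is left. *)
have := @iterN_inv R (fun q s => exists x j, search_inv t x j s /\ (stopf x \/ j = (N - q)%N))
   (8 * k)%N (fun q => heval [:: q] body) s2.
case.
- by exists (fun=> 1), N; split=> //; right; rewrite subn0.
- move=> q s3 hq [x [j [I3 hj]]]; case: (I3) => T3 r3 V3 j3 [jN3 gp3 hp3].
  rewrite /body [heval _ _ _]/= j3 ler_nat; case: j j3 I3 hj jN3 gp3 hp3 => [|j] j3 I3 hj jN3 gp3 hp3 /=.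
    by exists x, 0%N; split=> //; case: hj => [->|h1]; [left|right; lia].
  rewrite (Hstop q T3 r3 V3); case sx : (stopf x); first by exists x, j.+1; split=> //; left.
  have [x' I4] := roundP q t0 sx I3.
  exists x', j; split=> //; right; case: hj => [|h1]; [by rewrite sx|lia].
- move=> x [j [I3 hj]]; exists x, j; split=> //.
  by case: hj => [->|->]; [right|left; lia].
Qed.

End Search.

(** * The program's expressions and sweeps compute the intended quantities *)

Section Eval.
Variables (R : realType) (V : finType) (H : hypergraph R V).
Variables (k : nat) (f : 'I_k -> V -> R) (c : {set V} -> V) (N : nat).
Implicit Types (s : state R) (x : V -> R) (S e : {set V}).

Local Notation tab := (tab H f c N).

Lemma hvalD r s a b : hval r s (HAdd a b) = hval r s a + hval r s b.
Proof. by []. Qed.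
Lemma hvalB r s a b : hval r s (HSub a b) = hval r s a - hval r s b.
Proof. by []. Qed.
Lemma hvalM r s a b : hval r s (HMul a b) = hval r s a * hval r s b.
Proof. by []. Qed.
Lemma hval_div r s a b : hval r s (HDiv a b) = hval r s a / hval r s b.
Proof. by []. Qed.
Lemma hval_nat r s i : hval r s (HNat i) = (ival r s i)%:R.
Proof. by []. Qed.
Lemma hval_le r s a b t u : hval r s (HLe a b t u) =
  if hval r s a <= hval r s b then hval r s t else hval r s u.
Proof. by []. Qed.
Let hsum_V := @hsum_V R V H k.
Let hsum_E := @hsum_E R V H k.
Let hvalE := (hvalD, hvalB, hvalM, hval_div, hval_nat, hval_le).

Lemma eMassE r s q v : tab s -> ival r s q = vi v -> hval r s (eMass q) = mass H f v.
Proof. by move=> T h; rewrite /= h (t_vw T) (t_nrm T) -expr2 sqr_nrm. Qed.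

Lemma eFeatE r s q (i : 'I_k) (b : bool) v : tab s -> nth 0%N r 1 = i -> nth 0%N r 2 = b ->
  ival r s q = vi v -> hval r s (eFeat q) = feat f i b v.
Proof.
move=> T h1 h2 h; rewrite /= h1 h2 h (t_unit T) /feat /spos /pos ler_nat.
by case: b {h2} => /=; rewrite ?sub0r.
Qed.

Lemma soft_chE s m (i : 'I_k) (b : bool) (t v : V) x : tab s -> denotes s 8 x ->
  hval [:: m; nat_of_ord i; nat_of_bool b; vi t; vi v] s soft_ch =
  soft_child f (i, b) x v.
Proof.
move=> T r8; rewrite /soft_ch hvalE (eFeatE (i := i) (b := b) (v := v)) //.
by rewrite /= r8.
Qed.

Lemma soft_gE s m1 m2 m3 m4 x j : tab s -> denotes s 9 x ->
  nmem s 5 0%N 0%N = j.+1 -> (j < N)%N -> (N <= 8 * k)%N ->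
  hval [:: m1; m2; m3; m4] s soft_g = soft_good H f j x.
Proof.
move=> T r9 hj jN N8; have sz := t_sz T; case: (sz) => sV _ sK.
rewrite /soft_g !hvalE.
have -> : hval [:: m1; m2; m3; m4] s (HSum bV (HMul (eMass (iV 4)) (sqe (cand_val (iV 4)))))
   = soft_mass H f x.
  rewrite hsum_V //; apply: eq_bigr => v _; rewrite hvalE (eMassE (v := v)) //.
  by rewrite /= r9 expr2.
have -> : hval [:: m1; m2; m3; m4] s (HSum bV (HSum bV (HMul (eMass (iV 4))
     (HMul (cand_val (iV 4)) (cand_val (iV 5)))))) = soft_pair H f x.
  rewrite hsum_V //; apply: eq_bigr => u _; rewrite hsum_V //; apply: eq_bigr => v _.
  by rewrite hvalE (eMassE (v := u)) //= !r9.
have -> : hval [:: m1; m2; m3; m4] s (HSum bV (HSum bV (HMul (HMul (eMass (iV 4))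
    (eCorr2 (iV 4) (iV 5))) (HDiv (HAdd (sqe (cand_val (iV 4))) (sqe (cand_val (iV 5)))) (lit 2)))))
   = soft_close H f x.
  rewrite hsum_V //; apply: eq_bigr => u _; rewrite hsum_V //; apply: eq_bigr => v _.
  by rewrite hvalM hvalM (eMassE (v := u)) //= !r9 (t_corr T) -!expr2.
have -> : hval [:: m1; m2; m3; m4] s (HGet 14 c0 iJ1) = (3 / 4) ^+ j.
  rewrite /= hj subn1 /= (t_34 T) //; lia.
by rewrite /= sV sK.
Qed.

Lemma soft_hE s m1 m2 m3 m4 x j : tab s -> denotes s 9 x ->
  nmem s 5 0%N 0%N = j.+1 ->
  hval [:: m1; m2; m3; m4] s soft_h = soft_cost H f c j x.
Proof.
move=> T r9 hj; have sz := t_sz T.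
rewrite /soft_h hsum_E //; apply: eq_bigr => e he; rewrite hvalE.
congr (_ * _); first exact: (t_w T he).
rewrite hsum_V // [RHS]big_mkcond; apply: eq_bigr => v _.
rewrite /= (t_inc T) // if_nat_bool; case: ifP => // _.
rewrite (t_least T) // hj !subn1 /= !r9 !(t_nrm T) (t_dist T) // /soft_term -sqr_nrm.
by ring.
Qed.

Lemma card_eI (S e : {set V}) : \sum_v (if v \in e then (v \in S)%:R else 0) = #|e :&: S|%:R :> R.
Proof.
rewrite -sum1_card natr_sum [RHS]big_mkcond; apply: eq_bigr => v _.
by rewrite inE; case: (v \in e); case: (v \in S).
Qed.

Lemma card_e (e : {set V}) : \sum_v (if v \in e then 1 else 0) = #|e|%:R :> R.
Proof. by rewrite -sum1_card natr_sum [RHS]big_mkcond. Qed.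

Lemma card_subsetI S e : (#|e| <= #|e :&: S|)%N = (e \subset S).
Proof.
apply/idP/idP => [h|/setIidPl -> //].
by apply/setIidPl/eqP; rewrite eqEcard subsetIl.
Qed.

Lemma cntE r s e a S : tab s -> e \in edges H -> nth 0%N r (size r).-1 = ei H e ->
  (0 < size r)%N -> denotes s a (fun v => (v \in S)%:R) ->
  hval r s (HSum bV (ifinc (iV (size r).-1) (iV (size r)) (HGet a c0 (iV (size r)))))
  = #|e :&: S|%:R.
Proof.
move=> T he hr r0 ra; rewrite hsum_V; last exact: t_sz T.
rewrite -card_eI; apply: eq_bigr => v _.
have h1 : nth 0%N (rcons r (vi v)) (size r) = vi v by rewrite nth_rcons ltnn eqxx.
have h2 : nth 0%N (rcons r (vi v)) (size r).-1 = ei H e.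
  by rewrite nth_rcons ltn_predL r0.
by rewrite /= h1 h2 (t_inc T) // if_nat_bool ra.
Qed.

Lemma sizeE r s e : tab s -> e \in edges H -> nth 0%N r (size r).-1 = ei H e ->
  (0 < size r)%N ->
  hval r s (HSum bV (ifinc (iV (size r).-1) (iV (size r)) (lit 1))) = #|e|%:R.
Proof.
move=> T he hr r0; rewrite hsum_V; last exact: t_sz T.
rewrite -card_e; apply: eq_bigr => v _.
have h1 : nth 0%N (rcons r (vi v)) (size r) = vi v by rewrite nth_rcons ltnn eqxx.
have h2 : nth 0%N (rcons r (vi v)) (size r).-1 = ei H e.
  by rewrite nth_rcons ltn_predL r0.
by rewrite /= h1 h2 (t_inc T) // if_nat_bool.
Qed.

Definition ind S (v : V) : R := (v \in S)%:R.
Definition supp x : {set V} := [set v | x v == 1].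

Lemma suppE S x : x =1 ind S -> supp x = S.
Proof.
move=> h; apply/setP => v; rewrite inE h /ind; case: (v \in S); first exact: eqxx.
by rewrite eq_sym oner_eq0.
Qed.

(** The cluster array holds real functions in both searches; a hard cluster is stored as its
    indicator and recovered by [supp]. *)
Definition hard_val x : Prop := exists S, x =1 ind S.
Definition hard_ch_fun (y : ('I_k * bool) * V) x v : R :=
  x v * (feat2 f y.1 y.2 <= feat2 f y.1 v)%R%:R.

Lemma hard_ch_ind y x S : x =1 ind S -> hard_ch_fun y x =1 ind (hard_child f y S).
Proof.
move=> h v; rewrite /hard_ch_fun h /ind inE -natrM.
by case: (v \in S); case: (_ <= _).
Qed.

Lemma hard_val_child y x : hard_val x -> hard_val (hard_ch_fun y x).
Proof. by move=> [S h]; exists (hard_child f y S); apply: hard_ch_ind. Qed.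

Lemma hard_chE s m (i : 'I_k) (b : bool) (t v : V) x : tab s -> denotes s 8 x ->
  hval [:: m; nat_of_ord i; nat_of_bool b; vi t; vi v] s hard_ch =
  hard_ch_fun ((i, b), t) x v.
Proof.
move=> T r8; rewrite /hard_ch hvalE hvalE (eFeatE (q := iV 4) (i := i) (b := b) (v := v)) //.
rewrite (eFeatE (q := iV 3) (i := i) (b := b) (v := t)) // /hard_ch_fun /feat2 /= r8.
by case: (_ <= _).
Qed.

Lemma hard_massE2 r s a S : tab s -> denotes s a (ind S) ->
  hval r s (HSum bV (HMul (eMass (iV (size r))) (HGet a c0 (iV (size r))))) = hard_mass H f S.
Proof.
move=> T ra; rewrite hsum_V; last exact: t_sz T.
rewrite /hard_mass [RHS]big_mkcond; apply: eq_bigr => v _; rewrite hvalE (eMassE (v := v)) //.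
  rewrite /= nth_rcons ltnn eqxx ra /ind.
  by case: (v \in S); rewrite ?mulr1 ?mulr0.
by rewrite /= nth_rcons ltnn eqxx.
Qed.

Lemma hard_gE s m1 m2 m3 m4 x j : tab s -> denotes s 9 x -> hard_val x ->
  nmem s 5 0%N 0%N = j.+1 -> (j < N)%N -> (N <= 8 * k)%N ->
  hval [:: m1; m2; m3; m4] s hard_g = hard_good H f N j (supp x).
Proof.
move=> T r9 [S hS] hj jN N8; have sz := t_sz T; case: (sz) => sV _ sK.
have rS : denotes s 9 (ind S) by move=> v; rewrite r9 hS.
rewrite (suppE hS) /hard_g !hvalE (@hard_massE2 [:: m1; m2; m3; m4] s 9 S T rS).
have -> : hval [:: m1; m2; m3; m4] s (HSum bV (cand_val (iV 4))) = #|S|%:R.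
  rewrite hsum_V // -sum1_card natr_sum [RHS]big_mkcond; apply: eq_bigr => v _.
  by rewrite /= rS /ind; case: (v \in S).
have -> : hval [:: m1; m2; m3; m4] s (HGet 15 c0 iJ1) = (7 / 8) ^+ j.
  rewrite /= hj subn1 /= (t_78 T) //; lia.
by rewrite /= sV sK (t_N T) hj subn1 /= div1r -expr2.
Qed.

Lemma hard_hE s m1 m2 m3 m4 x j : tab s -> denotes s 9 x -> hard_val x ->
  nmem s 5 0%N 0%N = j.+1 -> (j < N)%N -> (N <= 8 * k)%N ->
  hval [:: m1; m2; m3; m4] s hard_h = hard_cost H f c j (supp x).
Proof.
move=> T r9 [S hS] hj jN N8; have sz := t_sz T.
have rS : denotes s 9 (ind S) by move=> v; rewrite r9 hS.
rewrite (suppE hS) /hard_h hsum_E // /hard_cost [RHS]big_mkcondr.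
apply: eq_bigr => e he; set r := rcons _ _.
have hr : nth 0%N r (size r).-1 = ei H e by [].
have nuE : hval r s (eNrm (iC (iV 4))) = nrm f (c e).
  by rewrite /= (t_least T) // subn1 /= (t_nrm T).
have dE : hval r s (eDiam (iV 4)) = diam f c e by rewrite /= (t_diam T).
have wE : hval r s (eW (iV 4)) = weight H e by rewrite /= (t_w T).
have qE : hval r s (HGet 16 c0 iJ1) = (13 / 12) ^+ j.
  rewrite /= hj subn1 /= (t_1312 T) //; lia.
have jE : ival r s iJ1 = j by rewrite /= hj subn1.
rewrite !hvalE nuE dE wE qE jE (sizeE T he hr) // (cntE T he hr _ rS) //.
rewrite ler_nat card_subsetI /short /hard_term.
rewrite ler_nat leqn0 cards_eq0 -expr2.
by case: ifP => // _; case: ifP => // _; case: (_ == _).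
Qed.

Lemma hard_stopE s m x : tab s -> denotes s 8 x -> hard_val x ->
  (hval [:: m] s hard_stop <= 2%:R) = (hard_mass H f (supp x) <= 2).
Proof.
move=> T r8 [S hS]; rewrite (suppE hS).
have rS : denotes s 8 (ind S) by move=> v; rewrite r8 hS.
by rewrite (@hard_massE2 [:: m] s 8 S T rS).
Qed.

Section Sweep.
Variable x : V -> R.

Definition swept s : Prop := 0 < best_g 12 s -> exists S,
  [/\ (#|S| * k <= 24 * #|V|)%N, forall v, nmem s 2 0%N (vi v) = (v \in S) :> nat,
      best_g 12 s = volume H S & best_h 12 s = cut_weight H S].

Definition sweep_inv s : Prop := [/\ tab s, denotes s 8 x & swept s].

Definition sweep_vol := HSum bV (HMul (eVW (iV 2)) (flag_val (iV 2))).
Definition sweep_cut := HSum bE (HMul (eW (iV 2))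
  (HLe (HSum bV (ifinc (iV 2) (iV 3) (flag_val (iV 3)))) (lit 0) (lit 0)
     (HLe (HSum bV (ifinc (iV 2) (iV 3) (lit 1)))
          (HSum bV (ifinc (iV 2) (iV 3) (flag_val (iV 3)))) (lit 0) (lit 1)))).
Definition sweep_take := HFor bV (HIf (lit 1) (flag_val (iV 2))
  (HSetN 2 c0 (iV 2) (IConst 1)) (HSetN 2 c0 (iV 2) (IConst 0))).
Definition sweep_body := HSeq
  (HFor bV (HSetR 13 c0 (iV 2) (HLe (HGet 8 c0 (iV 0)) (HGet 8 c0 (iV 2))
                (HLe (eNrm (iV 1)) (eNrm (iV 2)) (lit 1) (lit 0)) (lit 0))))
  (HIf (HMul (HSum bV (flag_val (iV 2))) nK) (HMul (lit 24) nV)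
     (consider 12 sweep_vol sweep_cut sweep_take) HSkip).

Lemma sweepE : sweep = HFor bV (HFor bV sweep_body).
Proof. by []. Qed.

Lemma sweep_volE m1 m2 s S : tab s -> denotes s 13 (ind S) ->
  hval [:: m1; m2] s sweep_vol = volume H S.
Proof.
move=> T r13; rewrite hsum_V; last exact: t_sz T.
rewrite /volume [RHS]big_mkcond; apply: eq_bigr => v _.
by rewrite /= (t_vw T) r13 /ind; case: (v \in S); rewrite ?mulr1 ?mulr0.
Qed.

Lemma sweep_cutE m1 m2 s S : tab s -> denotes s 13 (ind S) ->
  hval [:: m1; m2] s sweep_cut = cut_weight H S.
Proof.
move=> T r13; rewrite hsum_E; last exact: t_sz T.
rewrite cut_weightE; apply: eq_bigr => e he; set r := rcons _ _.
have hr : nth 0%N r (size r).-1 = ei H e by [].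
rewrite hvalE; congr (_ * _); first exact: (t_w T he).
rewrite !hvalE (sizeE T he hr) // (cntE T he hr _ r13) //.
rewrite ler_nat leqn0 cards_eq0 ler_nat card_subsetI /boundary inE he /=.
rewrite -setDE setD_eq0.
by case: (_ == _); case: (_ \subset _).
Qed.

Lemma sweep_takeP m1 m2 s S : tab s -> denotes s 13 (ind S) ->
  forall v, nmem (heval [:: m1; m2] sweep_take s) 2 0%N (vi v) = (v \in S) :> nat.
Proof.
move=> T r13; have sz := t_sz T.
rewrite /sweep_take /=; have /= -> := bval_V sz.
set F := (X in iterN _ X _).
have [] := @iterN_inv R (fun m s' => denotes s' 13 (ind S) /\
   forall v, (vi v < m)%N -> nmem s' 2 0%N (vi v) = (v \in S) :> nat) #|V| F s _ _ => //.
  move=> i s' /vi_surj[u ->] [r' h']; rewrite /F /= r' /ind.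
  have -> : ((1%:R : R) <= (u \in S)%:R) = (u \in S) by rewrite ler_nat; case: (u \in S).
  by case: ifP => hu; split=> // v; rewrite ltnS leq_eqVlt /= updE eqxx /= => /orP[/eqP/vi_inj ->|hv];
    rewrite ?eqxx ?hu // (ltn_eqF hv) h'.
by move=> _ h v; apply: h; apply: vi_lt.
Qed.

Lemma sweep_bodyP (p t : V) s : sweep_inv s ->
  let s' := heval [:: vi p; vi t] sweep_body s in let S := soft_set f x (p, t) in
  [/\ sweep_inv s', forall z, good_ratio 12 z s -> good_ratio 12 z s' &
    forall z, S != set0 -> (#|S| * k <= 24 * #|V|)%N ->
      cut_weight H S <= z * volume H S -> good_ratio 12 z s'].
Proof.
move=> [T r8 W]; set S := soft_set f x (p, t); set r := [:: vi p; vi t].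
pose fill := HFor bV (HSetR 13 c0 (iV 2) (HLe (HGet 8 c0 (iV 0)) (HGet 8 c0 (iV 2))
                (HLe (eNrm (iV 1)) (eNrm (iV 2)) (lit 1) (lit 0)) (lit 0))).
pose s1 := heval r fill s.
have [||||[T1 r81] r131] := @fill_denotes R V H k r 13 (HLe (HGet 8 c0 (iV 0)) (HGet 8 c0 (iV 2))
                (HLe (eNrm (iV 1)) (eNrm (iV 2)) (lit 1) (lit 0)) (lit 0)) s (ind S)
     (fun s => tab s /\ denotes s 8 x).
- by [].
- by move=> s' [/t_sz].
- by move=> s' i z [T' r']; split=> //; exact: tab_updR.
- move=> s' v [T' r']; rewrite /= !r' !(t_nrm T') /ind inE /=.
  by case: ifP => _ //=; case: ifP.
rewrite -/fill -/s1 in T1 r81 r131.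
have n2 : nmem s1 2 = nmem s 2 by rewrite /s1 hevalN.
have e12 : rmem s1 12 = rmem s 12 by rewrite /s1 hevalR.
have W1 : swept s1 by rewrite /swept /best_g /best_h e12 n2.
have sizeS : hval r s1 (HMul (HSum bV (flag_val (iV 2))) nK) = (#|S| * k)%:R.
  have sz := t_sz T1; rewrite hvalE natrM; congr (_ * _); last by case: sz => /= _ _ ->.
  rewrite hsum_V // -sum1_card natr_sum [RHS]big_mkcond; apply: eq_bigr => v _.
  by rewrite /= r131 /ind; case: (v \in S).
have sizeV : hval r s1 (HMul (lit 24) nV) = (24 * #|V|)%:R.
  by rewrite natrM /=; case: (t_sz T1) => ->.
have -> : heval r sweep_body s = if (#|S| * k <= 24 * #|V|)%N then
    heval r (consider 12 sweep_vol sweep_cut sweep_take) s1 else s1.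
  rewrite -(ler_nat R) -sizeS -sizeV; exact: erefl.
have gr z : good_ratio 12 z s1 <-> good_ratio 12 z s.
  by rewrite /good_ratio /best_g /best_h e12.
case: ifP => hS; last by split=> // z => [/gr|_]; rewrite ?hS.
have [||||//|s2 [[T2 r82 r132 n22] hcase hhit hmono]] := @considerP R r 12 sweep_vol sweep_cut
   sweep_take s1 (volume H S) (cut_weight H S)
   (fun s => [/\ tab s, denotes s 8 x, denotes s 13 (ind S) & nmem s 2 = nmem s1 2]).
- by [].
- by move=> s' q z [T' r8' r13' n']; split=> //; exact: tab_updR.
- by move=> s' [T' _ r13' _]; apply: sweep_volE.
- by move=> s' [T' _ r13' _]; apply: sweep_cutE.
set s' := heval r (consider _ _ _ _) s1 in hcase hhit hmono *.
split.
- case: hcase => [[e [b1 b2]]|[e [gp [b1 b2]]]].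
    by rewrite e; split=> //; rewrite /swept b1 b2 n22.
  split.
  + by rewrite e; apply: tab_heval T2.
  + by rewrite e; apply: denotes_eq r82; rewrite hevalR.
  + move=> _; exists S; split=> // v.
    by rewrite e; apply: sweep_takeP.
- by move=> z /gr; apply: hmono.
- by move=> z S0 _ hc; apply: hhit => //; apply: volume_gt0.
Qed.

Lemma sweepP s : sweep_inv s ->
  let s' := heval [::] sweep s in
  [/\ sweep_inv s', forall z, good_ratio 12 z s -> good_ratio 12 z s' &
    forall z y, let S := soft_set f x y in S != set0 -> (#|S| * k <= 24 * #|V|)%N ->
      cut_weight H S <= z * volume H S -> good_ratio 12 z s'].
Proof.
move=> I0; rewrite sweepE /=.
pose F p := @heval R [:: p] (HFor bV sweep_body).
have sizes s' : sweep_inv s' -> sizesP H k (nmem s' 0) by case=> /t_sz.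
rewrite -[iterN _ _ s]/(iterN (bval s bV) F s) (bval_V (sizes _ I0)).
have inner p s' : sweep_inv s' ->
  [/\ sweep_inv (F (vi p) s'), forall z, good_ratio 12 z s' -> good_ratio 12 z (F (vi p) s') &
    forall z t, let S := soft_set f x (p, t) in S != set0 -> (#|S| * k <= 24 * #|V|)%N ->
      cut_weight H S <= z * volume H S -> good_ratio 12 z (F (vi p) s')].
  move=> I'; pose G t := @heval R [:: vi p; t] sweep_body.
  rewrite -[F _ s']/(iterN (bval s' bV) G s') (bval_V (sizes _ I')).
  have st q s1 : (q < #|V|)%N -> sweep_inv s1 -> sweep_inv (G q s1) /\
     forall z, good_ratio 12 z s1 -> good_ratio 12 z (G q s1).
    by move=> /vi_surj[v ->] I1; have [] := sweep_bodyP p v I1.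
  split.
  - by apply: (@iterN_inv R (fun _ => sweep_inv)) => // q s1 hq I1; have [] := st q s1 hq I1.
  - move=> z G0; apply: (proj2 (@iterN_inv R (fun _ s => sweep_inv s /\ good_ratio 12 z s) #|V| G s' _ _)) => //.
    by move=> q s1 hq [I1 G1]; have [h1 h2] := st q s1 hq I1; split=> //; apply: h2.
  - move=> z t S S0 hS hc.
    apply: (proj2 (@iterN_hit R sweep_inv (good_ratio 12 z) #|V| G s' (vi t) (vi_lt t) I' _ _ _)).
    + by move=> q s1 hq I1; have [] := st q s1 hq I1.
    + by move=> q s1 hq I1; have [_] := st q s1 hq I1; apply.
    + by move=> s1 I1; have [_ _ h] := sweep_bodyP p t I1; apply: h.
have st q s1 : (q < #|V|)%N -> sweep_inv s1 -> sweep_inv (F q s1) /\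
     forall z, good_ratio 12 z s1 -> good_ratio 12 z (F q s1).
  by move=> /vi_surj[v ->] I1; have [] := inner v s1 I1.
split.
- by apply: (@iterN_inv R (fun _ => sweep_inv)) => // q s1 hq I1; have [] := st q s1 hq I1.
- move=> z G0; apply: (proj2 (@iterN_inv R (fun _ s => sweep_inv s /\ good_ratio 12 z s) #|V| F s _ _)) => //.
  by move=> q s1 hq [I1 G1]; have [h1 h2] := st q s1 hq I1; split=> //; apply: h2.
- move=> z [p t] S0 hS hc.
  apply: (proj2 (@iterN_hit R sweep_inv (good_ratio 12 z) #|V| F s (vi p) (vi_lt p) I0 _ _ _)).
  + by move=> q s1 hq I1; have [] := st q s1 hq I1.
  + by move=> q s1 hq I1; have [_] := st q s1 hq I1; apply.
  + by move=> s1 I1; have [_ _ h] := inner p s1 I1; apply: h hc.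
Qed.

End Sweep.
End Eval.

Lemma heval_seq (R : realType) r p q (s : state R) :
  heval r (HSeq p q) s = heval r q (heval r p s).
Proof. by []. Qed.

Lemma heval_if (R : realType) r a b p q (s : state R) :
  heval r (HIf a b p q) s =
  if hval r s a <= hval r s b then heval r p s else heval r q s.
Proof. by []. Qed.

Lemma best_g_reset (R : realType) (s : state R) :
  best_g 12 (heval [::] (HSetR 12 c0 (IConst 2) (lit 0)) s) = 0.
Proof. by rewrite /best_g /= updE. Qed.

(** * Correctness of the algorithm *)

Section Final.
Variables (R : realType) (V : finType) (H : hypergraph R V).
Variables (k : nat) (f : 'I_k -> V -> R) (xi : R).
Hypothesis f_orth : orthonormal_w H f.
Hypothesis f_disc : forall s, discrepancy_ratio H (f s) <= xi.
Hypothesis k25 : (25 <= k)%N.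

Local Notation K := (k%:R : R).

Let k0 : (0 < k)%N. Proof. exact: leq_trans k25. Qed.

Lemma vertex_exists m (g : 'I_m -> V -> R) : orthonormal_w H g -> (0 < m)%N ->
  exists v : V, true.
Proof.
move=> go m0; case: (pickP (fun _ : V => true)) => [v _|V0]; first by exists v.
have := go (Ordinal m0) (Ordinal m0); rewrite eqxx /inner_w big_pred0 //.
by move=> /eqP; rewrite eq_sym oner_eq0.
Qed.

(** Eight rounds halve the quantity, and [l] halvings beat [k <= 2 ^ l]. *)
Lemma pow_half (q : R) l : 0 <= q -> q ^+ 8 <= 1 / 2 -> (k <= 2 ^ l)%N ->
  q ^+ (8 * l) * K <= 1.
Proof.
move=> q0 q8 kl; rewrite exprM.
have h1 : (q ^+ 8) ^+ l <= (1 / 2) ^+ l.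
  by apply: lerXn2r; rewrite ?nnegrE ?exprn_ge0 //; lra.
apply: le_trans (ler_wpM2r (ler0n _ _) h1) _.
rewrite mul1r exprVn mulrC ler_pdivrMr ?exprn_gt0 // mul1r.
by rewrite -natrX ler_nat.
Qed.

(** Twice [(N + 1) * rank * xi]: the soft cost at the root is at most that product times [k], and
    [soft_good] there is at least [k / 2]. *)
Definition soft_rate (l : nat) : R :=
  2 * ((8 * l)%:R + 1) * ((rank H)%:R * xi).
(** The first term is the ratio at the root, with 4 because [hard_good] is at least [k / 4] there;
    the second pays for the long hyperedges in [hard_leaf]. *)
Definition hard_rate (l : nat) (z : R) : R :=
  4 * ((13 / 12) ^+ (8 * l) * (24 * (8 * l)%:R + 6) * z)
  + 8 * 101 ^+ 2 * (K ^+ 2 * (8 * l)%:R * z ^+ 2).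

Lemma xi_ge0 : 0 <= xi.
Proof.
apply: le_trans (f_disc (Ordinal k0)); rewrite /discrepancy_ratio.
apply: divr_ge0.
  apply: sumr_ge0 => e he; apply: mulr_ge0; first exact: weight_ge0.
  exact: bigmax_ge_id.
by apply: sumr_ge0 => v _; rewrite mulr_ge0 ?sqr_ge0 // ltW ?vweight_pos.
Qed.

(** The run involves no [z], so one set [S] obeys both families of estimates for all [z]
    simultaneously. *)
Lemma algorithmP omega : exists l (S : {set V}),
  [/\ (k <= 2 ^ l)%N, (2 ^ l < 2 * k)%N, (0 < l)%N &
  [/\ S != set0, (#|S| * k <= 24 * #|V|)%N,
      forall v, nmem (heval [::] algorithm (input H f omega)) 2 0%N (vi v) = (v \in S) :> nat,
      forall z, 0 < z -> soft_rate l <= z ^+ 2 ->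
        cut_weight H S <= 2 * (3 * z + z ^+ 2) * volume H S &
      forall z, 0 < z -> xi <= z ^+ 2 ->
        cut_weight H S <= hard_rate l z * volume H S]].
Proof.
have [v0 _] := vertex_exists f_orth k0.
have [sz inc w hf h0] := inputP H f omega.
set s0 := input H f omega in sz inc w hf h0 *; clearbody s0.
have k2 : (2 <= k)%N by apply: leq_trans k25.
have [c [l [cmin l1 l2 /andP[l3 l4] T1]]] := prepP v0 k2 sz inc w hf h0.
set N := (8 * l)%N in T1.
have N8 : (N <= 8 * k)%N by rewrite /N leq_mul2l l4.
have N0 : (0 < N)%N by rewrite /N muln_gt0.
pose s1 := heval [::] prep s0; rewrite -/s1 in T1.
pose s2 := heval [::] (search soft_ch soft_g soft_h (lit 3)) s1.
pose s3 := heval [::] (HSetR 12 c0 (IConst 2) (lit 0)) s2.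
pose s4 := heval [::] sweep s3.
pose s5 := heval [::] (search hard_ch hard_g hard_h hard_stop) s4.
pose s6 := heval [::] sweep s5.
have -> : heval [::] algorithm s0 = s6.
  rewrite /algorithm heval_if.
  have -> : (hval [::] s0 nK <= hval [::] s0 (lit 24)) = false.
    by case: sz => _ _ sK; rewrite /= sK ler_nat leqNgt k25.
  rewrite (@heval_seq R [::] prep _ s0) -/s1.
  rewrite (@heval_seq R [::] (search soft_ch soft_g soft_h (lit 3)) _ s1) -/s2.
  rewrite (@heval_seq R [::] (HSetR 12 c0 (IConst 2) (lit 0)) _ s2) -/s3.
  rewrite (@heval_seq R [::] sweep _ s3) -/s4.
  by rewrite (@heval_seq R [::] (search hard_ch hard_g hard_h hard_stop) _ s4) -/s5.
have q34 : (3 / 4 : R) ^+ N * K <= 1 by apply: pow_half l1; lra.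
have q78 : (7 / 8 : R) ^+ N * K <= 1 by apply: pow_half l1; lra.
have K0 : 0 < K by rewrite ltr0n.
have xi0 := xi_ge0.
have soft_root := soft_good_root f_orth k0 q34.
have gp : 0 < soft_good H f N (fun=> 1) by apply: lt_le_trans soft_root; rewrite divr_gt0.
have phase1 t : 0 <= t -> soft_cost H f c N (fun=> 1) <= t * soft_good H f N (fun=> 1) ->
    exists x, [/\ tab H f c N s2, denotes s2 8 x, forall v, 0 <= x v, 0 < soft_good H f 0 x &
      soft_cost H f c 0 x <= t * soft_good H f 0 x].
  move=> t0 ht.
  have [|||||||x [j [[T2 d2 V2 j2 [jN g2 h2]] [j0|//]]]] := @searchP R V H k f c N soft_ch soft_g soft_h
    (lit 3) (fun x => forall v, 0 <= x v) (fun y => soft_child f y.1) (soft_good H f)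
    (soft_cost H f c) (fun=> false) _ _ _ _ _ _ t s1 t0 _ N8 T1 gp ht.
  - by move=> s m i b t' v x T d; exact: (soft_chE _ _ _ _ _ T d).
  - by move=> s m1 m2 m3 m4 x j T d _ hj jN; exact: (soft_gE _ _ _ _ T d hj jN N8).
  - by move=> s m1 m2 m3 m4 x j T d _ hj jN; exact: (soft_hE _ _ _ _ T d hj).
  - by move=> s m x _ _ _; rewrite /= ler_nat.
  - by move=> y x hx v; rewrite mulr_ge0 ?hx ?feat_ge0.
  - move=> x j t' hx ht' _ hg hh; have [y hy] := soft_step cmin hx ht' hg hh.
    by exists (y, v0).
  - by move=> v; exact: ler01.
  by exists x; split=> //; [rewrite -j0|rewrite -j0].
(* The actual ratio at the root is an admissible [t]; it shows that a cluster is stored before any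
   particular [z] is considered. *)
have soft_t : exists2 t, 0 <= t & soft_cost H f c N (fun=> 1) <= t * soft_good H f N (fun=> 1).
  exists (soft_cost H f c N (fun=> 1) / soft_good H f N (fun=> 1)).
    by rewrite divr_ge0 ?soft_cost_ge0 ?ltW.
  by rewrite divfK ?gt_eqF.
have [t1 t10 ht1] := soft_t.
have [x1 [T2 d2 x10 g2 _]] := phase1 t1 t10 ht1.
have T3 : tab H f c N s3 by apply: tab_heval T2.
have d3 : denotes s3 8 x1 by apply: denotes_eq d2; rewrite /s3 hevalR.
have I3 : sweep_inv H f c N x1 s3.
  split; [exact: T3|exact: d3|].
  by rewrite /swept /s3 best_g_reset ltxx.
have [I4 _ hit4] := sweepP I3; rewrite -/s4 in I4 hit4.
case: I4 => T4 d4 W4.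
have hard_root := hard_good_root f_orth k0 N0 k25 q78.
have gp2 : 0 < hard_good H f N N setT by apply: lt_le_trans hard_root; rewrite divr_gt0.
have suppT : supp (fun=> 1 : R) = [set: V].
  by apply/setP => v; rewrite !inE eqxx.
have phase2 t : 0 <= t -> hard_cost H f c N setT <= t * hard_good H f N N setT ->
    exists S j, [/\ tab H f c N s5, denotes s5 8 (ind R S), (j <= N)%N,
      0 < hard_good H f N j S /\ hard_cost H f c j S <= t * hard_good H f N j S &
      (j = 0%N \/ hard_mass H f S <= 2)].
  move=> t0 ht; rewrite -suppT in ht gp2.
  have [|||||||x [j [[T5 d5 [S hS] j5 [jN g5 h5]] hj]]] := @searchP R V H k f c N hard_ch hard_g hard_h
    hard_stop (@hard_val R V) (hard_ch_fun f)
    (fun j x => hard_good H f N j (supp x)) (fun j x => hard_cost H f c j (supp x))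
    (fun x => hard_mass H f (supp x) <= 2) _ _ _ _ _ _ t s4 t0 _ N8 T4 gp2 ht.
  - by move=> s m i b t' v x T d; exact: (hard_chE _ _ _ _ _ T d).
  - by move=> s m1 m2 m3 m4 x j T d hx hj jN; exact: (hard_gE _ _ _ _ T d hx hj jN N8).
  - by move=> s m1 m2 m3 m4 x j T d hx hj jN; exact: (hard_hE _ _ _ _ T d hx hj jN N8).
  - by move=> s m x T d hx; exact: (hard_stopE m T d hx).
  - by move=> y x; apply: hard_val_child.
  - move=> x j t' [S hS] ht' /negbT; rewrite -ltNge (suppE hS) => hm hg hh.
    have [y hy] := hard_step f_orth cmin k0 N0 hm ht' hg hh.
    by exists y; rewrite (suppE (hard_ch_ind f y hS)).
  - by exists setT => v; rewrite /ind inE.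
  exists S, j; rewrite (suppE hS) in g5 h5 hj; split=> //.
  by move=> v; rewrite d5 hS.
have hard_t : exists2 t, 0 <= t & hard_cost H f c N setT <= t * hard_good H f N N setT.
  exists (hard_cost H f c N setT / hard_good H f N N setT).
    by rewrite divr_ge0 ?hard_cost_ge0 ?ltW.
  by rewrite divfK ?gt_eqF.
have [t2 t20 ht2] := hard_t.
have [S5 [j5 [T5 d5 _ _ _]]] := phase2 t2 t20 ht2.
have e12 : rmem s5 12 = rmem s4 12 by rewrite /s5 hevalR.
have n2 : nmem s5 2 = nmem s4 2 by rewrite /s5 hevalN.
have I5 : sweep_inv H f c N (ind R S5) s5.
  by split; [exact: T5|exact: d5|rewrite /swept /best_g /best_h e12 n2].
have gr5 z : good_ratio 12 z s4 -> good_ratio 12 z s5.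
  by rewrite /good_ratio /best_g /best_h e12.
have [I6 mono6 hit6] := sweepP I5; rewrite -/s6 in I6 mono6 hit6.
have goodA z : 0 < z -> soft_rate l <= z ^+ 2 -> good_ratio 12 (2 * (3 * z + z ^+ 2)) s6.
  move=> z0 hz; apply: mono6; apply: gr5.
  have [|x [_ dx x0 gx hx]] := phase1 (z ^+ 2) (sqr_ge0 z).
    apply: (@le_trans _ _ (z ^+ 2 * (K / 2))); last by apply: ler_wpM2l; rewrite ?sqr_ge0.
    rewrite soft_cost_root.
    have h1 := star_energy_le f_orth f_disc cmin.
    have hN : 0 <= N%:R + 1 :> R by rewrite addr_ge0.
    have h2 := ler_wpM2l hN h1.
    have h3 := ler_wpM2r (ltW K0) hz; rewrite /soft_rate -/N in h3.
    lra.
  have [y] := soft_leaf cmin x0 z0 k0 gx hx.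
  (* The cluster obtained for this [z] is read off the same memory as [x1], so it is the cluster
     that was swept. *)
  have ex : x1 = x by apply/boolp.funext => v; rewrite -d2 dx.
  move=> [S0 hS hc]; apply: (hit4 _ y); rewrite ex //.
have goodB z : 0 < z -> xi <= z ^+ 2 -> good_ratio 12 (hard_rate l z) s6.
  move=> z0 hz; pose t := 4 * ((13 / 12) ^+ N * (24 * N%:R + 6) * z).
  have q0 : 0 <= (13 / 12 : R) ^+ N by apply: exprn_ge0; lra.
  have t0 : 0 <= t.
    by rewrite /t mulr_ge0 // mulr_ge0 ?(ltW z0) // mulr_ge0 // addr_ge0 // mulr_ge0.
  have [|S [j [_ dS jN [gS hS] hj]]] := phase2 t t0.
    apply: le_trans (hard_cost_root N f_orth f_disc cmin k0 z0 hz) _.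
    apply: (@le_trans _ _ (t * (K / 4))); last exact: ler_wpM2l.
    by rewrite le_eqVlt; apply/orP; left; apply/eqP; rewrite /t; field.
  have eS : ind R S5 = ind R S by apply/boolp.funext => v; rewrite -d5 dS.
  have [cS [u [S0 hc]]] := hard_leaf f_orth f_disc cmin k0 N0 jN z0 hz t0 gS hS hj.
  have [p /[!inE] /andP[pS _]] := set0Pn _ S0.
  (* For an indicator, a threshold taken at a member [p] of [S] selects exactly [S]. *)
  have E : soft_set f (ind R S5) (p, u) = S :&: [set v | nrm f u <= nrm f v].
    apply/setP => v; rewrite eS !inE /ind /= pS; congr andb.
    by rewrite ler_nat; case: (v \in S).
  have := hit6 (hard_rate l z) (p, u); rewrite E; apply => //.
  apply: leq_trans cS; rewrite leq_mul2r; apply/orP; right.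
  by apply: subset_leq_card; apply: subsetIl.
have [S [S1 S2 S3 S4]] : exists S : {set V}, [/\ (#|S| * k <= 24 * #|V|)%N,
    forall v, nmem s6 2 0%N (vi v) = (v \in S) :> nat,
    0 < volume H S & forall z, good_ratio 12 z s6 -> cut_weight H S <= z * volume H S].
  have bp : 0 < best_g 12 s6.
    have m0 : 0 <= soft_rate l.
      by rewrite /soft_rate mulr_ge0 ?mulr_ge0 // addr_ge0.
    have z0 : 0 < soft_rate l + 1 by lra.
    by have [] := goodA _ z0 _; first by rewrite expr2; nra.
  case: I6 => _ _ /(_ bp) [S [h1 h2 h3 h4]]; exists S; split=> //; first by rewrite -h3.
  by move=> z [_]; rewrite h3 h4.
exists l, S; split=> //; split=> //.
- by apply/eqP => S0; rewrite S0 /volume big_set0 ltxx in S3.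
- by move=> z z0 hz; apply: S4; apply: goodA.
- by move=> z z0 hz; apply: S4; apply: goodB.
Qed.

End Final.

(** * From rates to the stated bound *)

Section Bounds.
Variable R : realType.

Lemma ln2_gt0 : 0 < ln 2 :> R.
Proof. by apply: ln_gt0; lra. Qed.

Lemma log2_ge (m : nat) (x : R) : 2 ^+ m <= x -> m%:R <= log2 x.
Proof.
move=> h; have x0 : 0 < x by apply: lt_le_trans h; rewrite exprn_gt0.
rewrite /log2 ler_pdivlMr ?ln2_gt0 // mulr_natl -lnXn //.
by rewrite ler_ln ?posrE ?exprn_gt0.
Qed.

Lemma log2_ge0 (x : R) : 1 <= x -> 0 <= log2 x.
Proof. by move=> h; apply: (@log2_ge 0); rewrite expr0. Qed.

(** For [m <= 1] the value is 0, because [ln] vanishes at 0 and at 1. *)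
Lemma loglog2_nat_ge0 (m : nat) : 0 <= log2 (log2 m%:R) :> R.
Proof.
case: (leqP 2 m) => hm.
  by apply/log2_ge0/(@log2_ge 1); rewrite expr1 ler_nat.
have -> : log2 m%:R = 0 :> R.
  rewrite /log2; case: m hm => [|[|//]] _; first by rewrite ln0 ?mul0r.
  by rewrite mulr1n ln1 mul0r.
by rewrite /log2 ln0 ?mul0r.
Qed.

(** Ends the use of [z]: take the square root of [x] when it is positive. For [x = 0] every [z > 0]
    is allowed, and a small one contradicts [phi > 0]. *)
Lemma le_mul_sqrt (phi B x : R) : 0 <= x -> 0 <= B ->
  (forall z, 0 < z -> x <= z ^+ 2 -> phi <= B * z) -> phi <= B * Num.sqrt x.
Proof.
move=> x0 B0 h; have [x00|xn] := eqVneq x 0; last first.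
  have xp : 0 < x by rewrite lt_def xn.
  by apply: h; rewrite ?sqrtr_gt0 ?sqr_sqrtr.
rewrite x00 sqrtr0 mulr0 leNgt; apply/negP => p0.
have B1 : 0 < 2 * (B + 1) by lra.
have z0 : 0 < phi / (2 * (B + 1)) by rewrite divr_gt0.
have := h _ z0; rewrite x00 sqr_ge0 => /(_ isT).
rewrite mulrA ler_pdivlMr //; nra.
Qed.

Variables (V : finType) (H : hypergraph R V) (k : nat) (f : 'I_k -> V -> R) (xi : R).
Hypothesis f_orth : orthonormal_w H f.
Hypothesis f_disc : forall s, discrepancy_ratio H (f s) <= xi.

Local Notation K := (k%:R : R).
Local Notation lam := (log2 K : R).

Definition rate : R := Num.min (Num.sqrt ((rank H)%:R * log2 k%:R))
  (k%:R * log2 k%:R * log2 (log2 k%:R) * Num.sqrt (log2 (rank H)%:R)).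
(** [3120 = 4 * 2 * 390] comes from the short hyperedges and [128 = 8 * 16] times [101 ^+ 2] from
    the long ones. *)
Definition abs_const : R := 3120 + 128 * 101 ^+ 2.

Lemma rate_ge0 : (0 < k)%N -> 0 <= rate.
Proof.
move=> k0; rewrite /rate le_min sqrtr_ge0 /=.
apply: mulr_ge0; last exact: sqrtr_ge0.
apply: mulr_ge0; last exact: loglog2_nat_ge0.
apply: mulr_ge0 => //; by apply: log2_ge0; rewrite ler1n.
Qed.

(** For [k >= 25], [log2 k >= 4] and its logarithm is at least 1, while [l <= 2 log2 k] since
    [2 ^ (l - 1) < k]. Values of [z] too large for the estimates are covered by expansion at most
    1. *)
Lemma expansion_le_rate (S : {set V}) l : (25 <= k)%N -> (2 ^ l < 2 * k)%N -> (0 < l)%N ->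
  S != set0 ->
  (forall z : R, 0 < z -> soft_rate H xi l <= z ^+ 2 ->
        cut_weight H S <= 2 * (3 * z + z ^+ 2) * volume H S) ->
  (forall z : R, 0 < z -> xi <= z ^+ 2 -> cut_weight H S <= hard_rate k l z * volume H S) ->
  expansion H S <= abs_const * rate * Num.sqrt xi.
Proof.
move=> k25 l2 l0 S0 hA hB.
have xi0 : 0 <= xi := xi_ge0 f_disc k25.
have vp := volume_gt0 H S0.
set phi := expansion H S.
have phiE B : cut_weight H S <= B * volume H S -> phi <= B.
  by rewrite /phi /expansion -/(cut_weight H S) ler_pdivrMr.
have phi1 : phi <= 1 by apply: phiE; rewrite mul1r cut_weight_le_volume.
have K25 : 25 <= K by rewrite ler_nat.
have lam4 : 4 <= lam by apply: (@log2_ge 4); lra.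
have ll1 : 1 <= log2 lam.
  by apply: (@log2_ge 1); rewrite expr1; lra.
have lK : l%:R <= 2 * lam.
  have : (l.-1)%:R <= lam.
    apply: log2_ge; rewrite -natrX ler_nat.
    by move: l2; rewrite -{1}(prednK l0) expnS ltn_pmul2l // => /ltnW.
  have -> : l%:R = (l.-1)%:R + 1 :> R by rewrite natr1 prednK.
  lra.
have l1 : 1 <= l%:R :> R by rewrite ler1n.
have l8 : (8 * l)%:R = 8 * l%:R :> R by rewrite natrM.
have boundA : phi <= abs_const * Num.sqrt ((rank H)%:R * lam) * Num.sqrt xi.
  have r0 : 0 <= (rank H)%:R * lam by rewrite mulr_ge0 //; lra.
  have s0 : 0 <= soft_rate H xi l.
    by rewrite /soft_rate mulr_ge0 ?mulr_ge0 // addr_ge0.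
  have h1 : phi <= 8 * Num.sqrt (soft_rate H xi l).
    apply: le_mul_sqrt => // z z0 hz; have [z1|z1] := leP z 1; last by lra.
    by apply: le_trans (phiE _ (hA z z0 hz)) _; nra.
  have h2 : soft_rate H xi l <= 6 ^+ 2 * ((rank H)%:R * lam * xi).
    rewrite /soft_rate l8.
    have rx : 0 <= (rank H)%:R * xi by rewrite mulr_ge0.
    have h : 2 * (8 * l%:R + 1) <= 36 * lam by lra.
    have := ler_wpM2r rx h; lra.
  apply: le_trans h1 _.
  apply: (@le_trans _ _ (8 * (6 * (Num.sqrt ((rank H)%:R * lam) * Num.sqrt xi)))).
    rewrite ler_pM2l //; apply: le_trans (ler_wsqrtr h2) _.
    rewrite sqrtrM ?exprn_ge0 // sqrtr_sqr ger0_norm // sqrtrM //.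
  rewrite -mulrA mulrA; apply: ler_wpM2r; first by rewrite mulr_ge0 ?sqrtr_ge0.
  by rewrite /abs_const; lra.
have boundB : phi <= abs_const * (K * lam * log2 lam * Num.sqrt (log2 (rank H)%:R)) * Num.sqrt xi.
  (* If all hyperedges have at most one vertex, the claimed bound is 0, but nothing can be cut
     either; otherwise [log2] of the rank is at least 1. *)
  have [r1|r2] := leqP (rank H) 1.
    suff -> : phi = 0.
      apply: mulr_ge0; last exact: sqrtr_ge0.
      apply: mulr_ge0; first by rewrite /abs_const; lra.
      apply: mulr_ge0; last exact: sqrtr_ge0.
      by apply: mulr_ge0; [apply: mulr_ge0|]; lra.
    rewrite /phi /expansion big1 ?mul0r // => e he; exfalso.
    move: he; rewrite /boundary inE => /and3P[he /set0Pn[u] hu /set0Pn[v] hv].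
    move: hu hv; rewrite !inE => /andP[eu Su] /andP[ev Sv].
    have e1 : (#|e| <= 1)%N.
      apply: leq_trans r1.
      exact: (@leq_bigmax_cond _ (fun e => e \in edges H) (fun e : {set V} => #|e|) e he).
    move/card_le1_eqP: e1 => /(_ u v eu ev) uv.
    by rewrite uv Su in Sv.
  have s1 : 1 <= Num.sqrt (log2 (rank H)%:R : R).
    rewrite -[leLHS]sqrtr1; apply: ler_wsqrtr.
    by apply: (@log2_ge 1); rewrite expr1 ler_nat.
  set L := K * lam * log2 lam * _.
  have Kl0 : 0 < K * lam by rewrite mulr_gt0 //; lra.
  have LKl : K * lam <= L.
    rewrite /L -mulrA ler_peMr ?(ltW Kl0) //.
    by apply: (@le_trans _ _ (1 * 1)); [lra|apply: ler_pM; lra].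
  have ac : 1 <= abs_const by rewrite /abs_const; lra.
  apply: le_mul_sqrt => //; first by rewrite mulr_ge0; lra.
  (* When [L * z <= 1], also [K * lam * z <= 1], which makes the quadratic term of [hard_rate]
     linear in [z]. *)
  move=> z z0 hz; have [zL|zL] := leP (L * z) 1; last first.
    apply: (le_trans phi1); apply: (le_trans (ltW zL)).
    rewrite -mulrA ler_peMl //; apply: mulr_ge0; lra.
  apply: le_trans (phiE _ (hB z z0 hz)) _.
  rewrite /hard_rate l8.
  have q0 : 0 <= (13 / 12 : R) ^+ (8 * l) by apply: exprn_ge0; lra.
  have q2 : (13 / 12 : R) ^+ (8 * l) <= 2 * K.
    rewrite exprM; apply: (@le_trans _ _ (2 ^+ l)).
      by apply: lerXn2r; rewrite ?nnegrE ?exprn_ge0 //; lra.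
    by rewrite -natrX -natrM ler_nat ltnW.
  have h1 : (13 / 12) ^+ (8 * l) * (24 * (8 * l%:R) + 6) <= 2 * K * (390 * lam).
    by apply: ler_pM => //; lra.
  have h2 := ler_wpM2r (ltW z0) h1.
  have kz : K * lam * z <= 1 by apply: le_trans zL; rewrite ler_pM2r.
  have Kz0 : 0 <= K * z by rewrite mulr_ge0 // ltW.
  have h3 : K ^+ 2 * (8 * l%:R) * z ^+ 2 <= 16 * (K * z).
    have a1 : 0 <= K ^+ 2 * z ^+ 2 by rewrite mulr_ge0 ?sqr_ge0.
    have a2 := ler_wpM2l a1 lK.
    have a3 := ler_wpM2r Kz0 kz.
    have e1 : K ^+ 2 * (8 * l%:R) * z ^+ 2 = 8 * (K ^+ 2 * z ^+ 2 * l%:R) by ring.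
    have e2 : K ^+ 2 * z ^+ 2 * (2 * lam) = 2 * (K * lam * z * (K * z)) by ring.
    rewrite e1; rewrite e2 in a2; lra.
  have h4 : K * z <= K * lam * z.
    rewrite ler_pM2r // ler_peMr //; lra.
  apply: (@le_trans _ _ (abs_const * (K * lam * z))).
    rewrite /abs_const; have -> : 4 * ((13 / 12) ^+ (8 * l) * (24 * (8 * l%:R) + 6) * z) +
      8 * 101 ^+ 2 * (K ^+ 2 * (8 * l%:R) * z ^+ 2) =
      4 * ((13 / 12) ^+ (8 * l) * (24 * (8 * l%:R) + 6) * z) +
      8 * 101 ^+ 2 * (K ^+ 2 * (8 * l%:R) * z ^+ 2) by [].
    have b1 : 8 * 101 ^+ 2 * (K ^+ 2 * (8 * l%:R) * z ^+ 2) <= 8 * 101 ^+ 2 * (16 * (K * lam * z)).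
      by apply: ler_wpM2l; lra.
    lra.
  rewrite -[abs_const * L * z]mulrA ler_pM2l; last by lra.
  by rewrite ler_pM2r.
rewrite /rate; have [hm|hm] := leP (Num.sqrt ((rank H)%:R * lam))
  (K * lam * log2 lam * Num.sqrt (log2 (rank H)%:R)).
  exact: boundA.
exact: boundB.
Qed.

Lemma expansion_setT : expansion H setT = 0.
Proof.
rewrite /expansion big1 ?mul0r // => e; rewrite /boundary inE => /and3P[_ _].
by rewrite setCT setI0 eqxx.
Qed.

End Bounds.

(** * Conclusion *)

Lemma coin_prob_true (R : realType) T (P : pred (T.-tuple bool)) :
  (forall omega, P omega) -> coin_prob R P = 1.
Proof.
move=> hP; rewrite /coin_prob.
have -> : [set omega | P omega] = setT by apply/setP => w; rewrite !inE hP.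
by rewrite cardsT card_tuple card_bool divff // pnatr_eq0 expn_eq0.
Qed.

Lemma bounded_input (R : realType) (V : finType) (H : hypergraph R V) (k : nat)
  (f : 'I_k -> V -> R) omega : bounded_dims (input_size H k) (input H f omega).
Proof.
rewrite /input_size => -[|[|[|x]]]; rewrite /= /load /=.
- by rewrite -addnA leq_addr.
- by rewrite addnAC leq_addl.
- by rewrite leq_addl.
- by rewrite nth_nil.
Qed.

Lemma small_case (R : realType) (V : finType) (H : hypergraph R V) (k : nat)
  (f : 'I_k -> V -> R) omega (v : V) : (k <= 24)%N ->
  nmem (heval [::] algorithm (input H f omega)) 2 0%N (vi v) = 1%N.
Proof.
move=> k24; have [sz _ _ _ _] := inputP H f omega.
set s := input H f omega in sz *; clearbody s.
rewrite /algorithm heval_if.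
have -> : (hval [::] s nK <= hval [::] s (lit 24)) = true.
  by case: sz => _ _ sK; rewrite /= sK ler_nat.
move: (v); rewrite /=; have /= -> := bval_V sz.
set F := (X in iterN _ X _).
have h := @iterN_inv R (fun m s' =>
   forall v, (vi v < m)%N -> nmem s' 2 0%N (vi v) = 1%N) #|V| F s.
move=> u; apply: h (vi_lt u) => // i s' hi h' w; rewrite ltnS leq_eqVlt /F /= updE eqxx /=.
by case: eqP => //= _; apply: h'.
Qed.

Theorem mainTheorem9 (R : realType) :
  exists (prog : cmd) (c d : nat) (p0 C : R),
    0 < p0 /\ 0 < C /\
    forall (V : finType) (H : hypergraph R V) (k : nat) (f : 'I_k -> V -> R)
           (xi : R),
      (0 < k)%N ->
      orthonormal_w H f ->
      (forall s : 'I_k, discrepancy_ratio H (f s) <= xi) ->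
      let T := (c * input_size H k ^ d)%N in
      let final (omega : T.-tuple bool) := run T prog (input H f omega) in
      (forall omega : T.-tuple bool, halted (final omega)) /\
      p0 <= coin_prob R (fun omega : T.-tuple bool =>
        let S := output_set V (final omega) in
        [&& S != set0,
            #|S|%:R <= 24%:R * #|V|%:R / k%:R :> R &
            expansion H S <=
              C * Num.min
                    (Num.sqrt ((rank H)%:R * log2 k%:R))
                    (k%:R * log2 k%:R * log2 (log2 k%:R)
                       * Num.sqrt (log2 (rank H)%:R))
                * Num.sqrt xi]).
Proof.
have [A [D hAD]] := poly_bounded_ccost algorithm.
(* No construct of the source language compiles to [Flip], so the same set is returned for all coin
   sequences and the success probability is 1. *)
exists (ccmd 0 algorithm), A, D, 1, (abs_const R).
split; first exact: ltr01.
split; first by rewrite /abs_const; lra.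
move=> V H k f xi k0 f_orth f_disc T final.
have size0 : (0 < input_size H k)%N by rewrite /input_size addn_gt0 k0 orbT.
have hT := hAD _ size0; rewrite -/T in hT.
have hrun omega := run_ccmd algorithm_wf (bounded_input H f omega) hT.
split=> [omega|].
  by rewrite /final; have [o [-> _]] := hrun omega.
rewrite coin_prob_true // => omega /=.
have [o [ho [_ co _]]] := hrun omega; rewrite /final ho.
have outE (S : {set V}) : (forall v, nmem (heval [::] algorithm (input H f omega)) 2 0%N (vi v)
    = (v \in S) :> nat) -> output_set V ([::], o) = S.
  move=> hS; apply/setP => v; rewrite inE /= co // hS.
  by case: (v \in S).
have K0 : 0 < k%:R :> R by rewrite ltr0n.
(* For [k <= 24] the allowed size is at least [|V|], so the output is all of [V], which is nonempty
   because an orthonormal family with [k > 0] needs a vertex. *)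
have [k24|k25] := leqP k 24.
  rewrite (outE setT) => [|v]; last by rewrite small_case // inE.
  have [v _] := vertex_exists f_orth k0.
  apply/and3P; split.
  - by apply/set0Pn; exists v; rewrite inE.
  - by rewrite cardsT ler_pdivlMr // mulrC ler_wpM2r // ler_nat.
  - rewrite expansion_setT; apply: mulr_ge0; last exact: sqrtr_ge0.
    by apply: mulr_ge0; [rewrite /abs_const; lra|exact: rate_ge0].
have [l [S [l1 l2 l0 [S0 S1 S2 S3 S4]]]] := algorithmP f_orth f_disc k25 omega.
rewrite (outE S S2); apply/and3P; split=> //.
  by rewrite ler_pdivlMr // -!natrM ler_nat.
exact: (expansion_le_rate f_disc k25 l2 l0 S0 S3 S4).
Qed.
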